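(* Let $\mathcal{U} = \ker A \cap \mathbb{S}^{n-1}$. Suppose that there exists $J \in \mathbb{N}$ such that for every $x \in \mathcal{U}$, if $X_t$ solves the ODE $$\frac{d}{dt} X_t = B(X_t,X_t), \qquad X_0 = x,$$ then there exists $j \leq J$ such that $$\Pi_{(\ker A)^{\perp}} \frac{d^j}{dt^j} X_t \Big|_{t = 0} \neq 0.$$ Then the SDE $dx_t = B(x_t,x_t)dt - Ax_t dt + \sigma dW_t$ has at least one stationary measure $\mu$, and $\langle x\rangle^p \in L^1(d\mu)$ for all $p < \infty$.
   Context: Consider the SDE in $\mathbb{R}^n$: $dx_t = B(x_t,x_t)dt - A x_t dt + \sigma dW_t$, $x_t|_{t=0}=x_0\in\mathbb{R}^n$, where $W_t$ is an $n$-dimensional standard Brownian motion, $A \in \mathbb{R}^{n\times n}$ is positive semi-definite with nontrivial kernel, $\sigma \in \mathbb{R}^{n\times n}$ is arbitrary (no rank condition), and $B:\mathbb{R}^n\times\mathbb{R}^n\to\mathbb{R}^n$ is bilinear with $x\cdot B(x,x)=0$ for all $x\in\mathbb{R}^n$. The SDE is globally well-posed. Let $\mathcal{P}_t f(x)=\mathbf{E}[f(x_t)\mid x_0=x]$ be its Markov semigroup on bounded Borel functions and $\mathcal{P}_t^*$ the dual action on Borel probability measures. A stationary measure is a Borel probability measure $\mu$ with $\mathcal{P}_t^*\mu=\mu$ for all $t\ge 0$. For a subspace $S$, $\Pi_S$ is the orthogonal projection onto $S$. $\mathbb{S}^{n-1}$ is the unit sphere and $\langle x\rangle=(1+|x|^2)^{1/2}$.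 *)

(* Defs.v *)
From HB Require Import structures.
From mathcomp Require Import all_boot all_order all_algebra.
From mathcomp Require Import all_classical all_reals all_analysis.

Set Implicit Arguments.
Unset Strict Implicit.
Unset Printing Implicit Defensive.

Import Order.TTheory GRing.Theory Num.Theory.
Import numFieldNormedType.Exports.

Local Open Scope classical_set_scope.
Local Open Scope ring_scope.

(** Euclidean structure of R^n = 'cV[R]_n. The library norm on matrices is the
    max norm: it is used below only through its topology. *)

Definition dotv (R : realType) (n : nat) (x y : 'cV[R]_n) : R :=
  \sum_i x i 0 * y i 0.

Definition enorm (R : realType) (n : nat) (x : 'cV[R]_n) : R :=
  Num.sqrt (dotv x x).

Definition bracket (R : realType) (n : nat) (x : 'cV[R]_n) : R :=
  Num.sqrt (1 + enorm x ^+ 2).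

Definition kerv (R : realType) (n : nat) (A : 'M[R]_n) : set 'cV[R]_n :=
  [set x | A *m x = 0].

Definition orthc (R : realType) (n : nat) (S : set 'cV[R]_n) :
    set 'cV[R]_n :=
  [set y | forall z, S z -> dotv y z = 0].

(** Orthogonal projection onto S: when S is a linear subspace, the set below is
    a singleton (for other S the value is not meaningful). *)
Definition orthproj (R : realType) (n : nat) (S : set 'cV[R]_n)
    (x : 'cV[R]_n) : 'cV[R]_n :=
  xget 0 [set y | S y /\ orthc S (x - y)].

Definition usphere (R : realType) (n : nat) : set 'cV[R]_n :=
  [set x | enorm x = 1].

(** As usual, a positive semi-definite matrix is in particular symmetric. *)
Definition psdmx (R : realType) (n : nat) (A : 'M[R]_n) : Prop :=
  A^T = A /\ forall x : 'cV[R]_n, 0 <= dotv x (A *m x).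

Definition ode_solution (R : realType) (n : nat)
    (F : 'cV[R]_n -> 'cV[R]_n) (x : 'cV[R]_n) (X : R -> 'cV[R]_n) : Prop :=
  X 0 = x /\ forall t : R, is_derive t (1 : R) X (F (X t)).

(** R^n with its Borel sigma-algebra. *)
Definition borelV (R : realType) (n : nat) :=
  g_sigma_algebraType (@open 'cV[R]_n).

(** Mutual independence of a finite family of random variables; the product
    rule for subfamilies is the case where some of the E j are the full set. *)
Definition independent_family (R : realType) (d : measure_display)
    (Omega : measurableType d) (P : probability Omega R)
    (d' : measure_display) (T : measurableType d') (k : nat)
    (Y : 'I_k -> Omega -> T) : Prop :=
  forall E : 'I_k -> set T, (forall j, measurable (E j)) ->
    P [set w | forall j, E j (Y j w)] =
    (\prod_(j < k) P [set w | E j (Y j w)])%E.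

(** Law N(0, v I_n), v > 0: the coordinates are independent and each of them is
    a centered normal variable with standard deviation sqrt v. *)
Definition has_law_normal_iso (R : realType) (n : nat) (d : measure_display)
    (Omega : measurableType d) (P : probability Omega R)
    (v : R) (Y : Omega -> 'cV[R]_n) : Prop :=
  forall E : 'I_n -> set R, (forall i, measurable (E i)) ->
    P [set w | forall i, E i (Y w i 0)] =
    (\prod_(i < n) normal_prob 0 (Num.sqrt v) (E i))%E.

(** Processes are indexed by R; only the times t >= 0 are constrained. *)
Definition standard_brownian_motion (R : realType) (n : nat)
    (d : measure_display) (Omega : measurableType d) (P : probability Omega R)
    (W : R -> Omega -> borelV R n) : Prop :=
  [/\ forall t, 0 <= t -> measurable_fun setT (W t),
      {ae P, forall w, W 0 w = 0 :> 'cV[R]_n},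
      {ae P, forall w,
        {within `[0, +oo[, continuous (fun t => W t w : 'cV[R]_n)}},
      forall (k : nat) (t : nat -> R), 0 <= t 0%N ->
        (forall j, t j <= t j.+1) ->
        independent_family P
          (fun (j : 'I_k) w => (W (t j.+1) w - W (t j) w : 'cV[R]_n)
                               : borelV R n) &
      forall s t, 0 <= s -> s < t ->
        has_law_normal_iso P (t - s)
          (fun w => W t w - W s w : 'cV[R]_n)].

Definition drift (R : realType) (n : nat)
    (B : 'cV[R]_n -> 'cV[R]_n -> 'cV[R]_n) (A : 'M[R]_n) (x : 'cV[R]_n) :
    'cV[R]_n :=
  B x x - A *m x.

(** Y solves dY = F(Y) dt + sigma dW, Y_0 = x. The noise is additive, hence the
    equation is the pathwise integral equation
      Y_t = x + \int_0^t F(Y_s) ds + sigma W_t. *)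
Definition sde_solution (R : realType) (n : nat) (d : measure_display)
    (Omega : measurableType d) (P : probability Omega R)
    (F : 'cV[R]_n -> 'cV[R]_n) (sigma : 'M[R]_n)
    (W : R -> Omega -> borelV R n) (x : 'cV[R]_n)
    (Y : R -> Omega -> borelV R n) : Prop :=
  (forall t, 0 <= t -> measurable_fun setT (Y t)) /\
  {ae P, forall w,
    {within `[0, +oo[, continuous (fun t => Y t w : 'cV[R]_n)} /\
    forall t, 0 <= t ->
      (Y t w : 'cV[R]_n) =
      x + (\col_i \int[lebesgue_measure]_(s in `[0, t]) (F (Y s w) i 0))
        + sigma *m (W t w : 'cV[R]_n)}.

(** P_t f (x) = E[f(x_t) | x_0 = x], where X x is the solution started at x. *)
Definition markov_semigroup (R : realType) (n : nat) (d : measure_display)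
    (Omega : measurableType d) (P : probability Omega R)
    (X : 'cV[R]_n -> R -> Omega -> borelV R n)
    (t : R) (f : borelV R n -> R) (x : borelV R n) : \bar R :=
  expectation P (fun w => f (X x t w)).

(** P_t^* mu (E) = \int P_t 1_E dmu. *)
Definition dual_semigroup (R : realType) (n : nat) (d : measure_display)
    (Omega : measurableType d) (P : probability Omega R)
    (X : 'cV[R]_n -> R -> Omega -> borelV R n)
    (t : R) (mu : probability (borelV R n) R) (E : set (borelV R n)) : \bar R :=
  (\int[mu]_x markov_semigroup P X t \1_E x)%E.

Definition stationary_measure (R : realType) (n : nat) (d : measure_display)
    (Omega : measurableType d) (P : probability Omega R)
    (X : 'cV[R]_n -> R -> Omega -> borelV R n)
    (mu : probability (borelV R n) R) : Prop :=
  forall t, 0 <= t -> forall E, measurable E ->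
    dual_semigroup P X t mu E = mu E.

(* Main.v *)
(** Write [x = v + sigma W].  Since [x . B(x, x) = 0], the energy [|v|^2] changes at the rate
    [- 2 x . A x] up to terms bounded by [|sigma W| |x|^2].  Seen from a point of large norm [r],
    after rescaling space by [r] and time by [1 / r], a path is a small perturbation of a
    solution of [Y' = B(Y, Y)] on the unit sphere.  By hypothesis such a solution cannot stay in
    [ker A], for all its derivatives would lie there too.  By compactness of the
    sphere a path dissipates an energy of order at least [r] during a time [1 / r], that is, a
    fixed fraction of [r^2] per unit of time.  So [|v_T|^2 <= |x|^2 exp (C \int |sigma W| - c T) + M]
    for every path, with [M] depending on [sup |sigma W|], and since the moments of the exponential of [\int |sigma W|] are [1 + o(T)],
    all the moments satisfy a drift condition
    [E |x_T|^(2p) <= gamma |x|^(2p) + K] with [gamma < 1].  The limit along an ultrafilter of the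
    time averages of the semigroup is then a tight functional on bounded continuous functions,
    represented by a measure with all its moments.  It is stationary because the
    semigroup is Feller and Markov at dyadic times, which is inherited from Euler schemes
    driven by discretised increments: these are finite Markov chains. *)
Require Import Defs.
From HB Require Import structures.
From mathcomp Require Import all_boot all_order all_algebra.
From mathcomp Require Import all_classical all_reals all_analysis.
From mathcomp Require Import measurable_realfun.
From mathcomp Require Import ring lra.

Set Implicit Arguments.
Unset Strict Implicit.
Unset Printing Implicit Defensive.

Import Order.TTheory GRing.Theory Num.Theory.
Import numFieldNormedType.Exports.

Local Open Scope classical_set_scope.
Local Open Scope ring_scope.

(** * Energy estimates along driven paths *)

(** The data are a family of pathwise solutions, each valid off a null set of its own, with nothing
    prescribed about the dependence on the starting point: measurability in that point, continuity
    and the Markov property all have to be derived. Likewise [escape] speaks of solutions of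
    [Y' = B(Y, Y)] without producing any; they are obtained by rescaling SDE solutions started at
    [k x] along one fixed noise path. The exponent in the energy estimates is the integral of
    [|sigma W|] over [[0, T]], because Jensen's inequality reduces its exponential moments to those
    of Gaussian variables at fixed times. It has typical size [T^(3/2)], against a gain [c T] from
    dissipation, so that a short time [T] gives a mean factor below 1. The additive constant [M]
    depends on the supremum of the noise in an uncontrolled way and is never integrated. The drift
    condition is reached by contradiction, along starting points that tend to infinity, where
    [M / |x|^2] vanishes path by path. *)

Lemma is_derive_nincr (R : realType) (f df : R -> R) (a b : R) : a <= b ->
  (forall t, a <= t <= b -> is_derive t (1:R) f (df t)) ->
  (forall t, a < t < b -> df t <= 0) -> f b <= f a.
Proof.
move=> ab fd dle0.
have cf : {within `[a, b], continuous f}.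
  apply: derivable_within_continuous => x; rewrite in_itv /= => xab.
  exact: (@ex_derive _ _ _ _ _ _ _ (fd x xab)).
have dfd x : x \in `]a, b[ ->
    is_derive x 1 f ((fun t => if (a < t < b) then df t else 0) x).
  rewrite in_itv /= => xab; rewrite xab; apply: fd.
  by case/andP: xab => /ltW -> /ltW ->.
have [c] := MVT_segment ab dfd cf.
move=> _ E; rewrite -subr_le0 E; apply: mulr_le0_ge0; last by rewrite subr_ge0.
by case: ifP => // h; exact: dle0.
Qed.

Lemma is_derive_ndecr (R : realType) (f df : R -> R) (a b : R) : a <= b ->
  (forall t, a <= t <= b -> is_derive t (1:R) f (df t)) ->
  (forall t, a < t < b -> 0 <= df t) -> f a <= f b.
Proof.
move=> ab fd df0; rewrite -lerN2.
apply: (@is_derive_nincr _ (fun t => - f t) (fun t => - df t)) => // t tab.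
  by apply: is_deriveN; exact: fd.
by rewrite oppr_le0 df0.
Qed.

Lemma is_derive_growth (R : realType) (f df : R -> R) (a b c : R) : a <= b ->
  (forall t, a <= t <= b -> is_derive t (1:R) f (df t)) ->
  (forall t, a < t < b -> df t <= c) -> f b - f a <= c * (b - a).
Proof.
move=> ab fd dc.
have := @is_derive_nincr _ (fun s => f s - c * s) (fun s => df s - c) a b ab.
have -> : (f b - c * b <= f a - c * a) = (f b - f a <= c * (b - a)).
  by apply/idP/idP; lra.
apply.
  move=> s sab; apply: is_deriveB; first exact: fd.
  by rewrite -[X in is_derive _ _ _ X]mulr1; apply: is_deriveZ.
by move=> s sab; rewrite subr_le0 dc.
Qed.

(** * Euclidean product against the max norm; boundedness of linear and bilinear maps *)

Section Euclid.
Context {R : realType} {n : nat}.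
Implicit Types x y : 'cV[R]_n.

Lemma coord_le_norm x i : `|x i 0| <= `|x|.
Proof.
rewrite [leRHS]/Num.norm /= mx_normrE.
by apply: (le_bigmax _ (fun ij : 'I_n * 'I_1 => `|x ij.1 ij.2|) (i, 0)).
Qed.

Lemma norm_le_coord x (c : R) : 0 <= c -> (forall i, `|x i 0| <= c) -> `|x| <= c.
Proof.
move=> c0 h; rewrite [leLHS]/Num.norm /= mx_normrE.
by apply/bigmax_leP; split => // -[i j] _ /=; rewrite ord1.
Qed.

Lemma dotvDl x y z : dotv (x + y) z = dotv x z + dotv y z.
Proof. by rewrite /dotv -big_split; apply: eq_bigr => i _; rewrite mxE mulrDl. Qed.
Lemma dotvC x y : dotv x y = dotv y x.
Proof. by apply: eq_bigr => i _; rewrite mulrC. Qed.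
Lemma dotvDr x y z : dotv z (x + y) = dotv z x + dotv z y.
Proof. by rewrite dotvC dotvDl !(dotvC z). Qed.
Lemma dotvZl (a : R) x y : dotv (a *: x) y = a * dotv x y.
Proof. by rewrite /dotv mulr_sumr; apply: eq_bigr => i _; rewrite mxE mulrA. Qed.
Lemma dotvZr (a : R) x y : dotv y (a *: x) = a * dotv y x.
Proof. by rewrite dotvC dotvZl dotvC. Qed.
Lemma dotvNl x y : dotv (- x) y = - dotv x y.
Proof. by rewrite -scaleN1r dotvZl mulN1r. Qed.
Lemma dotvNr x y : dotv y (- x) = - dotv y x.
Proof. by rewrite -scaleN1r dotvZr mulN1r. Qed.
Lemma dotvBl x y z : dotv (x - y) z = dotv x z - dotv y z.
Proof. by rewrite dotvDl dotvNl. Qed.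
Lemma dotvBr x y z : dotv z (x - y) = dotv z x - dotv z y.
Proof. by rewrite dotvDr dotvNr. Qed.
Lemma dotv0 y : dotv y 0 = 0.
Proof. by rewrite -(scale0r y) dotvZr mul0r. Qed.

Lemma dotv_ge0 x : 0 <= dotv x x.
Proof. by apply: sumr_ge0 => i _; rewrite -expr2 sqr_ge0. Qed.

Lemma norm_sqr_le_dotv x : `|x| ^+ 2 <= dotv x x.
Proof.
rewrite -[leRHS]sqr_sqrtr ?dotv_ge0// ler_sqr ?nnegrE ?normr_ge0 ?sqrtr_ge0//.
apply: norm_le_coord; first exact: sqrtr_ge0.
move=> i; rewrite -sqrtr_sqr ler_sqrt ?dotv_ge0// /dotv (bigD1 i)//= -expr2 lerDl.
by apply: sumr_ge0 => j _; rewrite -expr2 sqr_ge0.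
Qed.

Lemma dotv_le_norm x y : `|dotv x y| <= n%:R * (`|x| * `|y|).
Proof.
apply: (le_trans (ler_norm_sum _ _ _)).
rewrite -[X in X%:R * _](card_ord n) -sumr_const mulr_suml; apply: ler_sum => i _.
by rewrite mul1r normrM ler_pM// coord_le_norm.
Qed.

Lemma enorm_ge0 x : 0 <= enorm x. Proof. exact: sqrtr_ge0. Qed.
Lemma enormE x : enorm x ^+ 2 = dotv x x.
Proof. by rewrite sqr_sqrtr ?dotv_ge0. Qed.

Lemma norm_le_enorm x : `|x| <= enorm x.
Proof.
by rewrite -ler_sqr ?nnegrE ?normr_ge0 ?enorm_ge0// enormE norm_sqr_le_dotv.
Qed.

Lemma dotv_eq0 x : dotv x x = 0 -> x = 0.
Proof.
move=> x0; apply/normr0_eq0/eqP; rewrite -sqrf_eq0 eq_le sqr_ge0 andbT -x0.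
exact: norm_sqr_le_dotv.
Qed.

Lemma enormZ (a : R) x : enorm (a *: x) = `|a| * enorm x.
Proof.
by rewrite /enorm dotvZl dotvZr mulrA -expr2 sqrtrM ?sqr_ge0// sqrtr_sqr.
Qed.

Lemma mulmx_bounded m (A : 'M[R]_(m, n)) : exists2 K : R, 0 <= K &
  forall x, `|A *m x| <= K * `|x|.
Proof.
exists (\sum_i \sum_j `|A i j|).
  by apply: sumr_ge0 => i _; apply: sumr_ge0.
move=> x; rewrite [leLHS]/Num.norm /= mx_normrE; apply/bigmax_leP; split.
  by rewrite mulr_ge0// sumr_ge0// => i _; apply: sumr_ge0.
move=> -[i j] _ /=; rewrite mxE ord1; apply: (le_trans (ler_norm_sum _ _ _)).
rewrite (bigD1 i)//= mulrDl mulr_suml -[leLHS]addr0 lerD//.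
  by apply: ler_sum => k _; rewrite normrM ler_wpM2l// coord_le_norm.
by rewrite mulr_ge0// sumr_ge0// => i' _; apply: sumr_ge0.
Qed.

Lemma cvE x : x = \sum_i x i 0 *: delta_mx i 0.
Proof.
by rewrite [LHS]matrix_sum_delta; apply: eq_bigr => i _; rewrite big_ord1.
Qed.

Lemma bilinear_bounded (B : {bilinear 'cV[R]_n -> 'cV[R]_n -> 'cV[R]_n}) :
  exists2 K : R, 0 <= K & forall x y, `|B x y| <= K * (`|x| * `|y|).
Proof.
pose e i : 'cV[R]_n := delta_mx i 0.
exists (\sum_i \sum_j `|B (e i) (e j)|).
  by apply: sumr_ge0 => i _; apply: sumr_ge0.
move=> x y; rewrite [in leLHS](cvE x) [in leLHS](cvE y) linear_sumlz.
apply: (le_trans (ler_norm_sum _ _ _)); rewrite mulr_suml; apply: ler_sum => i _.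
rewrite linearZl_LR linear_sumr normrZ -mulrCA mulr_suml.
apply: (le_trans (ler_wpM2l (normr_ge0 _) (ler_norm_sum _ _ _))).
apply: ler_pM; rewrite ?sumr_ge0 ?coord_le_norm//.
apply: ler_sum => j _; rewrite linearZr_LR normrZ mulrC ler_wpM2l//.
exact: coord_le_norm.
Qed.

End Euclid.

Lemma continuous_primitive (R : realType) (f : R -> R) : continuous f ->
  exists2 G : R -> R, forall t : R, 0 <= t -> is_derive t (1:R) G (f t) &
    forall t : R, 0 <= t ->
      G t = (\int[lebesgue_measure]_(s in `[0%R, t]) f s)%R.
Proof.
move=> cf.
have intf (a b : R) : lebesgue_measure.-integrable `[a, b] (EFin \o f).
  apply: continuous_compact_integrable; first exact: segment_compact.
  exact: continuous_subspaceT.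
(* The lower limit -1 makes 0 an interior point, so that the derivative at 0 is two-sided. *)
pose G t := (\int[lebesgue_measure]_(s in `[(-1)%R, t]) f s)%R.
pose G0 := G 0.
exists (fun t => G t - G0).
  move=> t t0.
  have [||||dG G't] := @continuous_FTC1_closed R f (-1) t (t + 1).
  - by rewrite ltrDl.
  - exact: intf.
  - by rewrite (lt_le_trans _ t0)// oppr_lt0.
  - exact: cf.
  have dG1 : is_derive t (1:R) G (f t) by rewrite -G't derive1E; exact: derivableP.
  by rewrite -[f t]subr0; apply: is_deriveB; exact: is_derive_cst.
move=> t t0; rewrite /G0 /G.
rewrite Rintegral_itvB ?bnd_simp ?lerN10// Rintegral_itv_obnd_cbnd//.
by apply: integrableS (intf 0 t) => //; exact: subset_itv_oc_cc.
Qed.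

(** Coordinatewise, so that the calculus of real functions applies directly; [cderivP] identifies it
    with [is_derive]. *)
Definition cderiv (R : realType) (n : nat) (v : R -> 'cV[R]_n) (t : R)
    (w : 'cV[R]_n) : Prop :=
  forall i, is_derive t (1:R) (fun s => v s i 0 : R) (w i 0).

(* [u = v + g] solves the integral equation [u_t = u_0 - g_0 + \int_0^t F u + g_t]; the
   absolutely continuous part [v] is extended to negative times so that it is
   differentiable at 0. *)
Definition driven (R : realType) (n : nat) (F : 'cV[R]_n -> 'cV[R]_n)
    (u g v : R -> 'cV[R]_n) : Prop :=
  [/\ continuous u, continuous g, forall t, 0 <= t -> u t = v t + g t &
      forall t, 0 <= t -> cderiv v t (F (u t))].

Lemma is_derive_dotv (R : realType) (n : nat) (v : R -> 'cV[R]_n) t w :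
  cderiv v t w ->
  is_derive t (1:R) (fun s => dotv (v s) (v s) : R) (2 * dotv (v t) w).
Proof.
move=> vw.
have -> : (fun s => dotv (v s) (v s)) = \sum_(i < n) (fun s : R => v s i 0 * v s i 0).
  by apply/funext => s; rewrite fct_sumE.
apply: is_derive_eq.
  by apply: is_derive_sum => i; apply: is_deriveM; exact: vw.
rewrite /dotv mulr_sumr; apply: eq_bigr => i _; rewrite /GRing.scale /=; ring.
Qed.

(** Both rescalings of the proof are instances with [a = b]: a quadratic field satisfies the
    hypothesis with [F' = F], and linear damping gets multiplied by [b]. *)
Lemma driven_scale (R : realType) (n : nat) (F F' : 'cV[R]_n -> 'cV[R]_n)
    (u g v : R -> 'cV[R]_n) (a b : R) : 0 <= a ->
  (forall x, F' (b *: x) = (b * a) *: F x) ->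
  driven F u g v ->
  driven F' (fun t => b *: u (a * t)) (fun t => b *: g (a * t)) (fun t => b *: v (a * t)).
Proof.
move=> a0 FF [cu cg uvg dv]; split.
- move=> t; apply: continuousZl_tmp; apply: continuous_comp; last exact: cu.
  exact: mulrl_continuous.
- move=> t; apply: continuousZl_tmp; apply: continuous_comp; last exact: cg.
  exact: mulrl_continuous.
- by move=> t t0; rewrite uvg ?mulr_ge0// scalerDr.
- move=> t t0 i; rewrite FF !mxE.
  have at0 : 0 <= a * t by rewrite mulr_ge0.
  have -> : (fun s => (b *: v (a * s)) i 0) = b *: ((fun s => v s i 0) \o ( *%R a)).
    by apply/funext => s; rewrite mxE.
  rewrite -mulrA; apply: is_deriveZ.
  have h := dv _ at0 i.
  have ha : is_derive t (1:R) ( *%R a) a.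
    by rewrite -[X in is_derive _ _ _ X]mulr1; apply: is_deriveZ.
  by rewrite mulrC; apply: is_derive1_comp.
Qed.

Lemma driven_shift (R : realType) (n : nat) (F : 'cV[R]_n -> 'cV[R]_n)
    (u g v : R -> 'cV[R]_n) (a : R) : 0 <= a ->
  driven F u g v ->
  driven F (fun t => u (a + t)) (fun t => g (a + t)) (fun t => v (a + t)).
Proof.
move=> a0 [cu cg uvg dv]; split.
- move=> t; apply: continuous_comp; last exact: cu.
  by apply: continuousD => //; exact: cst_continuous.
- move=> t; apply: continuous_comp; last exact: cg.
  by apply: continuousD => //; exact: cst_continuous.
- by move=> t t0; rewrite uvg ?addr_ge0.
- move=> t t0 i.
  have := dv _ (addr_ge0 a0 t0) i => h.
  have -> : (fun s => (v (a + s)) i 0) = (fun s => v s i 0) \o (fun s => a + s) by [].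
  rewrite -[X in is_derive _ _ _ X]mulr1.
  apply: is_derive1_comp.
  rewrite -[X in is_derive _ _ _ X]add0r; apply: is_deriveD.
Qed.

Section Energy.
Context {R : realType} {n : nat}.
Variables (B : {bilinear 'cV[R]_n -> 'cV[R]_n -> 'cV[R]_n}) (A : 'M[R]_n).
Hypothesis Bcons : forall x : 'cV[R]_n, dotv x (B x x) = 0.
Hypothesis Apsd : forall x : 'cV[R]_n, 0 <= dotv x (A *m x).
Variable K : R.
Hypothesis K1 : 1 <= K.
Hypothesis BK : forall x y : 'cV[R]_n, `|B x y| <= K * (`|x| * `|y|).
Hypothesis AK : forall x : 'cV[R]_n, `|A *m x| <= K * `|x|.
Hypothesis dK : forall x y : 'cV[R]_n, `|dotv x y| <= K * (`|x| * `|y|).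

Let K0 : 0 <= K. Proof. exact: le_trans K1. Qed.

(** Testing against [u] kills [B u u], so the noise enters only through its products with [B u u]
    and [A *m u]: the error is quadratic in [u], not cubic. *)
Lemma energy_rate (u g : 'cV[R]_n) :
  2 * dotv (u - g) (drift B A u) <=
  - (2 * dotv u (A *m u)) + 2 * K ^+ 2 * `|g| * (`|u| ^+ 2 + `|u|).
Proof.
rewrite /drift dotvBl !dotvBr Bcons sub0r.
have h1 := dK g (B u u); have h2 := dK g (A *m u).
have h3 : K * (`|g| * `|B u u|) <= K ^+ 2 * `|g| * `|u| ^+ 2.
  have -> : K ^+ 2 * `|g| * `|u| ^+ 2 = K * (`|g| * (K * (`|u| * `|u|))) by ring.
  by rewrite ler_wpM2l// ler_wpM2l// BK.
have h4 : K * (`|g| * `|A *m u|) <= K ^+ 2 * `|g| * `|u|.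
  have -> : K ^+ 2 * `|g| * `|u| = K * (`|g| * (K * `|u|)) by ring.
  by rewrite ler_wpM2l// ler_wpM2l// AK.
move: h1 h2; rewrite !ler_norml => /andP[h1 h1'] /andP[h2 h2'].
lra.
Qed.

(** The dissipation is dropped. Since [|u| <= |v| + |g|], the error [|g| (|u|^2 + |u|)] is linear in
    [dotv v v] up to a source that is cubic in [|g|]. *)
Lemma crude_rate (u g v : 'cV[R]_n) : u = v + g ->
  2 * dotv v (drift B A u) <=
  16 * K ^+ 2 * (`|g| * dotv v v + (1 + `|g|) ^+ 3).
Proof.
move=> uvg; have -> : v = u - g by rewrite uvg addrK.
apply: le_trans (energy_rate u g) _.
have Au := Apsd u.
have hu : `|u| <= `|u - g| + `|g| by rewrite -{1}(subrK g u) ler_normD.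
have := norm_sqr_le_dotv (u - g).
set a := `|u - g| in hu *; set b := `|g| in hu *; set c := `|u| in hu *.
set q := dotv (u - g) (u - g).
have a0 : 0 <= a by exact: normr_ge0.
have b0 : 0 <= b by exact: normr_ge0.
have c0 : 0 <= c by exact: normr_ge0.
move=> aq.
have K20 : 0 <= K ^+ 2 by exact: sqr_ge0.
suff : 2 * b * (c ^+ 2 + c) <= 16 * (b * q + (1 + b) ^+ 3) by nra.
have c2 : c ^+ 2 <= (a + b) ^+ 2 by rewrite lerXn2r// nnegrE addr_ge0.
have ab : 0 <= (a - b) ^+ 2 by exact: sqr_ge0.
have c1 : 0 <= (c - 1) ^+ 2 by exact: sqr_ge0.
have hc : c ^+ 2 + c <= 4 * q + 4 * b ^+ 2 + 1.
  by move: c2 ab c1; rewrite !sqrrB sqrrD expr1n mulr1; lra.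
have b3 : 0 <= b ^+ 3 by rewrite exprn_ge0.
have b2 : 0 <= b ^+ 2 by rewrite exprn_ge0.
have hb : b * (c ^+ 2 + c) <= b * (4 * q + 4 * b ^+ 2 + 1) by rewrite ler_wpM2l.
have hq : 0 <= b * q by rewrite mulr_ge0// dotv_ge0.
have -> : 16 * (b * q + (1 + b) ^+ 3) =
  16 * (b * q) + 16 + 48 * b + 48 * b ^+ 2 + 16 * b ^+ 3 by ring.
have : b * (4 * q + 4 * b ^+ 2 + 1) = 4 * (b * q) + 4 * b ^+ 3 + b by ring.
lra.
Qed.

(** Gronwall's argument with the integrating factor [expR (- (C * G t))], which is at most 1, so
    that the source contributes at most [C * H T]. The integral [G T] is kept in place of [T] times
    a supremum for the sake of exponential moments. *)
Lemma driven_crude (u g v : R -> 'cV[R]_n) (G H : R -> R) (T : R) :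
  0 <= T -> driven (drift B A) u g v ->
  (forall t : R, 0 <= t -> is_derive t (1:R) G `|g t|) -> G 0 = 0 ->
  (forall t : R, 0 <= t -> is_derive t (1:R) H ((1 + `|g t|) ^+ 3)) -> H 0 = 0 ->
  dotv (v T) (v T) <=
    expR (16 * K ^+ 2 * G T) * (dotv (v 0) (v 0) + 16 * K ^+ 2 * H T).
Proof.
move=> T0 [cu cg uvg dv] dG G0 dH H0.
set C := 16 * K ^+ 2.
have C0 : 0 <= C by rewrite mulr_ge0// sqr_ge0.
have Gge0 t : 0 <= t -> 0 <= G t.
  move=> t0; rewrite -G0; apply: (@is_derive_ndecr _ G (fun s => `|g s|)) => //.
  by move=> s /andP[s0 _]; apply: dG.
have h : dotv (v T) (v T) * expR (- (C * G T)) - C * H T <=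
         dotv (v 0) (v 0) * expR (- (C * G 0)) - C * H 0.
  pose e t := expR (- (C * G t)).
  apply: (@is_derive_nincr _ (fun s => dotv (v s) (v s) * e s - C * H s)
   (fun s => (dotv (v s) (v s) * (e s * - (C * `|g s|)) +
              e s * (2 * dotv (v s) (drift B A (u s)))) - C * (1 + `|g s|) ^+ 3)) => //.
    move=> t /andP[t0 _]; apply: is_deriveB; last first.
      by apply: is_deriveZ; apply: dH.
    apply: is_deriveM; first exact/is_derive_dotv/dv.
    apply: (@is_derive1_comp _ expR (fun s => - (C * G s))).
    by apply: is_deriveN; apply: is_deriveZ; apply: dG.
  move=> t /andP[t0 _]; have := crude_rate (uvg t (ltW t0)); rewrite -/C.
  have e0 : 0 <= e t by exact: expR_ge0.
  have e1 : e t <= 1.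
    by rewrite -expR0 ler_expR oppr_le0 mulr_ge0// Gge0// ltW.
  set x := 2 * _; set q := dotv _ _; set b := `|g t|.
  have b0 : 0 <= b by exact: normr_ge0.
  have b3 : 0 <= (1 + b) ^+ 3 by rewrite exprn_ge0// addr_ge0.
  move=> xle; have : e t * x <= e t * (C * (b * q + (1 + b) ^+ 3)) by exact: ler_wpM2l.
  have : e t * (C * (1 + b) ^+ 3) <= C * (1 + b) ^+ 3.
    by rewrite ler_piMl// mulr_ge0.
  lra.
move: h; rewrite G0 H0 mulr0 oppr0 expR0 mulr1 addr0 lerBlDr => h.
rewrite -[leLHS](mulfVK (_ : expR (- (C * G T)) != 0)) ?gt_eqF ?expR_gt0//.
by rewrite -expRN opprK mulrAC [leLHS]mulrC ler_wpM2l ?expR_ge0.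
Qed.

Lemma driven_bounded (u g v : R -> 'cV[R]_n) (S T : R) :
  driven (drift B A) u g v -> (forall t, 0 <= t <= T -> `|g t| <= S) ->
  forall t, 0 <= t <= T -> dotv (v t) (v t) <=
    expR (16 * K ^+ 2 * (S * T)) * (dotv (v 0) (v 0) + 16 * K ^+ 2 * ((1 + S) ^+ 3 * T)).
Proof.
move=> dr gS t /andP[t0 tT]; have [cu cg uvg dv] := dr.
have cng : continuous (fun t => `|g t|).
  by move=> s; apply: continuous_comp; [exact: cg|exact: norm_continuous].
have [G dG _] := continuous_primitive cng.
have cng3 : continuous (fun t => (1 + `|g t|) ^+ 3).
  move=> s; apply: (@continuous_comp _ _ _ (fun s => 1 + `|g s|) (fun x => x ^+ 3)).
    by apply: continuousD; [exact: cst_continuous|exact: cng].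
  exact: exprn_continuous.
have [H dH _] := continuous_primitive cng3.
have S0 : 0 <= S.
  by rewrite (le_trans (normr_ge0 (g 0)))// gS// lexx (le_trans t0).
have bd (F f : R -> R) c : 0 <= c ->
    (forall t : R, 0 <= t -> is_derive t (1:R) F (f t)) ->
    (forall s, 0 <= s <= T -> f s <= c) -> F t - F 0 <= c * T.
  move=> c0 dF fc; apply: (@le_trans _ _ (c * t)); last exact: ler_wpM2l.
  rewrite -[X in c * X]subr0; apply: (is_derive_growth t0).
    by move=> s /andP[s0 _]; apply: dF.
  by move=> s /andP[s0 st]; rewrite fc// ltW//= (le_trans (ltW st)).
have := @driven_crude u g v (fun t => G t - G 0) (fun t => H t - H 0) t t0 dr.
move=> /(_ _ (subrr _) _ (subrr _)) h.
apply: le_trans (h _ _) _.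
- by move=> s s0; rewrite -[X in is_derive _ _ _ X]subr0; apply: is_deriveB; exact: dG.
- by move=> s s0; rewrite -[X in is_derive _ _ _ X]subr0; apply: is_deriveB; exact: dH.
have K20 : 0 <= 16 * K ^+ 2 by rewrite mulr_ge0// sqr_ge0.
apply: ler_pM; rewrite ?expR_ge0//.
- apply: addr_ge0; first exact: dotv_ge0.
  apply: mulr_ge0 => //; rewrite subr_ge0.
  apply: (@is_derive_ndecr _ H (fun s => (1 + `|g s|) ^+ 3)) => //.
  by move=> s /andP[s0 _]; apply: dH.
- rewrite ler_expR; apply: ler_wpM2l => //; exact: (bd G _ S).
- rewrite lerD2l; apply: ler_wpM2l => //; apply: (bd H _ _ _ dH).
    by rewrite exprn_ge0// addr_ge0.
  move=> s sT; rewrite lerXn2r ?nnegrE ?addr_ge0// lerD2l; exact: gS.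
Qed.

End Energy.

(** * The flow of the quadratic field *)

Lemma cderivP (R : realType) (n : nat) (v : R -> 'cV[R]_n) t w :
  cderiv v t w <-> is_derive t (1:R) v w.
Proof.
split=> [dv|dv i].
  have dvb : derivable v t (1:R).
    apply/derivable_mxP => i j; rewrite ord1.
    exact: (@ex_derive _ _ _ _ _ _ _ (dv i)).
  apply: DeriveDef => //.
  rewrite derive_mx//; apply/matrixP => i j; rewrite mxE ord1.
  exact: (@derive_val _ _ _ _ _ _ _ (dv i)).
have dvb : derivable v t (1:R) by exact: (@ex_derive _ _ _ _ _ _ _ dv).
apply: DeriveDef; first by have /derivable_mxP := dvb; exact.
by rewrite -[w](@derive_val _ _ _ _ _ _ _ dv) derive_mx// mxE.
Qed.

Lemma le0_of_le_invn (R : realType) (x c : R) :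
  (forall N, x <= c / N.+1%:R) -> x <= 0.
Proof.
move=> h; rewrite leNgt; apply/negP => x0.
have [c0|c0] := leP c 0.
  have := h 0%N; rewrite divr1; lra.
have := h (Num.truncn (c / x)); rewrite leNgt => /negP; apply.
rewrite ltr_pdivrMr// mulrC -ltr_pdivrMr//; exact: truncnS_gt.
Qed.

(** Adding [δ ^+ 2] to the squared distance makes the differential inequality homogeneous: [2 K L
    |w| (|w| + 2 δ) <= 4 K L (|w|^2 + δ^2)], whence the rate [4 K L]. *)
Lemma driven_close (R : realType) (n : nat) (F1 F2 : 'cV[R]_n -> 'cV[R]_n)
    (u1 g1 v1 u2 g2 v2 : R -> 'cV[R]_n) (K L δ T : R) :
  0 <= K -> (forall x y : 'cV[R]_n, `|dotv x y| <= K * (`|x| * `|y|)) ->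
  0 <= L -> 0 <= δ ->
  driven F1 u1 g1 v1 -> driven F2 u2 g2 v2 ->
  (forall t, 0 <= t <= T -> `|F1 (u1 t) - F2 (u2 t)| <= L * (`|u1 t - u2 t| + δ)) ->
  (forall t, 0 <= t <= T -> `|g1 t - g2 t| <= δ) ->
  forall t, 0 <= t <= T -> dotv (v1 t - v2 t) (v1 t - v2 t) + δ ^+ 2 <=
    expR (4 * K * L * t) * (dotv (v1 0 - v2 0) (v1 0 - v2 0) + δ ^+ 2).
Proof.
move=> K0 dK L0 d0 [cu1 cg1 uv1 dv1] [cu2 cg2 uv2 dv2] hF hg t /andP[t0 tT].
pose M := 4 * K * L; rewrite -/M.
pose w s := v1 s - v2 s.
have dw s : 0 <= s -> cderiv w s (F1 (u1 s) - F2 (u2 s)).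
  move=> s0 i; rewrite mxE [X in _ + X]mxE.
  have -> : (fun s => w s i 0) = (fun s => v1 s i 0 - v2 s i 0).
    by apply/funext => r; rewrite !mxE.
  by apply: is_deriveB; [exact: dv1|exact: dv2].
pose e s := expR (- (M * s)).
have : (dotv (w t) (w t) + δ ^+ 2) * e t <= (dotv (w 0) (w 0) + δ ^+ 2) * e 0.
  apply: (@is_derive_nincr _ (fun s => (dotv (w s) (w s) + δ ^+ 2) * e s)
    (fun s => (dotv (w s) (w s) + δ ^+ 2) * (e s * - M) +
        e s * (2 * dotv (w s) (F1 (u1 s) - F2 (u2 s))))) => //.
    move=> s /andP[s0 _].
    apply: is_deriveM.
      rewrite -[X in is_derive _ _ _ X]addr0; apply: is_deriveD.
      exact/is_derive_dotv/dw.
    apply: (@is_derive1_comp _ expR (fun s => - (M * s))).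
    apply: is_deriveN; rewrite -[X in is_derive _ _ _ X]mulr1.
    exact: is_deriveZ.
  move=> s /andP[s0 st].
  have sT : 0 <= s <= T by rewrite (ltW s0) (le_trans (ltW st)).
  have e0 : 0 <= e s by exact: expR_ge0.
  rewrite mulrCA -mulrDr; apply: mulr_ge0_le0 => //.
  have h1 := hF s sT; have h2 := hg s sT.
  have := dK (w s) (F1 (u1 s) - F2 (u2 s)).
  rewrite ler_norml => /andP[_ h3].
  have h4 : `|u1 s - u2 s| <= `|w s| + δ.
    rewrite uv1 ?(ltW s0)// uv2 ?(ltW s0)//.
    have -> : v1 s + g1 s - (v2 s + g2 s) = w s + (g1 s - g2 s).
      by rewrite /w opprD addrACA.
    by rewrite (le_trans (ler_normD _ _))// lerD2l.
  have h5 := norm_sqr_le_dotv (w s).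
  have h6 : `|F1 (u1 s) - F2 (u2 s)| <= L * (`|w s| + 2 * δ).
    by apply: le_trans h1 _; apply: ler_wpM2l => //; lra.
  have h7 : K * (`|w s| * `|F1 (u1 s) - F2 (u2 s)|) <=
            K * (`|w s| * (L * (`|w s| + 2 * δ))).
    by rewrite ler_wpM2l// ler_wpM2l.
  have KL : 0 <= K * L by rewrite mulr_ge0.
  have h8 : `|w s| * (`|w s| + 2 * δ) <= 2 * dotv (w s) (w s) + δ ^+ 2.
    have : 0 <= (`|w s| - δ) ^+ 2 by exact: sqr_ge0.
    by rewrite sqrrB; move: h5; rewrite expr2; lra.
  have h9 : K * L * (`|w s| * (`|w s| + 2 * δ)) <= K * L * (2 * dotv (w s) (w s) + δ ^+ 2).
    by rewrite ler_wpM2l.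
  have h10 : 0 <= K * L * δ ^+ 2 by rewrite mulr_ge0// sqr_ge0.
  rewrite /M; lra.
rewrite {2}/e mulr0 oppr0 expR0 mulr1 => h.
rewrite -[leLHS](mulfVK (_ : expR (- (M * t)) != 0)) ?gt_eqF ?expR_gt0//.
by rewrite -expRN opprK mulrAC [leLHS]mulrC ler_wpM2l ?expR_ge0.
Qed.

Lemma continuous_bounded_segment (R : realType) (n : nat) (g : R -> 'cV[R]_n) (T : R) :
  continuous g -> exists2 S : R, 0 <= S & forall t, 0 <= t <= T -> `|g t| <= S.
Proof.
move=> cg.
have [T0|T0] := leP 0 T; last first.
  by exists 0 => // t /andP[t0 tT]; lra.
have [] := @EVT_max R (fun t => `|g t|) 0 T T0.
  apply: continuous_subspaceT => t.
  by apply: continuous_comp; [exact: cg|exact: norm_continuous].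
move=> c _ h; by exists `|g c| => // t tT; apply: h.
Qed.

Lemma is_derive_glue (R : realType) (f1 f2 : R -> R) (d : R) :
  is_derive (0:R) (1:R) f1 d -> is_derive (0:R) (1:R) f2 d -> f1 0 = f2 0 ->
  is_derive (0:R) (1:R) (fun t => if 0 <= t then f1 t else f2 t) d.
Proof.
move=> [df1 d1] [df2 d2] f12.
pose f t := if 0 <= t then f1 t else f2 t.
pose r (h : R -> R) := fun x : R => x^-1 *: ((h \o shift 0) (x *: (1:R)) - h 0).
have c1 : r f1 x @[x --> 0^'] --> d by rewrite -d1; exact: df1.
have c2 : r f2 x @[x --> 0^'] --> d by rewrite -d2; exact: df2.
have c : r f x @[x --> 0^'] --> d.
  apply/cvgrPdist_le => e e0.
  move/cvgrPdist_le : c1 => /(_ e e0) c1; move/cvgrPdist_le : c2 => /(_ e e0) c2.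
  near=> x.
  have h1 : `|d - r f1 x| <= e by near: x.
  have h2 : `|d - r f2 x| <= e by near: x.
  rewrite /r /f /= lexx; case: ifPn => _; first exact: h1.
  by rewrite f12; exact: h2.
apply: DeriveDef; first by apply/cvg_ex; exists d.
exact/cvg_lim.
Unshelve. all: by end_near. Qed.

Lemma locally_lipschitz_continuous (R : realType) (V W : normedModType R) (f : V -> W) :
  (forall x, exists L, forall y, `|x - y| <= 1 -> `|f x - f y| <= L * `|x - y|) ->
  continuous f.
Proof.
move=> h x; have [L hL] := h x; apply/cvgrPdist_le => e e0.
have L0 : 0 < `|L| + 1 by rewrite ltr_wpDl.
have d0 : 0 < Num.min 1 (e / (`|L| + 1)) by rewrite lt_min ltr01 divr_gt0.
apply: filterS (nbhsx_ballx x _ d0) => y; rewrite -ball_normE /= lt_min => /andP[xy1 xye].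
apply: le_trans (hL y (ltW xy1)) _.
apply: (@le_trans _ _ ((`|L| + 1) * `|x - y|)).
  by rewrite ler_wpM2r// (le_trans (ler_norm L))// lerDl.
by rewrite mulrC -ler_pdivlMr// ltW.
Qed.

Section ODE.
Context {R : realType} {n : nat}.
Variables (B : {bilinear 'cV[R]_n -> 'cV[R]_n -> 'cV[R]_n}) (A : 'M[R]_n).
Hypothesis Bcons : forall x : 'cV[R]_n, dotv x (B x x) = 0.
Hypothesis Apsd : forall x : 'cV[R]_n, 0 <= dotv x (A *m x).
Variable K : R.
Hypothesis K1 : 1 <= K.
Hypothesis BK : forall x y : 'cV[R]_n, `|B x y| <= K * (`|x| * `|y|).
Hypothesis AK : forall x : 'cV[R]_n, `|A *m x| <= K * `|x|.
Hypothesis dK : forall x y : 'cV[R]_n, `|dotv x y| <= K * (`|x| * `|y|).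

Let K0 : 0 <= K. Proof. exact: le_trans K1. Qed.

(** At scale [1 / b] the damping matrix becomes [b *: A]: it fades as [b] tends to 0 and the
    conservative flow is left. *)
Lemma drift_rescale (b : R) (x : 'cV[R]_n) :
  drift B (b *: A) (b *: x) = (b * b) *: drift B A x.
Proof.
rewrite /drift linearZl_LR linearZr_LR scalerA scalerBr; congr (_ - _).
by rewrite -scalemxAl -scalemxAr scalerA.
Qed.

Lemma Apsd_scale (b : R) : 0 <= b -> forall x : 'cV[R]_n, 0 <= dotv x ((b *: A) *m x).
Proof. by move=> b0 x; rewrite -scalemxAl dotvZr mulr_ge0. Qed.

Lemma AK_scale (b : R) : 0 <= b <= 1 ->
  forall x : 'cV[R]_n, `|(b *: A) *m x| <= K * `|x|.
Proof.
move=> /andP[b0 b1] x; rewrite -scalemxAl normrZ ger0_norm//.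
by apply: le_trans (AK x); rewrite ler_piMl.
Qed.

Lemma quadratic_diff (x y : 'cV[R]_n) : B x x - B y y = B (x - y) x + B y (x - y).
Proof. by rewrite linearBl linearBr addrA subrK. Qed.

Lemma drift_lipschitz (m : R) (x y : 'cV[R]_n) : 0 <= m -> `|x| <= m -> `|y| <= m ->
  `|drift B A x - drift B A y| <= (2 * K * m + K) * `|x - y|.
Proof.
move=> m0 xm ym.
have -> : drift B A x - drift B A y = (B (x - y) x + B y (x - y)) - A *m (x - y).
  rewrite -quadratic_diff /drift mulmxBr.
  move: (B x x) (B y y) (A *m x) (A *m y) => p q r s.
  by apply/matrixP => i j; rewrite !mxE; ring.
have h1 : `|B (x - y) x| <= K * m * `|x - y|.
  apply: le_trans (BK _ _) _; rewrite -mulrA ler_wpM2l// mulrC.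
  exact: ler_wpM2r.
have h2 : `|B y (x - y)| <= K * m * `|x - y|.
  by apply: le_trans (BK _ _) _; rewrite -mulrA ler_wpM2l// ler_wpM2r.
have h3 := AK (x - y).
apply: le_trans (ler_normB _ _) _; have := ler_normD (B (x - y) x) (B y (x - y)).
lra.
Qed.

Lemma drift_continuous : continuous (drift B A).
Proof.
apply: locally_lipschitz_continuous => x; exists (2 * K * (`|x| + 1) + K) => y xy.
apply: drift_lipschitz; first by rewrite addr_ge0.
  by rewrite lerDl.
by rewrite -[y](subrK x) addrC (le_trans (ler_normD _ _))// lerD2l distrC.
Qed.

Lemma quadratic_continuous : continuous (fun x => B x x).
Proof.
apply: locally_lipschitz_continuous => x; exists (K * (`|x| + 1) * 2) => y xy.
rewrite quadratic_diff.
have ym : `|y| <= `|x| + 1.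
  by rewrite -[y](subrK x) addrC (le_trans (ler_normD _ _))// lerD2l distrC.
have h1 : `|B (x - y) x| <= K * (`|x| + 1) * `|x - y|.
  apply: le_trans (BK _ _) _; rewrite -mulrA ler_wpM2l// mulrC.
  by apply: ler_wpM2r => //; rewrite lerDl.
have h2 : `|B y (x - y)| <= K * (`|x| + 1) * `|x - y|.
  by apply: le_trans (BK _ _) _; rewrite -mulrA ler_wpM2l// ler_wpM2r.
by apply: le_trans (ler_normD _ _) _; lra.
Qed.

(** Two damping coefficients in [[0, d]] differ by a perturbation of size [d]; the case [c = 0]
    compares a rescaled path with the limiting ODE. *)
Lemma drift_close (m d b c : R) (x y : 'cV[R]_n) : 0 <= m ->
  `|x| <= m -> `|y| <= m -> 0 <= b <= d -> 0 <= c <= d ->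
  `|drift B (b *: A) x - drift B (c *: A) y| <= 2 * K * m * (`|x - y| + d).
Proof.
move=> m0 xm ym /andP[b0 bd] /andP[c0 cd].
have -> : drift B (b *: A) x - drift B (c *: A) y =
    (B (x - y) x + B y (x - y)) + (- (b *: (A *m x)) + c *: (A *m y)).
  rewrite -quadratic_diff /drift -!scalemxAl.
  move: (B x x) (B y y) (b *: _) (c *: _) => p q r s.
  by apply/matrixP => i j; rewrite !mxE; ring.
apply: le_trans (ler_normD _ _) _; rewrite mulrDr; apply: lerD.
  have h1 : `|B (x - y) x| <= K * m * `|x - y|.
    apply: le_trans (BK _ _) _; rewrite -mulrA ler_wpM2l// mulrC.
    exact: ler_wpM2r.
  have h2 : `|B y (x - y)| <= K * m * `|x - y|.
    by apply: le_trans (BK _ _) _; rewrite -mulrA ler_wpM2l// ler_wpM2r.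
  by apply: le_trans (ler_normD _ _) _; lra.
have h (b' : R) (z : 'cV[R]_n) : 0 <= b' -> b' <= d -> `|z| <= m ->
    `|b' *: (A *m z)| <= K * m * d.
  move=> b0' bd' zm; rewrite normrZ ger0_norm// mulrC; apply: ler_pM => //.
  by apply: le_trans (AK z) _; rewrite ler_wpM2l.
have h1 := h b x b0 bd xm; have h2 := h c y c0 cd ym.
by apply: le_trans (ler_normD _ _) _; rewrite normrN; lra.
Qed.

Section Existence.
Variables (g : R -> 'cV[R]_n) (x : 'cV[R]_n).
Hypothesis sol : forall k : nat, exists u v,
  driven (drift B A) u g v /\ v 0 = k.+1%:R *: x.

(* Brownian-type scaling: if [u] solves the SDE started at [k x] then [u (t / k) / k]
   solves a perturbation of the ODE started at [x], of size [O(1 / k)]. *)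
Lemma ode_approx :
  exists y e z : nat -> R -> 'cV[R]_n,
   [/\ forall k, driven (drift B (k.+1%:R^-1 *: A)) (y k) (e k) (z k),
       forall k, z k 0 = x &
       forall T, 0 <= T -> exists2 S, 0 <= S & forall k t, 0 <= t <= T ->
         `|y k t| <= S /\ `|e k t| <= S / k.+1%:R].
Proof.
have /(_ _)/cid h k := sol k.
have /(_ _)/cid h2 k := projT2 (h k).
pose u k := projT1 (h k); pose v k := projT1 (h2 k).
have uv k : driven (drift B A) (u k) g (v k) /\ v k 0 = k.+1%:R *: x := projT2 (h2 k).
pose b k : R := k.+1%:R^-1.
have b0 k : 0 <= b k by rewrite invr_ge0.
have b1 k : b k <= 1 by rewrite invf_le1// ler1n.
exists (fun k t => b k *: u k (b k * t)), (fun k t => b k *: g (b k * t)),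
  (fun k t => b k *: v k (b k * t)).
have dr k : driven (drift B (b k *: A)) (fun t => b k *: u k (b k * t))
    (fun t => b k *: g (b k * t)) (fun t => b k *: v k (b k * t)).
  by apply: driven_scale (uv k).1 => // w; exact: drift_rescale.
split => //.
  by move=> k; rewrite mulr0 (uv k).2 scalerA mulVf ?scale1r ?pnatr_eq0.
move=> T' T'0.
have [_ cg _ _] := (uv 0%N).1.
have [S S0 gS] := continuous_bounded_segment T' cg.
have eS k t : 0 <= t <= T' -> `|b k *: g (b k * t)| <= S / k.+1%:R.
  move=> /andP[t0 tT]; rewrite normrZ ger0_norm// mulrC ler_wpM2r// gS//.
  by rewrite mulr_ge0//= (le_trans _ tT)// ler_piMl.
have eS' k t : 0 <= t <= T' -> `|b k *: g (b k * t)| <= S.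
  by move=> tT; apply: le_trans (eS k t tT) _; rewrite ler_piMr//; exact: b1.
pose m2 := expR (16 * K ^+ 2 * (S * T')) * (dotv x x + 16 * K ^+ 2 * ((1 + S) ^+ 3 * T')).
have m20 : 0 <= m2.
  rewrite mulr_ge0 ?expR_ge0// addr_ge0 ?dotv_ge0// mulr_ge0//.
    by rewrite mulr_ge0 ?sqr_ge0.
  by rewrite mulr_ge0// exprn_ge0// addr_ge0.
exists (Num.sqrt m2 + S); first by rewrite addr_ge0 ?sqrtr_ge0.
move=> k t tT; split; last first.
  by apply: le_trans (eS k t tT) _; rewrite ler_wpM2r ?b0// lerDr sqrtr_ge0.
have := @driven_bounded _ _ B (b k *: A) Bcons (Apsd_scale (b0 k)) K K1 BK
  (@AK_scale (b k) _) dK _ _ _ S T' (dr k) (eS' k) t tT.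
rewrite mulr0 (uv k).2 scalerA mulVf ?scale1r ?pnatr_eq0// -/m2 b0 b1 => /(_ isT) h'.
have t0 : 0 <= t by case/andP: tT.
have [_ _ uE _] := dr k; rewrite (uE t t0).
apply: le_trans (ler_normD _ _) _; apply: lerD; last exact: eS'.
rewrite -ler_sqr ?nnegrE ?sqrtr_ge0// sqr_sqrtr//.
exact: le_trans (norm_sqr_le_dotv _) h'.
Qed.

(** For [k, l >= N] the rescaled paths stay in a common ball and solve equations whose damping and
    forcing are [O(1 / N)]. By [driven_close] they form a Cauchy sequence, uniformly on bounded time
    intervals, and the ODE passes to the limit in integral form. *)
Lemma ode_exists_half : exists Y : R -> 'cV[R]_n,
  Y 0 = x /\ forall t, 0 <= t -> cderiv Y t (B (Y t) (Y t)).
Proof.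
have [y [e [z [dr z0 bnd]]]] := ode_approx.
have close T : 0 <= T -> exists2 C, 0 <= C & forall N k l t, (N <= k)%N -> (N <= l)%N ->
    0 <= t <= T -> `|z k t - z l t| <= C / N.+1%:R.
  move=> T0; have [S S0 hS] := bnd T T0.
  pose L := 2 * K * S; have L0 : 0 <= L by rewrite !mulr_ge0.
  exists (expR (4 * K * L * T) * (1 + 2 * S)).
    by rewrite mulr_ge0 ?expR_ge0// addr_ge0// mulr_ge0.
  move=> N k l t Nk Nl tT.
  pose d := (1 + 2 * S) / N.+1%:R.
  have d0 : 0 <= d by rewrite divr_ge0// addr_ge0// mulr_ge0.
  have invle k' : (N <= k')%N -> (k'.+1%:R^-1 : R) <= N.+1%:R^-1.
    by move=> h; rewrite lef_pV2 ?posrE// ler_nat.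
  have invd k' : (N <= k')%N -> 0 <= (k'.+1%:R^-1 : R) <= d.
    move=> h; rewrite invr_ge0 ler0n /=; apply: le_trans (invle _ h) _.
    by rewrite ler_peMl ?invr_ge0// lerDl mulr_ge0.
  have ed k' s : (N <= k')%N -> 0 <= s <= T -> `|e k' s| <= d / 2.
    move=> h sT; apply: le_trans (hS k' s sT).2 _.
    apply: le_trans (ler_wpM2l S0 (invle _ h)) _.
    have : 0 <= (N.+1%:R^-1 : R) by rewrite invr_ge0.
    by rewrite /d; move: (N.+1%:R^-1) => i; lra.
  have hF s : 0 <= s <= T -> `|drift B (k.+1%:R^-1 *: A) (y k s) -
      drift B (l.+1%:R^-1 *: A) (y l s)| <= L * (`|y k s - y l s| + d).
    move=> sT; apply: drift_close => //; try exact: invd.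
      exact: (hS k s sT).1.
    exact: (hS l s sT).1.
  have hg s : 0 <= s <= T -> `|e k s - e l s| <= d.
    by move=> sT; apply: le_trans (ler_normB _ _) _; have := ed k s Nk sT; have := ed l s Nl sT; lra.
  have := driven_close K0 dK L0 d0 (dr k) (dr l) hF hg tT.
  rewrite !z0 subrr dotv0 add0r => h.
  have h1 : `|z k t - z l t| ^+ 2 <= (expR (4 * K * L * T) * d) ^+ 2.
    apply: le_trans (norm_sqr_le_dotv _) _.
    apply: le_trans (le_trans _ h) _; first by rewrite lerDl sqr_ge0.
    rewrite [leRHS]exprMn; apply: ler_wpM2r; first exact: sqr_ge0.
    have e1 : 1 <= expR (4 * K * L * T).
      by rewrite -expR0 ler_expR !mulr_ge0.
    apply: (@le_trans _ _ (expR (4 * K * L * T))); last by rewrite expr2 ler_peMr ?expR_ge0.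
    by rewrite ler_expR ler_wpM2l// ?mulr_ge0//; case/andP: tT.
  have ed0 : 0 <= expR (4 * K * L * T) * d by rewrite mulr_ge0 ?expR_ge0.
  move: h1; rewrite ler_sqr ?nnegrE ?normr_ge0// => h1; apply: le_trans h1 _.
  by rewrite /d mulrA.
pose Y0 t := lim (z ^~ t @ \oo).
have Y0P T : 0 <= T -> exists2 C, 0 <= C & forall k t, 0 <= t <= T ->
    `|Y0 t - z k t| <= C / k.+1%:R /\ `|Y0 t - y k t| <= C / k.+1%:R.
  move=> T0; have [C C0 hC] := close T T0; have [S S0 hS] := bnd T T0.
  have zY k t : 0 <= t <= T -> `|Y0 t - z k t| <= C / k.+1%:R.
    move=> tT.
    have cz : z ^~ t @ \oo --> Y0 t.
      apply/cauchy_cvgP/cauchy_exP => eps eps0.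
      exists (z (Num.truncn (C / eps)) t).
      suff : \forall l \near \oo, ball (z (Num.truncn (C / eps)) t) eps (z l t) by [].
      near=> l; rewrite -ball_normE /=; apply: le_lt_trans (hC _ _ _ _ (leqnn _) _ tT) _.
        by near: l; exact: nbhs_infty_ge.
      by rewrite ltr_pdivrMr// mulrC -ltr_pdivrMr// truncnS_gt.
    apply/ler_addgt0Pr => eta eta0.
    have /cvgrPdist_le/(_ _ eta0) cz' := cz.
    near \oo => l.
    have -> : Y0 t - z k t = (Y0 t - z l t) + (z l t - z k t) by rewrite addrA subrK.
    rewrite addrC; apply: le_trans (ler_normD _ _) _; apply: lerD.
      by apply: hC => //; near: l; exact: nbhs_infty_ge.
    by near: l.
  exists (C + S); first by rewrite addr_ge0.
  move=> k t tT; rewrite mulrDl; split.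
    by apply: le_trans (zY k t tT) _; rewrite lerDl divr_ge0.
  have t0 : 0 <= t by case/andP: tT.
  have [_ _ uE _] := dr k; rewrite (uE t t0).
  rewrite opprD addrA; apply: le_trans (ler_normB _ _) _.
  by apply: lerD; [exact: zY|exact: (hS k t tT).2].
(* Clamping the time makes the limit path continuous on the whole line, as [continuous_primitive]
   requires. *)
pose p (t : R) := Num.max 0 t.
have p0 t : 0 <= p t by rewrite /p le_max lexx.
have pE t : 0 <= t -> p t = t by move=> t0; rewrite /p max_r.
have pd t s : `|p t - p s| <= `|t - s|.
  have : `|t - s| <= `|t - s| by []; rewrite {1}ler_norml => /andP[h1 h2].
  have d0 := normr_ge0 (t - s).
  by rewrite /p ler_norml; case: (lerP 0 t); case: (lerP 0 s); lra.
have cp : continuous p.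
  by apply: (@locally_lipschitz_continuous _ R R) => t; exists 1 => s _; rewrite mul1r.
pose yy t := Y0 (p t).
have cyy : continuous yy.
  move=> t; apply/cvgrPdist_le => eps eps0.
  have T0 : 0 <= p t + 1 by rewrite addr_ge0.
  have [C C0 hC] := Y0P _ T0.
  pose k := Num.truncn (C / (eps / 3)).
  have Ck : C / k.+1%:R <= eps / 3.
    by rewrite ler_pdivrMr// mulrC -ler_pdivrMr ?divr_gt0// ltW// truncnS_gt.
  have cyk : {for t, continuous (y k \o p)}.
    by have [cyk _ _ _] := dr k; apply: continuous_comp; [exact: cp|exact: cyk].
  have /cvgrPdist_le/(_ _ (divr_gt0 eps0 (ltr0n _ 3))) := cyk.
  apply: filterS2 (nbhsx_ballx t (1:R) ltr01) => s.
  rewrite -ball_normE /= => ts hyk.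
  have h1 := (hC k (p t) _).2; have h2 := (hC k (p s) _).2.
  have -> : yy t - yy s = (yy t - y k (p t)) + (y k (p t) - y k (p s)) - (yy s - y k (p s)).
    by rewrite opprB !addrA !subrK.
  have := h1; have := h2; rewrite p0 p0 /= => /(_ _)/le_trans/(_ Ck) {}h2.
  move=> /(_ _)/le_trans/(_ Ck) {}h1.
  apply: le_trans (ler_normB _ _) _.
  have := ler_normD (yy t - y k (p t)) (y k (p t) - y k (p s)).
  have : `|yy t - y k (p t)| <= eps / 3 by apply: h1; rewrite lerDl.
  have : `|yy s - y k (p s)| <= eps / 3.
    apply: h2; have := le_trans (pd t s) (ltW ts); rewrite ler_norml; lra.
  by move: hyk => /=; lra.
have cf i : continuous (fun s => B (yy s) (yy s) i 0).
  move=> s; apply: (continuous_comp (f := fun s => B (yy s) (yy s)) (g := fun x : 'cV[R]_n => x i 0)); last exact: coord_continuous.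
  by apply: (continuous_comp (f := yy) (g := fun x => B x x)); [exact: cyy|exact: quadratic_continuous].
have /(_ _)/cid2 Pr i := continuous_primitive (cf i).
(* The integral equation serves as the definition: [Y] agrees with [Y0] at nonnegative times and is
   differentiable at 0 from both sides. *)
pose Y t : 'cV[R]_n := \col_i (x i 0 + (s2val (Pr i) t - s2val (Pr i) 0)).
have YE t : 0 <= t -> Y t = Y0 t.
  move=> t0; apply/matrixP => i j; rewrite !mxE ord1.
  set P := s2val (Pr i).
  have dP : forall s : R, 0 <= s -> is_derive s (1:R) P (B (yy s) (yy s) i 0) := s2valP (Pr i).
  have [C C0 hC] := Y0P t t0; have [S S0 hS] := bnd t t0.
  apply/eqP; rewrite -subr_eq0 -normr_eq0 eq_le normr_ge0 andbT.
  apply: (@le0_of_le_invn _ _ (2 * K * (C + S) * (C + 1) * t + C)) => k.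
  have inv0 : 0 <= (k.+1%:R^-1 : R) by rewrite invr_ge0.
  have inv1 : (k.+1%:R^-1 : R) <= 1 by rewrite invf_le1// ler1n.
  have [_ _ _ dz] := dr k.
  pose c := 2 * K * (C + S) * ((C + 1) / k.+1%:R).
  have c0 : 0 <= c by rewrite !mulr_ge0 ?divr_ge0// ?addr_ge0.
  pose D s := z k s i 0 - P s.
  pose dD s := drift B (k.+1%:R^-1 *: A) (y k s) i 0 - B (yy s) (yy s) i 0.
  have DD (s : R) : 0 <= s -> is_derive s (1:R) D (dD s).
    by move=> s0; apply: is_deriveB; [exact: dz|exact: dP].
  have dDc s : 0 <= s <= t -> `|dD s| <= c.
    move=> st; rewrite /dD.
    have := coord_le_norm (drift B (k.+1%:R^-1 *: A) (y k s) - drift B (0 *: A) (yy s)) i.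
    have -> : (drift B (k.+1%:R^-1 *: A) (y k s) - drift B (0 *: A) (yy s)) i 0 = 
       drift B (k.+1%:R^-1 *: A) (y k s) i 0 - B (yy s) (yy s) i 0.
      by rewrite [in X in _ - X]/drift scale0r mul0mx subr0 !mxE.
    move/le_trans; apply.
    have ysY : `|Y0 s - y k s| <= C / k.+1%:R := (hC k s st).2.
    have yyE : yy s = Y0 s by rewrite /yy pE//; case/andP: st.
    have yS : `|y k s| <= S := (hS k s st).1.
    apply: le_trans (@drift_close (C + S) (k.+1%:R^-1) _ 0 _ _ _ _ _ _ _) _ => //.
    - by rewrite addr_ge0.
    - by apply: le_trans yS _; rewrite lerDr.
    - rewrite yyE -[Y0 s](subrK (y k s)); apply: le_trans (ler_normD _ _) _.
      by apply: lerD => //; apply: le_trans ysY _; rewrite ler_piMr.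
    - by rewrite inv0 lexx.
    - by rewrite lexx inv0.
    rewrite /c; apply: ler_wpM2l; first by rewrite !mulr_ge0// addr_ge0.
    by rewrite yyE distrC mulrDl mul1r lerD2r.
  have D1 : D t - D 0 <= c * (t - 0).
    apply: (@is_derive_growth _ D dD) => //.
      by move=> s /andP[s0 _]; exact: DD.
    move=> s /andP[s0 st]; have := dDc s; rewrite (ltW s0) (ltW st) => /(_ isT).
    by rewrite ler_norml => /andP[].
  have D2 : - D t - - D 0 <= c * (t - 0).
    apply: (@is_derive_growth _ (fun s => - D s) (fun s => - dD s)) => //.
      by move=> s /andP[s0 _]; apply: is_deriveN; exact: DD.
    move=> s /andP[s0 st]; have := dDc s; rewrite (ltW s0) (ltW st) => /(_ isT).
    by rewrite ler_norml => /andP[]; lra.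
  have zY : `|Y0 t i 0 - z k t i 0| <= C / k.+1%:R.
    have := coord_le_norm (Y0 t - z k t) i; rewrite mxE [X in _ + X]mxE => /le_trans; apply.
    by apply: (hC k t _).1; rewrite t0 lexx.
  move: D1 D2; rewrite /D z0 subr0 => D1 D2.
  have -> : (2 * K * (C + S) * (C + 1) * t + C) / k.+1%:R = c * t + C / k.+1%:R.
    by rewrite /c; ring.
  move: zY D1 D2; rewrite !ler_norml; move: (C / _) (c * t) => r1 r2.
  move: (Y0 t i 0) (z k t i 0) (P t) (P 0) (x i 0) => a1 a2 a3 a4 a5; lra.
exists Y; split.
  by apply/matrixP => i j; rewrite !mxE ord1 subrr addr0.
move=> t t0 i; rewrite YE//.
have := s2valP (Pr i) t t0; rewrite /yy pE// => dP.
have -> : (fun s => Y s i 0) = (fun s => x i 0 - s2val (Pr i) 0 + s2val (Pr i) s).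
  by apply/funext => s; rewrite mxE addrCA addrC.
by rewrite -[X in is_derive _ _ _ X]add0r; apply: is_deriveD.
Unshelve. all: by end_near. Qed.
End Existence.

Lemma ode_conserved (x : 'cV[R]_n) (Y : R -> 'cV[R]_n) :
  Y 0 = x -> (forall t, 0 <= t -> cderiv Y t (B (Y t) (Y t))) ->
  forall t, 0 <= t -> dotv (Y t) (Y t) = dotv x x.
Proof.
move=> Y0 dY t t0.
have d s : 0 <= s <= t -> is_derive s (1:R) (fun s => dotv (Y s) (Y s) : R) 0.
  move=> /andP[s0 _]; have := is_derive_dotv (dY s s0).
  by rewrite Bcons mulr0.
apply/eqP; rewrite eq_le -Y0; apply/andP; split.
  exact: (@is_derive_nincr _ _ (fun=> 0) _ _ t0 d).
exact: (@is_derive_ndecr _ _ (fun=> 0) _ _ t0 d).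
Qed.

(** [ode_solution] asks for all real times. Since [B (- y) (- y) = B y y], the path [- Y (- t)]
    solves the same equation, so the backward half comes from the forward solution started at [- x];
    the two are glued at 0. *)
Lemma ode_exists :
  (forall x, exists g, forall k : nat, exists u v,
     driven (drift B A) u g v /\ v 0 = k.+1%:R *: x) ->
  forall x, exists Y, ode_solution (fun y => B y y) x Y.
Proof.
move=> sol x.
have [g1 sol1] := sol x; have [g2 sol2] := sol (- x).
have [Y1 [Y10 dY1]] := ode_exists_half sol1.
have [Y2 [Y20 dY2]] := ode_exists_half sol2.
pose Z t : 'cV[R]_n := - Y2 (- t).
have dZ t : t <= 0 -> cderiv Z t (B (Z t) (Z t)).
  move=> t0 i; rewrite /Z linearNl linearNr opprK.
  have -> : (fun s => (- Y2 (- s)) i 0) = (fun s => - ((fun s => Y2 s i 0) \o -%R) s).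
    by apply/funext => s; rewrite mxE.
  rewrite -[X in is_derive _ _ _ X]opprK; apply: is_deriveN; rewrite -mulrN1.
  apply: is_derive1_comp.
  by apply: dY2; rewrite oppr_ge0.
exists (fun t => if 0 <= t then Y1 t else Z t); split; first by rewrite lexx.
move=> t; apply/cderivP => i.
have -> : (fun s => (if 0 <= s then Y1 s else Z s) i 0) =
          (fun s => if 0 <= s then Y1 s i 0 else Z s i 0).
  by apply/funext => s; case: ifP.
have [t0|t0|t0] := ltgtP 0 t.
- apply: near_eq_is_derive (dY1 t (ltW t0) i).
  near=> s; rewrite ifT//; near: s.
  by apply: filterS (lt_nbhsr t0) => s /ltW.
- apply: near_eq_is_derive (dZ t (ltW t0) i).
  near=> s; rewrite ifF//; apply/negbTE; rewrite -ltNge; near: s.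
  exact: lt_nbhsl t0.
- rewrite -t0; apply: is_derive_glue.
  + exact: dY1.
  + by have := dZ 0 (lexx _) i; rewrite /Z oppr0 Y20 opprK Y10.
  + by rewrite /Z oppr0 Y20 opprK Y10.
Unshelve. all: by end_near. Qed.

(** The derivative exists, so its value can be read from the right, where the difference quotient
    vanishes. *)
Lemma right_zero_derive0 (h : R -> R) (s d b : R) : s < b ->
  (forall t, s <= t < b -> h t = 0) -> is_derive s (1:R) h d -> d = 0.
Proof.
move=> sb h0 [dh dE]; apply: contrapT => /eqP dn0.
have c1 : x^-1 *: ((h \o shift s) (x *: (1:R)) - h s) @[x --> 0^'] --> d by rewrite -dE; exact: dh.
move/cvgrPdist_lt : c1 => /(_ `|d|); rewrite normr_gt0 => /(_ dn0).
rewrite /nbhs/= => -[e /= e0 he].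
pose x := Num.min (e / 2) ((b - s) / 2).
have x0 : 0 < x by rewrite lt_min !divr_gt0// subr_gt0.
have xe : x < e.
  by rewrite gt_min; apply/orP; left; rewrite ltr_pdivrMr// ltr_pMr// ltr1n.
have xb : s + x < b.
  rewrite -ltrBrDl gt_min; apply/orP; right.
  by rewrite ltr_pdivrMr// ltr_pMr ?subr_gt0// ltr1n.
have := he x; rewrite /ball_ /= sub0r normrN (gtr0_norm x0) => /(_ xe).
rewrite gt_eqF// => /(_ isT).
have hs : h s = 0 by apply: h0; rewrite lexx.
have hx : h (x *: (1 : R) + s) = 0.
  by apply: h0; rewrite [_ *: _]mulr1 addrC xb andbT lerDl ltW.
by rewrite hs hx subr0 scaler0 subr0 ltxx.
Qed.

(** A class closed under differentiation along the flow, because [Y' = B(Y, Y)]. It contains every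
    iterated derivative of [Y], which makes [Y] smooth. *)
Inductive flow_poly (Y : R -> 'cV[R]_n) : (R -> 'cV[R]_n) -> Prop :=
| flow_id : flow_poly Y Y
| flow_add f1 f2 : flow_poly Y f1 -> flow_poly Y f2 -> flow_poly Y (fun t => f1 t + f2 t)
| flow_bil f1 f2 : flow_poly Y f1 -> flow_poly Y f2 -> flow_poly Y (fun t => B (f1 t) (f2 t)).

Lemma cderivD (f g : R -> 'cV[R]_n) t a b : cderiv f t a -> cderiv g t b ->
  cderiv (fun s => f s + g s) t (a + b).
Proof.
move=> df dg i; rewrite mxE.
have -> : (fun s => (f s + g s) i 0) = (fun s => f s i 0 + g s i 0).
  by apply/funext => s; rewrite mxE.
exact: is_deriveD.
Qed.

Lemma bilinear_coord (x y : 'cV[R]_n) i :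
  B x y i 0 = \sum_j \sum_k x j 0 * y k 0 * B (delta_mx j 0) (delta_mx k 0) i 0.
Proof.
rewrite {1}(cvE x) {1}(cvE y) linear_sumlz summxE; apply: eq_bigr => j _.
rewrite linearZl_LR linear_sumr mxE summxE mulr_sumr; apply: eq_bigr => k _.
by rewrite linearZr_LR mxE mulrA.
Qed.

Lemma cderiv_bilinear (f g : R -> 'cV[R]_n) t a b : cderiv f t a -> cderiv g t b ->
  cderiv (fun s => B (f s) (g s)) t (B a (g t) + B (f t) b).
Proof.
move=> df dg i.
have -> : (fun s => B (f s) (g s) i 0) = \sum_(j < n) \sum_(k < n)
    (fun s : R => B (delta_mx j 0) (delta_mx k 0) i 0 * (f s j 0 * g s k 0)).
  apply/funext => s; rewrite bilinear_coord fct_sumE; apply: eq_bigr => j _.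
  by rewrite fct_sumE; apply: eq_bigr => k _; rewrite mulrC.
apply: is_derive_eq.
  apply: is_derive_sum => j; apply: is_derive_sum => k.
  by apply: is_deriveZ; apply: is_deriveM; [exact: df|exact: dg].
rewrite mxE !bilinear_coord -big_split; apply: eq_bigr => j _.
rewrite -big_split; apply: eq_bigr => k _; rewrite /GRing.scale /=; ring.
Qed.

Lemma flow_poly_derive (x : 'cV[R]_n) (Y f : R -> 'cV[R]_n) :
  ode_solution (fun y => B y y) x Y -> flow_poly Y f ->
  exists2 f', flow_poly Y f' & forall t, is_derive t (1:R) f (f' t).
Proof.
move=> [_ dY]; elim=> [|f1 f2 _ [f1' p1 d1] _ [f2' p2 d2]|f1 f2 q1 [f1' p1 d1] q2 [f2' p2 d2]].
- by exists (fun t => B (Y t) (Y t)); [apply: flow_bil; exact: flow_id|exact: dY].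
- exists (fun t => f1' t + f2' t); first exact: flow_add.
  by move=> t; apply/cderivP/cderivD; apply/cderivP.
- exists (fun t => B (f1' t) (f2 t) + B (f1 t) (f2' t)).
    by apply: flow_add; exact: flow_bil.
  by move=> t; apply/cderivP/cderiv_bilinear; apply/cderivP.
Qed.

Lemma derive1n_kernel (x : 'cV[R]_n) (Y : R -> 'cV[R]_n) (b : R) : 0 < b ->
  ode_solution (fun y => B y y) x Y -> (forall s, 0 <= s < b -> A *m Y s = 0) ->
  forall j, A *m (derive1n j Y 0) = 0.
Proof.
move=> b0 oY AY j.
(* The vanishing is carried on all of [[0, b)] and not at 0 alone, since it has to be differentiated
   again. *)
suff [f [_ -> h]] : exists f, [/\ flow_poly Y f, derive1n j Y = f &
    forall s, 0 <= s < b -> A *m f s = 0].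
  by apply: h; rewrite lexx.
elim: j => [|j [f [pf fE Af]]]; first by exists Y; split => //; exact: flow_id.
have [f' pf' df] := flow_poly_derive oY pf.
exists f'; split => //.
  rewrite derive1nS fE; apply/funext => t; rewrite derive1E.
  exact: (@derive_val _ _ _ _ _ _ _ (df t)).
move=> s /andP[s0 sb]; apply/matrixP => i k; rewrite ord1 [RHS]mxE.
have Afi t : s <= t < b -> (A *m f t) i 0 = 0.
  by move=> /andP[st tb]; rewrite Af ?mxE// (le_trans s0 st).
apply: (right_zero_derive0 sb Afi).
have -> : (fun t => (A *m f t) i 0) = \sum_(k < n) (fun t : R => A i k * f t k 0).
  by apply/funext => t; rewrite mxE fct_sumE.
rewrite mxE; apply: is_derive_sum => l; apply: is_deriveZ.
by have /cderivP := df s; exact.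
Qed.

End ODE.

(** * Pathwise contraction far from the origin *)

Lemma norm_trmx (R : realType) m n (x : 'M[R]_(m, n)) : `|x^T| <= `|x|.
Proof.
rewrite [leLHS]/Num.norm /= [leRHS]/Num.norm /= !mx_normrE.
apply/bigmax_leP; split; first exact: bigmax_ge_id.
move=> -[i j] _ /=; rewrite mxE.
exact: (le_bigmax _ (fun ij : 'I_m * 'I_n => `|x ij.1 ij.2|) (j, i)).
Qed.

Lemma bounded_cluster (R : realType) n (p : nat -> 'cV[R]_n) :
  (forall k, `|p k| <= 1) -> exists x, forall (e : R) N, 0 < e ->
    exists2 k, (N <= k)%N & `|p k - x| <= e.
Proof.
move=> p1.
pose C := [set v : 'rV[R]_n | `|v| <= 1].
have cC : compact C.
  apply: bounded_closed_compact.
    by exists 1; split; [exact: num_real|move=> M M1 v; rewrite /C /= => /le_trans; apply; exact: ltW].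
  have -> : C = (@Num.norm _ 'rV[R]_n) @^-1` [set x | x <= 1] by [].
  apply: closed_comp; last exact: closed_le.
  by move=> v _; exact: norm_continuous.
have [|v [_ clv]] := cC ((fun k => (p k)^T) @ \oo) _.
  by exists 0%N => // k _; rewrite /C /= (le_trans (norm_trmx _)).
exists v^T => e N e0.
have [|_ [[k /= Nk <-]]] := clv [set (p k)^T | k in [set k | (N <= k)%N]] (ball v e) _ (nbhsx_ballx v e e0).
  by exists N => // k Nk; exists k.
rewrite -ball_normE /= => h; exists k => //.
rewrite -[p k]trmxK -linearB /=; apply: le_trans (norm_trmx _) _.
by rewrite distrC ltW.
Qed.

Section Dissipation.
Context {R : realType} {n : nat}.
Variables (B : {bilinear 'cV[R]_n -> 'cV[R]_n -> 'cV[R]_n}) (A : 'M[R]_n).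
Hypothesis Bcons : forall x : 'cV[R]_n, dotv x (B x x) = 0.
Hypothesis A_psd : psdmx A.
Variable K : R.
Hypothesis K1 : 1 <= K.
Hypothesis BK : forall x y : 'cV[R]_n, `|B x y| <= K * (`|x| * `|y|).
Hypothesis AK : forall x : 'cV[R]_n, `|A *m x| <= K * `|x|.
Hypothesis dK : forall x y : 'cV[R]_n, `|dotv x y| <= K * (`|x| * `|y|).
Hypothesis escape : exists J : nat, forall x : 'cV[R]_n,
  (kerv A `&` @usphere R n) x ->
  forall Y : R -> 'cV[R]_n, ode_solution (fun y => B y y) x Y ->
  exists j : nat, (j <= J)%N /\ orthproj (orthc (kerv A)) (derive1n j Y 0) <> 0.
Hypothesis ode : forall x : 'cV[R]_n, exists Y, ode_solution (fun y => B y y) x Y.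

Let K0 : 0 <= K. Proof. exact: le_trans K1. Qed.
Let Apsd : forall x : 'cV[R]_n, 0 <= dotv x (A *m x). Proof. exact: A_psd.2. Qed.

Lemma dotv_symmx (x y : 'cV[R]_n) : dotv x (A *m y) = dotv (A *m x) y.
Proof.
rewrite /dotv.
under eq_bigr do rewrite mxE mulr_sumr.
rewrite exchange_big /=; apply: eq_bigr => j _; rewrite mxE mulr_suml.
apply: eq_bigr => i _; have /matrixP/(_ i j) := A_psd.1; rewrite mxE => ->; ring.
Qed.

(** The quadratic form is minimal at [y], so its derivative in the direction [A *m y] vanishes; by
    symmetry this derivative is [2 |A y|^2]. *)
Lemma psd_kernel (y : 'cV[R]_n) : dotv y (A *m y) = 0 -> A *m y = 0.
Proof.
move=> yAy; apply: dotv_eq0; set z := A *m y.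
have := dotv_ge0 z; rewrite le_eqVlt => /predU1P[->//|a0].
set a := dotv z z in a0; set c := dotv z (A *m z).
have c0 : 0 <= c := Apsd z.
have c1 : 0 < c + 1 by rewrite ltr_wpDl.
(* A point slightly short of the minimiser [- a / c]; the denominator [c + 1] covers the case
   [c = 0]. *)
pose t := - (a / (c + 1)).
have := Apsd (y + t *: z).
rewrite mulmxDr -scalemxAr dotvDl !dotvDr !dotvZl !dotvZr yAy add0r.
have -> : dotv y (A *m z) = a by rewrite dotv_symmx.
rewrite -/z -/a -/c.
have -> : t * a + (t * a + t * (t * c)) = - ((a ^+ 2 * (c + 2)) / (c + 1) ^+ 2).
  by rewrite /t; field; rewrite gt_eqF.
rewrite oppr_ge0 leNgt divr_gt0 ?exprn_gt0// mulr_gt0 ?exprn_gt0//.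
by rewrite ltr_wpDl.
Qed.

(** The chosen point [y] is orthogonal both to [z] and to [z - y], hence to itself; the default
    value of [xget] is 0 as well. *)
Lemma orthproj_orthc_kernel (z : 'cV[R]_n) : kerv A z -> orthproj (orthc (kerv A)) z = 0.
Proof.
move=> Az; rewrite /orthproj; case: xgetP => [y _ [oy oz]|//].
apply: dotv_eq0.
have h1 := oz y oy; have h2 := oy z Az.
by move: h1; rewrite dotvBl dotvC h2 sub0r => /eqP; rewrite oppr_eq0 => /eqP.
Qed.

(** Without dissipation on [[0, 1)] the trajectory lies in [ker A] there, its starting point
    included, and so do all its derivatives at 0, which [escape] excludes. *)
Lemma flow_dissipates (x : 'cV[R]_n) (Y : R -> 'cV[R]_n) : dotv x x = 1 ->
  ode_solution (fun y => B y y) x Y ->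
  ~ (forall s, 0 <= s < 1 -> dotv (Y s) (A *m Y s) = 0).
Proof.
move=> x1 oY h.
have AY s : 0 <= s < 1 -> A *m Y s = 0 by move=> s1; apply: psd_kernel; exact: h.
have [J esc] := escape.
have [|j [_]] := esc x _ Y oY.
  split; last by rewrite /usphere /= /enorm x1 sqrtr1.
  by have := AY 0; rewrite lexx ltr01 => /(_ isT); rewrite oY.1.
apply; apply: orthproj_orthc_kernel; exact: (derive1n_kernel ltr01 oY AY).
Qed.

Lemma dissipation_diff (m : R) (x y : 'cV[R]_n) : `|x| <= m -> `|y| <= m ->
  dotv x (A *m x) - dotv y (A *m y) <= 2 * K ^+ 2 * m * `|x - y|.
Proof.
move=> xm ym.
have -> : dotv x (A *m x) - dotv y (A *m y) = dotv (x - y) (A *m x) + dotv y (A *m (x - y)).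
  by rewrite mulmxBr dotvBl dotvBr; ring.
have m0 : 0 <= m by exact: le_trans (normr_ge0 _) xm.
have h1 : dotv (x - y) (A *m x) <= K * (`|x - y| * (K * m)).
  apply: le_trans (ler_norm _) (le_trans (dK _ _) _).
  rewrite ler_wpM2l// ler_wpM2l//; apply: le_trans (AK _) _; exact: ler_wpM2l.
have h2 : dotv y (A *m (x - y)) <= K * (m * (K * `|x - y|)).
  apply: le_trans (ler_norm _) (le_trans (dK _ _) _).
  by rewrite ler_wpM2l// ler_pM// AK.
lra.
Qed.

Lemma dissipation_continuous : continuous (fun x : 'cV[R]_n => dotv x (A *m x)).
Proof.
apply: (@locally_lipschitz_continuous _ 'cV[R]_n R) => x.
exists (2 * K ^+ 2 * (`|x| + 1)) => y xy.
have ym : `|y| <= `|x| + 1.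
  by rewrite -[y](subrK x) addrC (le_trans (ler_normD _ _))// lerD2l distrC.
have xm : `|x| <= `|x| + 1 by rewrite lerDl.
have h1 := dissipation_diff xm ym; have h2 := dissipation_diff ym xm.
by rewrite ler_norml; move: h2; rewrite distrC; lra.
Qed.

Lemma dotv_norm_ub (x : 'cV[R]_n) : dotv x x <= K * `|x| ^+ 2.
Proof. exact: le_trans (ler_norm _) (dK _ _). Qed.

(* By compactness: perturbed paths that dissipate less and less would converge to a
   solution of [Y' = B(Y, Y)] that stays in [ker A], against [escape]. *)
Lemma rescaled_dissipation : exists2 k : nat, (0 < k)%N & forall (b : R) (y e z : R -> 'cV[R]_n) (D : R -> R),
  0 <= b <= k%:R^-1 -> driven (drift B (b *: A)) y e z -> enorm (y 0) = 1 ->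
  (forall t, 0 <= t <= 1 -> `|e t| <= k%:R^-1) ->
  (forall t : R, 0 <= t -> is_derive t (1:R) D (dotv (y t) (A *m y t))) ->
  k%:R^-1 <= D 1 - D 0.
Proof.
apply: contrapT => nex.
have bad k : exists b y e z D, [/\ 0 <= b <= (k.+1%:R^-1 : R),
   driven (drift B (b *: A)) y e z, enorm (y 0) = 1,
   (forall t, 0 <= t <= 1 -> `|e t| <= k.+1%:R^-1) &
   (forall t : R, 0 <= t -> is_derive t (1:R) D (dotv (y t) (A *m y t))) /\
   D 1 - D 0 < k.+1%:R^-1].
  apply: contrapT => nb; apply: nex; exists k.+1 => // b y e z D hb hd hy he hD.
  rewrite leNgt; apply/negP => lt; apply: nb; exists b, y, e, z, D; split => //.
have /(_ _)/cid {}bad k := bad k.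
have /(_ _)/cid bad2 k := projT2 (bad k).
pose y k := projT1 (bad2 k).
have yP k : exists b e z D, [/\ 0 <= b <= (k.+1%:R^-1 : R),
   driven (drift B (b *: A)) (y k) e z, enorm (y k 0) = 1,
   (forall t, 0 <= t <= 1 -> `|e t| <= k.+1%:R^-1) &
   (forall t : R, 0 <= t -> is_derive t (1:R) D (dotv (y k t) (A *m y k t))) /\
   D 1 - D 0 < k.+1%:R^-1].
  have [e [z [D h]]] := projT2 (bad2 k).
  by exists (projT1 (bad k)), e, z, D.
have [x clx] : exists x, forall (e : R) N, 0 < e ->
    exists2 k, (N <= k)%N & `|y k 0 - x| <= e.
  apply: bounded_cluster => k; have [b [e [z [D [_ _ <- _ _]]]]] := yP k.
  exact: norm_le_enorm.
have x1 : dotv x x = 1.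
  apply/eqP; rewrite -subr_eq0 -normr_eq0 eq_le normr_ge0 andbT.
  apply: (@le0_of_le_invn _ _ (K * (`|x| + 1))) => N.
  have [|k _ kx] := clx N.+1%:R^-1 0%N; first by rewrite invr_gt0.
  have [b [e [z [D [_ _ y1 _ _]]]]] := yP k.
  have yk1 : `|y k 0| <= 1 by rewrite -y1 norm_le_enorm.
  have -> : dotv x x - 1 = - (dotv (y k 0 - x) (y k 0) + dotv x (y k 0 - x)).
    rewrite dotvBl dotvBr -(enormE (y k 0)) y1; ring.
  rewrite normrN; apply: le_trans (ler_normD _ _) _.
  have h1 := dK (y k 0 - x) (y k 0); have h2 := dK x (y k 0 - x).
  have h3 : K * (`|y k 0 - x| * `|y k 0|) <= K * (N.+1%:R^-1 * 1).
    by rewrite ler_wpM2l// ler_pM.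
  have h4 : K * (`|x| * `|y k 0 - x|) <= K * (`|x| * N.+1%:R^-1).
    by rewrite ler_wpM2l// ler_wpM2l.
  by move: h3 h4; move: (N.+1%:R^-1) => i; lra.
have [Y oY] := ode x.
have dY t : cderiv Y t (B (Y t) (Y t)) by apply/cderivP; exact: oY.2.
have Y1 t : 0 <= t -> `|Y t| <= 1.
  move=> t0; rewrite -ler_sqr ?nnegrE//.
  rewrite (le_trans (norm_sqr_le_dotv _))// expr1n -x1.
  by rewrite (ode_conserved Bcons oY.1 (fun t _ => dY t) t0).
have cY : continuous Y.
  move=> t; apply: differentiable_continuous; apply/derivable1_diffP.
  exact: (@ex_derive _ _ _ _ _ _ _ (oY.2 t)).
have [DY dDY _] : exists2 G : R -> R, forall t : R, 0 <= t -> is_derive t (1:R) G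
    (dotv (Y t) (A *m Y t)) & True.
  have [|G dG _] := @continuous_primitive _ (fun t => dotv (Y t) (A *m Y t)).
    move=> t; apply: (continuous_comp (f := Y) (g := fun x => dotv x (A *m x))).
      exact: cY.
    exact: dissipation_continuous.
  by exists G.
(* [DY] is nondecreasing: with no total gain it is constant on [[0, 1)], and its derivative, the
   dissipation, vanishes there. *)
have th0 : 0 < DY 1 - DY 0.
  rewrite ltNge; apply/negP => th; apply: (flow_dissipates x1 oY) => s /andP[s0 s1].
  have mono a b : 0 <= a -> a <= b -> DY a <= DY b.
    move=> a0 ab; apply: (@is_derive_ndecr _ _ (fun t => dotv (Y t) (A *m Y t)) _ _ ab) => //.
    by move=> t /andP[ta _]; apply: dDY; exact: le_trans ta.
  have cst t : s <= t < 1 -> DY t - DY 0 = 0.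
    move=> /andP[st t1]; have t0 := le_trans s0 st.
    have := mono 0 t (lexx _) t0; have := mono t 1 t0 (ltW t1); lra.
  apply: (right_zero_derive0 s1 cst).
  rewrite -[X in is_derive _ _ _ X]subr0; apply: is_deriveB; exact: dDY.
set th := DY 1 - DY 0 in th0.
(* Common bound of all the paths on [[0, 1]]: [driven_bounded] with [S = T = 1], where [4 * K]
   bounds [dotv (z 0) (z 0)] since [|z 0| <= 2]; the last 1 accounts for the noise [e]. *)
pose m := Num.sqrt (expR (16 * K ^+ 2) * (4 * K + 16 * K ^+ 2 * 2 ^+ 3)) + 1.
have m1 : 1 <= m by rewrite lerDr sqrtr_ge0.
have m0 : 0 <= m by exact: le_trans m1.
pose L := 2 * K * m.
have L0 : 0 <= L by rewrite !mulr_ge0.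
pose c1 := Num.sqrt (expR (4 * K * L) * (4 * K + 1)).
have c10 : 0 <= c1 by exact: sqrtr_ge0.
pose c2 := 2 * K ^+ 2 * m * (c1 + 1).
have c20 : 0 <= c2 by rewrite !mulr_ge0 ?sqr_ge0// addr_ge0.
(* When [y k] is close to [Y] at scale [eta], the two dissipations differ by at most [c2 * eta], and
   that of [y k] is below [eta]. This contradicts [th = 2 * (eta + c2 * eta)]. *)
pose eta := th / (2 * (1 + c2)).
have eta0 : 0 < eta by rewrite divr_gt0// mulr_gt0// ltr_pwDl.
pose N := Num.truncn eta^-1.
have [k Nk kx] := clx eta N eta0.
have [b [e [z [D [/andP[b0 bk] dr y1 ek [dD Dlt]]]]]] := yP k.
have keta : k.+1%:R^-1 <= eta.
  rewrite invf_ple ?posrE//; apply: (@le_trans _ _ N.+1%:R).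
    by rewrite ltW// truncnS_gt.
  by rewrite ler_nat.
have k1 : (k.+1%:R^-1 : R) <= 1 by rewrite invf_le1// ler1n.
have b1 : 0 <= b <= 1 by rewrite b0 (le_trans bk).
have I01 : (0 : R) <= (0 : R) <= (1 : R) by rewrite lexx ler01.
have e1 t : 0 <= t <= 1 -> `|e t| <= 1 by move=> t1; exact: le_trans (ek t t1) k1.
have ee t : 0 <= t <= 1 -> `|e t| <= eta by move=> t1; exact: le_trans (ek t t1) keta.
have y01 : `|y k 0| <= 1 by rewrite -y1 norm_le_enorm.
have [_ _ yze _] := dr.
have z0E : z 0 = y k 0 - e 0 by rewrite yze// addrK.
have zm t : 0 <= t <= 1 -> `|z t| <= m - 1.
  move=> t1; rewrite addrK -ler_sqr ?nnegrE ?sqrtr_ge0// sqr_sqrtr; last first.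
    rewrite mulr_ge0 ?expR_ge0// addr_ge0 ?mulr_ge0 ?sqr_ge0//.
  apply: le_trans (norm_sqr_le_dotv _) _.
  have := driven_bounded Bcons (Apsd_scale Apsd b0) K1 BK (AK_scale AK b1) dK dr e1 t1.
  move/le_trans; apply; rewrite !mulr1; apply: ler_wpM2l; first exact: expR_ge0.
  apply: lerD; last by [].
  apply: le_trans (dotv_norm_ub _) _; rewrite mulrC; apply: ler_wpM2r => //.
  have : `|z 0| <= 2.
    by rewrite z0E (le_trans (ler_normB _ _))// lerD// e1.
  move=> z2; rewrite (_ : 4 = 2 ^+ 2); last by rewrite -natrX.
  by rewrite lerXn2r ?nnegrE.
have ym t : 0 <= t <= 1 -> `|y k t| <= m.
  move=> t1; have t0 : 0 <= t by case/andP: t1.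
  rewrite yze// (le_trans (ler_normD _ _))//.
  by rewrite -[leRHS](subrK 1) lerD ?zm ?e1.
have Ym t : 0 <= t -> `|Y t| <= m by move=> t0; exact: le_trans (Y1 t t0) m1.
have drY : driven (drift B ((0:R) *: A)) Y (fun=> 0) Y.
  split => //; first exact: cst_continuous.
    by move=> t _; rewrite addr0.
  by move=> t _; rewrite /drift scale0r mul0mx subr0; exact: dY.
have close t : 0 <= t <= 1 -> `|Y t - y k t| <= (c1 + 1) * eta.
  move=> t1; have t0 : 0 <= t by case/andP: t1.
  have hF s : 0 <= s <= 1 -> `|drift B (b *: A) (y k s) - drift B (0 *: A) (Y s)| <=
      L * (`|y k s - Y s| + eta).
    move=> s1; apply: drift_close => //; [exact: ym|by apply: Ym; case/andP: s1| | ].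
      by rewrite b0 (le_trans bk).
    by rewrite lexx ltW.
  have hg s : 0 <= s <= 1 -> `|e s - 0| <= eta by move=> s1; rewrite subr0; exact: ee.
  have := driven_close K0 dK L0 (ltW eta0) dr drY hF hg t1.
  have z0x : dotv (z 0 - Y 0) (z 0 - Y 0) <= 4 * K * eta ^+ 2.
    rewrite oY.1; apply: le_trans (dotv_norm_ub _) _.
    have : `|z 0 - x| <= 2 * eta.
      rewrite z0E addrAC (le_trans (ler_normB _ _))//.
      by rewrite mulrDl !mul1r lerD ?ee// distrC.
    move=> h; have := normr_ge0 (z 0 - x) => h0.
    have : `|z 0 - x| ^+ 2 <= (2 * eta) ^+ 2 by rewrite lerXn2r ?nnegrE// mulr_ge0// ltW.
    by move/(ler_wpM2l K0)/le_trans; apply; rewrite exprMn le_eqVlt; apply/orP; left; apply/eqP; ring.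
  move=> h.
  have zY : `|z t - Y t| <= c1 * eta.
    have ce0 : 0 <= c1 * eta by rewrite mulr_ge0// ltW.
    rewrite -ler_sqr ?nnegrE// exprMn sqr_sqrtr; last first.
      by rewrite mulr_ge0 ?expR_ge0// addr_ge0// mulr_ge0.
    apply: le_trans (norm_sqr_le_dotv _) _.
    apply: le_trans (le_trans _ h) _; first by rewrite lerDl sqr_ge0.
    rewrite -[leRHS]mulrA; apply: ler_pM.
    - exact: expR_ge0.
    - by rewrite addr_ge0 ?dotv_ge0 ?sqr_ge0.
    - rewrite ler_expR ler_piMr//; first by rewrite !mulr_ge0.
      by case/andP: t1.
    - by rewrite mulrDl mul1r lerD2r.
  rewrite yze// opprD addrA (le_trans (ler_normB _ _))// distrC.
  by rewrite mulrDl mul1r lerD ?ee.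
have : (DY 1 - D 1) - (DY 0 - D 0) <= (c2 * eta) * (1 - 0).
  apply: (@is_derive_growth _ (fun t => DY t - D t)
    (fun t => dotv (Y t) (A *m Y t) - dotv (y k t) (A *m y k t))) => //.
    by move=> t /andP[t0 _]; apply: is_deriveB; [exact: dDY|exact: dD].
  move=> t /andP[t0 t1]; have tt : 0 <= t <= 1 by rewrite !ltW.
  apply: le_trans (dissipation_diff (Ym _ (ltW t0)) (ym _ tt)) _.
  rewrite /c2 -[leRHS]mulrA; apply: ler_wpM2l; last exact: close.
  by rewrite !mulr_ge0// sqr_ge0.
have : th = 2 * (eta + c2 * eta).
  by rewrite /eta; field; rewrite gt_eqF// ltr_pwDl.
have Deta : D 1 - D 0 < eta := lt_le_trans Dlt keta.
have thE : th = DY 1 - DY 0 by [].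
have c2eta : 0 <= c2 * eta by rewrite mulr_ge0// ltW.
move: thE Deta c2eta eta0; lra.
Qed.

Lemma enorm_le_norm (x : 'cV[R]_n) : enorm x <= K * `|x|.
Proof.
rewrite -ler_sqr ?nnegrE ?enorm_ge0 ?mulr_ge0// enormE.
apply: le_trans (dotv_norm_ub x) _; rewrite exprMn ler_wpM2r ?sqr_ge0//.
by rewrite expr2 ler_peMl.
Qed.

(** Undoes the scaling by [r = enorm (u 0)]. The threshold makes the rescaled damping [1 / r] and
    noise [S / r] at most [1 / k]. The dissipation rate [u . A u] is of order [r^2]; over a time
    [1 / r] it integrates to order [r]. *)
Lemma local_dissipation : exists2 k : nat, (0 < k)%N &
  forall (u g v : R -> 'cV[R]_n) (D : R -> R) (S : R), 0 <= S ->
  driven (drift B A) u g v -> k%:R * (1 + S) <= enorm (u 0) ->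
  (forall t, 0 <= t <= (enorm (u 0))^-1 -> `|g t| <= S) ->
  (forall t : R, 0 <= t -> is_derive t (1:R) D (dotv (u t) (A *m u t))) ->
  k%:R^-1 * enorm (u 0) <= D (enorm (u 0))^-1 - D 0.
Proof.
have [k k0 hk] := rescaled_dissipation.
exists k => // u g v D S S0 dr ku gS dD.
have k0' : 0 < k%:R :> R by rewrite ltr0n.
set r := enorm (u 0) in ku gS *.
have kr : k%:R <= r by apply: le_trans ku; rewrite ler_peMr ?(ltW k0')// lerDl.
have r0 : 0 < r by exact: lt_le_trans kr.
have rV0 : 0 <= r^-1 by rewrite invr_ge0 ltW.
have drS := driven_scale rV0 (drift_rescale B A r^-1) dr.
have -> : k%:R^-1 * r <= D r^-1 - D 0 = (k%:R^-1 <= r^-1 * D (r^-1 * 1) - r^-1 * D (r^-1 * 0)).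
  by rewrite mulr1 mulr0 -mulrBr mulrC ler_pdivlMl.
apply: (hk r^-1 _ _ _ (fun s => r^-1 * D (r^-1 * s)) _ drS) => /=.
- by rewrite rV0 lef_pV2 ?posrE.
- by rewrite mulr0 enormZ -/r ger0_norm// mulVf ?gt_eqF.
- move=> t /andP[t0 t1].
  have gt : `|g (r^-1 * t)| <= S by apply: gS; rewrite mulr_ge0//= ler_piMr.
  rewrite normrZ ger0_norm// mulrC ler_pdivrMr//.
  apply: le_trans gt _; rewrite ler_pdivlMl//.
  by apply: le_trans ku; apply: ler_wpM2l; [exact: ltW|rewrite lerDr].
- move=> t t0; rewrite -scalemxAr dotvZl dotvZr; apply: is_deriveZ.
  rewrite mulrC; apply: is_derive1_comp.
    by apply: dD; rewrite mulr_ge0.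
  by rewrite -[X in is_derive _ _ _ X]mulr1; apply: is_deriveZ.
Qed.

Lemma dissipation_primitive (u : R -> 'cV[R]_n) : continuous u ->
  exists D : R -> R, forall t : R, 0 <= t -> is_derive t (1:R) D (dotv (u t) (A *m u t)).
Proof.
move=> cu; have [|D dD _] := @continuous_primitive _ (fun t => dotv (u t) (A *m u t)).
  move=> t; apply: (continuous_comp (f := u) (g := fun x => dotv x (A *m x))).
    exact: cu.
  exact: dissipation_continuous.
by exists D.
Qed.

(** The threshold gives [|u| >= 2 (1 + S)], hence [|u| >= 1] and [|u| <= 2 |v|]: every error is
    absorbed into [|g| |v|^2] and, unlike in [crude_rate], no additive source is left. *)
Lemma large_rate (u g v : 'cV[R]_n) (S : R) : 0 <= S -> u = v + g -> `|g| <= S ->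
  2 * K * (1 + S) <= enorm u ->
  2 * dotv v (drift B A u) <=
    - (2 * dotv u (A *m u)) + 16 * K ^+ 2 * `|g| * dotv v v.
Proof.
move=> S0 uvg gS uS.
have vE : v = u - g by rewrite uvg addrK.
rewrite {1}vE; apply: le_trans (energy_rate Bcons K1 BK AK dK u g) _.
rewrite lerD2l.
have h1 : 2 * (1 + S) <= `|u|.
  have := le_trans uS (enorm_le_norm u).
  rewrite mulrAC [leRHS]mulrC ler_pM2r//; exact: lt_le_trans K1.
have h2 : `|u| <= `|v| + `|g| by rewrite uvg ler_normD.
have h3 := norm_sqr_le_dotv v.
have g0 := normr_ge0 g; have u0 := normr_ge0 u; have v0 := normr_ge0 v.
have h4 : `|u| <= 2 * `|v| by lra.
have h5 : `|u| ^+ 2 <= (2 * `|v|) ^+ 2 by rewrite lerXn2r ?nnegrE// mulr_ge0.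
have h6 : `|u| ^+ 2 + `|u| <= 8 * dotv v v.
  have : `|u| <= `|u| ^+ 2 by rewrite expr2 ler_peMl//; lra.
  by move: h5; rewrite exprMn; lra.
have K20 : 0 <= 2 * K ^+ 2 * `|g| by rewrite !mulr_ge0 ?sqr_ge0.
by have := ler_wpM2l K20 h6; lra.
Qed.

(** * Exponential decay of the energy as long as the path stays large *)

Section Contraction.
Variable k : nat.
Hypothesis k0 : (0 < k)%N.
Hypothesis kP : forall (u g v : R -> 'cV[R]_n) (D : R -> R) (S : R), 0 <= S ->
  driven (drift B A) u g v -> k%:R * (1 + S) <= enorm (u 0) ->
  (forall t, 0 <= t <= (enorm (u 0))^-1 -> `|g t| <= S) ->
  (forall t : R, 0 <= t -> is_derive t (1:R) D (dotv (u t) (A *m u t))) ->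
  k%:R^-1 * enorm (u 0) <= D (enorm (u 0))^-1 - D 0.

Let C := 16 * K ^+ 2.
Let C0 : 0 <= C. Proof. by rewrite mulr_ge0// sqr_ge0. Qed.
(** Decay rate: a step of length [h = 1 / r] removes at least [2 exp (- C) r / k] from an energy of
    at most [4 K r^2], that is, at least the fraction [c * h] of that bound. *)
Let c := expR (- C) / (2 * K * k%:R).
Let c0 : 0 < c.
Proof.
by rewrite divr_gt0 ?expR_gt0// !mulr_gt0 ?ltr0n// (lt_le_trans _ K1).
Qed.

(** [a] is a lower bound of the integrating factor. With [a = 0] the estimate reduces to
    monotonicity, which is how an incomplete last step is treated. *)
Lemma large_decreasing (u g v : R -> 'cV[R]_n) (G D : R -> R) (S h a : R) :
  0 <= S -> 0 <= h -> driven (drift B A) u g v ->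
  (forall t : R, 0 <= t -> is_derive t (1:R) G `|g t|) ->
  (forall t : R, 0 <= t -> is_derive t (1:R) D (dotv (u t) (A *m u t))) ->
  (forall t, 0 <= t <= h -> `|g t| <= S /\ 2 * K * (1 + S) <= enorm (u t)) ->
  (forall t, 0 <= t <= h -> a <= expR (- (C * G t))) ->
  dotv (v h) (v h) * expR (- (C * G h)) + 2 * a * (D h - D 0) <=
  dotv (v 0) (v 0) * expR (- (C * G 0)).
Proof.
move=> S0 h0 [cu cg uvg dv] dG dD big ha.
pose e t := expR (- (C * G t)).
have := @is_derive_nincr _ (fun s => dotv (v s) (v s) * e s + 2 * a * (D s - D 0))
   (fun s => (dotv (v s) (v s) * (e s * - (C * `|g s|)) +
              e s * (2 * dotv (v s) (drift B A (u s)))) + 2 * a * dotv (u s) (A *m u s)) 0 h h0.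
rewrite subrr mulr0 addr0; apply.
  move=> t /andP[t0 _]; apply: is_deriveD; last first.
    apply: is_deriveZ; rewrite -[X in is_derive _ _ _ X]subr0.
    by apply: is_deriveB; exact: dD.
  apply: is_deriveM; first exact/is_derive_dotv/dv.
  apply: (@is_derive1_comp _ expR (fun s => - (C * G s))).
  by apply: is_deriveN; apply: is_deriveZ; apply: dG.
move=> t /andP[t0 th]; have tt : 0 <= t <= h by rewrite !ltW.
have [gS uS] := big t tt.
have := large_rate S0 (uvg t (ltW t0)) gS uS; rewrite -/C.
have := ha t tt; rewrite -/(e t) => ae.
have e0 : 0 <= e t by exact: expR_ge0.
have Au := Apsd (u t).
move=> /(ler_wpM2l e0).
have := ler_wpM2r Au ae.
lra.
Qed.

Lemma large_step (u g v : R -> 'cV[R]_n) (G : R -> R) (S : R) :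
  0 <= S -> driven (drift B A) u g v ->
  (forall t : R, 0 <= t -> is_derive t (1:R) G `|g t|) -> G 0 = 0 ->
  (2 * K + k%:R) * (1 + S) <= enorm (u 0) ->
  (forall t, 0 <= t <= (enorm (u 0))^-1 ->
     `|g t| <= S /\ (2 * K + k%:R) * (1 + S) <= enorm (u t)) ->
  forall h, h = (enorm (u 0))^-1 ->
  dotv (v h) (v h) <= dotv (v 0) (v 0) * expR (C * G h - c * h).
Proof.
move=> S0 dr dG G0 ku big h hE; rewrite -hE in big.
have kk0 : 0 < k%:R :> R by rewrite ltr0n.
have S10 : 0 < 1 + S by rewrite ltr_pwDl.
have KS0 : 0 <= 2 * K * (1 + S) by rewrite !mulr_ge0// ltW.
have kS0 : 0 <= k%:R * (1 + S) by rewrite mulr_ge0// ltW.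
have r0 : 0 < enorm (u 0).
  by apply: lt_le_trans ku; rewrite mulr_gt0// ltr_wpDl// mulr_ge0.
have h0 : 0 <= h by rewrite hE invr_ge0 ltW.
have [cu _ uvg _] := dr.
have [D dD] := dissipation_primitive cu.
have hD : k%:R^-1 * enorm (u 0) <= D h - D 0.
  rewrite hE; apply: (kP S0 dr) => //; last by rewrite -hE => t /big[].
  by apply: le_trans ku; rewrite mulrDl lerDr.
(* The step lasts [1 / |u_0|] and [|u_0| >= S], so the noise integrates to at most 1 over it. This
   is the origin of [expR (- C)] in [c]. *)
have Gle t : 0 <= t <= h -> C * G t <= C.
  move=> /andP[t0 th]; rewrite ler_piMr//.
  have : G t - G 0 <= S * (t - 0).
    apply: (@is_derive_growth _ G (fun s => `|g s|)) => //.
      by move=> s /andP[s0 _]; exact: dG.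
    move=> s /andP[s0 st]; have [] := big s; last by [].
    by rewrite (ltW s0) (le_trans (ltW st)).
  rewrite G0 !subr0 => /le_trans; apply.
  apply: (@le_trans _ _ (S * h)); first by rewrite ler_wpM2l.
  rewrite hE ler_pdivrMr// mul1r; apply: le_trans ku.
  apply: (@le_trans _ _ (1 + S)); first by rewrite lerDr.
  rewrite ler_peMl ?(ltW S10)//.
  by rewrite (@le_trans _ _ k%:R) ?ler1n// lerDr mulr_ge0.
have big2 t : 0 <= t <= h -> `|g t| <= S /\ 2 * K * (1 + S) <= enorm (u t).
  move=> /big[gS uS]; split => //; apply: le_trans uS; apply: ler_wpM2r.
    exact: ltW.
  by rewrite lerDl ltW.
have eG t : 0 <= t <= h -> expR (- C) <= expR (- (C * G t)).
  by move=> /Gle GC; rewrite ler_expR lerN2.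
have := large_decreasing S0 h0 dr dG dD big2 eG.
rewrite G0 mulr0 oppr0 expR0 mulr1 => hdec.
have q0 : dotv (v 0) (v 0) <= 4 * K * enorm (u 0) ^+ 2.
  have I0 : (0:R) <= (0:R) <= h by rewrite lexx h0.
  have gS := (big 0 I0).1.
  have vE : v 0 = u 0 - g 0 by rewrite uvg// addrK.
  apply: le_trans (dotv_norm_ub _) _; 
  have -> : 4 * K * enorm (u 0) ^+ 2 = K * (4 * enorm (u 0) ^+ 2) by ring.
  apply: ler_wpM2l => //.
  have -> : 4 * enorm (u 0) ^+ 2 = (2 * enorm (u 0)) ^+ 2 by ring.
  rewrite lerXn2r ?nnegrE ?mulr_ge0 ?enorm_ge0// vE.
  apply: le_trans (ler_normB _ _) _; have := norm_le_enorm (u 0).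
  have : S <= enorm (u 0).
    apply: le_trans ku; apply: (@le_trans _ _ (1 + S)); first by rewrite lerDr.
    rewrite ler_peMl ?(ltW S10)//.
    by rewrite (@le_trans _ _ k%:R) ?ler1n// lerDr mulr_ge0.
  lra.
have ech : 1 - c * h <= expR (- (c * h)) by exact: expR_ge1Dx.
have hq : dotv (v h) (v h) * expR (- (C * G h)) <= dotv (v 0) (v 0) * (1 - c * h).
  have e0 : 0 <= 2 * expR (- C) by rewrite mulr_ge0// expR_ge0.
  have := ler_wpM2l e0 hD => h1.
  have ch0 : 0 <= c * h by rewrite mulr_ge0// ltW.
  have := ler_wpM2r ch0 q0.
  have -> : 4 * K * enorm (u 0) ^+ 2 * (c * h) = 2 * expR (- C) * (k%:R^-1 * enorm (u 0)).
    rewrite /c hE; field; rewrite !gt_eqF//; exact: lt_le_trans K1.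
  lra.
rewrite -(ler_pM2r (expR_gt0 (- (C * G h)))) -[leRHS]mulrA -expRD.
have -> : C * G h - c * h + - (C * G h) = - (c * h) by ring.
by apply: le_trans hq _; rewrite ler_wpM2l// dotv_ge0.
Qed.

(** The path is followed through consecutive steps of length [1 / |u|], each gaining [exp (- c h)]
    by [large_step]. The last step is incomplete and gains nothing; it is shorter than [1 / a],
    hence the exponent [T - a^-1]. *)
Lemma large_contraction (u g v : R -> 'cV[R]_n) (G : R -> R) (S T a : R) :
  0 <= S -> 0 <= T -> driven (drift B A) u g v ->
  (forall t : R, 0 <= t -> is_derive t (1:R) G `|g t|) -> G 0 = 0 ->
  2 * K + k%:R <= a ->
  (forall t, 0 <= t <= T -> `|g t| <= S /\ a * (1 + S) <= enorm (u t)) ->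
  dotv (v T) (v T) <= dotv (v 0) (v 0) * expR (C * G T - c * (T - a^-1)).
Proof.
move=> S0 T0 dr dG G0 ka big.
have kk0 : 0 < k%:R :> R by rewrite ltr0n.
have a0 : 0 < a by apply: lt_le_trans ka; rewrite ltr_wpDl// mulr_ge0.
have S10 : 0 < 1 + S by rewrite ltr_pwDl.
have last_step u' g' v' G' T' : 0 <= T' -> driven (drift B A) u' g' v' ->
    (forall t : R, 0 <= t -> is_derive t (1:R) G' `|g' t|) -> G' 0 = 0 ->
    (forall t, 0 <= t <= T' -> `|g' t| <= S /\ a * (1 + S) <= enorm (u' t)) ->
    T' < (enorm (u' 0))^-1 ->
    dotv (v' T') (v' T') <= dotv (v' 0) (v' 0) * expR (C * G' T' - c * (T' - a^-1)).
  move=> {}T0 {}dr {}dG {}G0 {}big Th.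
  have I0 : (0:R) <= (0:R) <= T' by rewrite lexx T0.
  have r0 : a <= enorm (u' 0).
    by apply: le_trans (big 0 I0).2; rewrite ler_peMr ?(ltW a0)// lerDl.
  have rT : T' - a^-1 <= 0.
    rewrite subr_le0; apply: le_trans (ltW Th) _.
    by rewrite lef_pV2 ?posrE//; exact: lt_le_trans r0.
  have [cu _ _ _] := dr; have [D dD] := dissipation_primitive cu.
  have big2 t : 0 <= t <= T' -> `|g' t| <= S /\ 2 * K * (1 + S) <= enorm (u' t).
    move=> /big[gS uS]; split => //; apply: le_trans uS; rewrite ler_wpM2r ?(ltW S10)//.
    by apply: le_trans ka; rewrite lerDl ltW.
  have e0 t : 0 <= t <= T' -> 0 <= expR (- (C * G' t)) by move=> _; exact: expR_ge0.
  have := large_decreasing S0 T0 dr dG dD big2 e0.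
  rewrite G0 !mulr0 mul0r addr0 oppr0 expR0 mulr1 => h.
  rewrite -(ler_pM2r (expR_gt0 (- (C * G' T')))) -[leRHS]mulrA -expRD.
  apply: le_trans h _; rewrite ler_peMr ?dotv_ge0// -expR0 ler_expR.
  have -> : C * G' T' - c * (T' - a^-1) + - (C * G' T') = - (c * (T' - a^-1)) by ring.
  by rewrite oppr_ge0 mulr_ge0_le0// ltW.
have [m m0 um] : exists2 m : R, 0 < m & forall t, 0 <= t <= T -> enorm (u t) <= m.
  have [cu _ _ _] := dr.
  have [M M0 uM] := continuous_bounded_segment T cu.
  exists (K * M + 1); first by rewrite ltr_wpDl// mulr_ge0.
  move=> t tT; apply: le_trans (enorm_le_norm _) _.
  by rewrite ler_wpDr// ler_wpM2l// uM.
(* Each full step lasts at least [1 / m], so [N] bounds the number of steps and the induction runs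
   on it. *)
have [N TN] : exists N, T * m <= N%:R.
  by exists (Num.truncn (T * m)).+1; rewrite ltW// truncnS_gt.
elim: N u v g G T T0 dr dG G0 big um TN => [|N IH] u v g G T T0 dr dG G0 big um TN.
  have I0 : (0:R) <= (0:R) <= T by rewrite lexx T0.
  apply: (last_step _ _ _ _ _ T0 dr dG G0 big); apply: (@le_lt_trans _ _ 0).
    by rewrite -(pmulr_lle0 T m0).
  rewrite invr_gt0; apply: lt_le_trans (big 0 I0).2.
  by rewrite mulr_gt0.
have [Th|hT] := ltP T (enorm (u 0))^-1; first exact: (last_step _ _ _ _ _ T0 dr dG G0 big).
have I0 : (0:R) <= (0:R) <= T by rewrite lexx T0.
have r0 : 0 < enorm (u 0) by apply: lt_le_trans (big 0 I0).2; rewrite mulr_gt0.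
pose h := (enorm (u 0))^-1.
have h0 : 0 <= h by rewrite invr_ge0 ltW.
have hT' : h <= T by [].
have big3 t : 0 <= t <= T -> `|g t| <= S /\ (2 * K + k%:R) * (1 + S) <= enorm (u t).
  by move=> /big[gS uS]; split => //; apply: le_trans uS; rewrite ler_wpM2r// ltW.
have step : dotv (v h) (v h) <= dotv (v 0) (v 0) * expR (C * G h - c * h).
  apply: (large_step S0 dr dG G0 (big3 0 I0).2) => //.
  by move=> t /andP[t0 th]; apply: big3; rewrite t0 (le_trans th).
have sh t : 0 <= t <= T - h -> 0 <= h + t <= T.
  by move=> /andP[t0 tT]; rewrite addr_ge0//= addrC -lerBrDr.
have := IH _ _ _ (fun t => G (h + t) - G h) (T - h) _ (driven_shift h0 dr).
rewrite subr_ge0 addr0 (addrC h (T - h)) subrK => /(_ hT') IH'.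
have := IH' _ (subrr _) => {}IH'.
apply: le_trans (IH' _ _ _ _) _.
- move=> t t0; rewrite -[X in is_derive _ _ _ X]subr0; apply: is_deriveB.
  rewrite -[X in is_derive _ _ _ X]mulr1.
  apply: (@is_derive1_comp _ G (fun t => h + t)).
    by apply: dG; rewrite addr_ge0.
  by rewrite -[X in is_derive _ _ _ X]add0r; apply: is_deriveD.
- by move=> t /sh/big.
- by move=> t /sh/um.
- have : 1 <= h * m.
    by rewrite /h mulrC ler_pdivlMr// mul1r um.
  by move: TN; rewrite -natr1 mulrBl; lra.
apply: le_trans (ler_wpM2r (expR_ge0 _) step) _.
rewrite -mulrA -expRD ler_wpM2l ?dotv_ge0// ler_expR.
by rewrite le_eqVlt; apply/orP; left; apply/eqP; ring.
Qed.

End Contraction.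

(** The rate [c] depends neither on [T] nor on [S], which leaves [T] free to be taken small in terms
    of [c]; the size of the noise affects [M] alone. *)
Lemma driven_contraction : exists2 c : R, 0 < c & forall T S : R, 0 < T -> 0 <= S ->
  exists M : R, forall (u g v : R -> 'cV[R]_n) (G : R -> R), driven (drift B A) u g v ->
  (forall t : R, 0 <= t -> is_derive t (1:R) G `|g t|) -> G 0 = 0 ->
  (forall t, 0 <= t <= T -> `|g t| <= S) ->
  dotv (v T) (v T) <= dotv (v 0) (v 0) * expR (16 * K ^+ 2 * G T - c * T) + M.
Proof.
have [k k0 kP] := local_dissipation.
have kk0 : 0 < k%:R :> R by rewrite ltr0n.
pose c := expR (- (16 * K ^+ 2)) / (2 * K * k%:R).
have c0 : 0 < c.
  by rewrite divr_gt0 ?expR_gt0// !mulr_gt0// (lt_le_trans _ K1).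
exists (c / 2); first by rewrite divr_gt0.
move=> T S T0 S0.
(* The bound [a >= 2 / T] keeps the loss [a^-1] below [T / 2], whence the rate [c / 2]. *)
pose a := Num.max (2 * K + k%:R) (2 / T).
have ka : 2 * K + k%:R <= a by rewrite le_max lexx.
have aT : 2 / T <= a by rewrite le_max lexx orbT.
have a0 : 0 < a by apply: lt_le_trans aT; rewrite divr_gt0.
pose b := K * (a * (1 + S) + S) ^+ 2 + 16 * K ^+ 2 * ((1 + S) ^+ 3 * T).
pose M := expR (16 * K ^+ 2 * (S * T)) * b.
have C0 : 0 <= 16 * K ^+ 2 by rewrite mulr_ge0// sqr_ge0.
have b0 : 0 <= b.
  apply: addr_ge0; first by rewrite mulr_ge0// sqr_ge0.
  by rewrite !mulr_ge0// ?exprn_ge0 ?addr_ge0// ltW.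
have M0 : 0 <= M by rewrite mulr_ge0// expR_ge0.
exists M => u g v G dr dG G0 gS.
(* Either the path stays above the threshold on [[0, T]] and contracts, or it is below it at some
   time [t] and, restarted from there, ends below [M] whatever its starting point. *)
have [big|/existsNP[t /not_implyP[tT /negP]]] :=
    pselect (forall t, 0 <= t <= T -> a * (1 + S) <= enorm (u t)).
  have big' t : 0 <= t <= T -> `|g t| <= S /\ a * (1 + S) <= enorm (u t).
    by move=> tT; split; [exact: gS|exact: big].
  apply: ler_wpDr => //.
  apply: le_trans (large_contraction k0 kP S0 (ltW T0) dr dG G0 ka big') _.
  rewrite ler_wpM2l ?dotv_ge0// ler_expR lerD2l lerN2 -/c -mulrA ler_pM2l//.
  have : a^-1 <= T / 2 by rewrite -[T / 2]invf_div lef_pV2 ?posrE ?divr_gt0.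
  lra.
rewrite -ltNge => ut.
have [t0 tT'] := andP tT.
apply: ler_wpDl; first by rewrite mulr_ge0 ?dotv_ge0 ?expR_ge0.
have gS' s : 0 <= s <= T - t -> `|g (t + s)| <= S.
  by move=> /andP[s0 sT]; apply: gS; rewrite addr_ge0//= addrC -lerBrDr.
have I1 : 0 <= T - t <= T - t by rewrite lexx subr_ge0 tT'.
have := driven_bounded Bcons Apsd K1 BK AK dK (driven_shift t0 dr) gS' I1.
rewrite addr0 [t + _]addrC subrK => /le_trans; apply.
have Tt : T - t <= T by rewrite gerBl.
rewrite /M; apply: ler_pM; first exact: expR_ge0.
- apply: addr_ge0; first exact: dotv_ge0.
  by rewrite mulr_ge0// mulr_ge0 ?subr_ge0// exprn_ge0// addr_ge0.
- by rewrite ler_expR; apply: ler_wpM2l => //; apply: ler_wpM2l.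
apply: lerD; last first.
  by apply: ler_wpM2l => //; apply: ler_wpM2l => //; rewrite exprn_ge0// addr_ge0.
apply: le_trans (dotv_norm_ub _) _; apply: ler_wpM2l => //.
rewrite lerXn2r ?nnegrE// ?addr_ge0 ?mulr_ge0 ?addr_ge0 ?(ltW a0)//.
have [_ _ uvg _] := dr.
have -> : v t = u t - g t by rewrite uvg// addrK.
apply: le_trans (ler_normB _ _) _; apply: lerD; last exact: gS.
exact: le_trans (norm_le_enorm _) (ltW ut).
Qed.

End Dissipation.

(** * Integral equation and Euler scheme *)

(** Freezing a path at its initial value for negative times turns continuity on [[0, +oo[] into
    continuity on the line, the form in which [driven] is stated. *)
Definition pos_time (R : realType) (t : R) : R := Num.max 0 t.

Lemma pos_time_ge0 (R : realType) (t : R) : 0 <= pos_time t.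
Proof. by rewrite /pos_time le_max lexx. Qed.

Lemma pos_timeE (R : realType) (t : R) : 0 <= t -> pos_time t = t.
Proof. by move=> t0; rewrite /pos_time max_r. Qed.

Lemma pos_time_lipschitz (R : realType) (t s : R) :
  `|pos_time t - pos_time s| <= `|t - s|.
Proof.
have : `|t - s| <= `|t - s| by []; rewrite {1}ler_norml => /andP[h1 h2].
have d0 := normr_ge0 (t - s).
by rewrite /pos_time ler_norml; case: (lerP 0 t); case: (lerP 0 s); lra.
Qed.

Lemma continuous_pos_time (R : realType) (V : normedModType R) (f : R -> V) :
  {within `[0, +oo[, continuous f} -> continuous (f \o @pos_time R).
Proof.
move=> cf t; apply/cvgrPdist_le => e e0.
have pt0 : `[(0:R), +oo[%classic (pos_time t) by rewrite /= in_itv /= pos_time_ge0.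
have /cvgrPdist_le/(_ e e0) := (subspace_continuousP _ _).1 cf _ pt0.
rewrite /within /= => -[d d0 hd].
exists d => // s ts; apply: hd.
  by rewrite /ball_ /= (le_lt_trans (pos_time_lipschitz _ _)).
by rewrite /= in_itv /= pos_time_ge0.
Qed.

Lemma uniformly_continuous_segment (R : realType) (V : normedModType R)
    (f : R -> V) (T e : R) : continuous f -> 0 < e ->
  exists2 d : R, 0 < d & forall s t, 0 <= t <= T -> `|s - t| <= d -> `|f s - f t| <= e.
Proof.
move=> cf e0.
have cov := (compact_near_coveringP _).1 (@segment_compact R 0 T).
have [x _|] := cov R 0^'+ (fun d t => forall s, `|s - t| <= d -> `|f s - f t| <= e).
- have e2 : 0 < e / 2 by rewrite divr_gt0.
  have /cvgrPdist_le/(_ _ e2)[d /= d0 hd] := cf x.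
  have d2 : 0 < d / 2 by rewrite divr_gt0.
  exists (ball x (d / 2), [set r | r < d / 2]) => /=.
    split; first exact: nbhsx_ballx.
    exact: nbhs_right_lt.
  move=> [t r] /= [xt rd] s str; rewrite -ball_normE /= in xt.
  have h1 : `|f x - f t| <= e / 2 by apply: hd => /=; rewrite (lt_trans xt)// ltr_pdivrMr// ltr_pMr// ltr1n.
  have h2 : `|f x - f s| <= e / 2.
    apply: hd => /=; have -> : x - s = (x - t) - (s - t) by rewrite opprB addrA subrK.
    apply: le_lt_trans (ler_normB _ _) _; lra.
  have -> : f s - f t = (f x - f t) - (f x - f s) by rewrite opprB addrCA addrAC subrr add0r addrC.
  apply: le_trans (ler_normB _ _) _; lra.
- move=> d /= d0 hd; exists (d / 2); first by rewrite divr_gt0.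
  move=> s t tT st; apply: (hd (d / 2) _ _ t tT s st).
    rewrite /ball_ /= sub0r normrN gtr0_norm ?divr_gt0//.
    by rewrite ltr_pdivrMr// ltr_pMr// ltr1n.
  by rewrite divr_gt0.
Qed.

Section Bridge.
Context {R : realType} {n : nat}.
Variables (F : 'cV[R]_n -> 'cV[R]_n) (sigma : 'M[R]_n).
Hypothesis cF : continuous F.

Lemma mulmx_continuous : continuous (fun x : 'cV[R]_n => sigma *m x).
Proof.
have [K K0 sK] := mulmx_bounded sigma.
apply: locally_lipschitz_continuous => x; exists K => y _.
by rewrite -mulmxBr.
Qed.

Lemma integral_equation_driven (x : 'cV[R]_n) (y w : R -> 'cV[R]_n) :
  {within `[0, +oo[, continuous y} -> {within `[0, +oo[, continuous w} ->
  (forall t, 0 <= t -> y t =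
     x + (\col_i \int[lebesgue_measure]_(s in `[0, t]) (F (y s) i 0)) + sigma *m w t) ->
  exists v, driven F (y \o @pos_time R) (fun t => sigma *m w (pos_time t)) v /\ v 0 = x.
Proof.
move=> /continuous_pos_time cy /continuous_pos_time cw eq.
have cf i : continuous (fun s => F (y (pos_time s)) i 0).
  move=> s; apply: (continuous_comp (f := fun s => F (y (pos_time s))) (g := fun x : 'cV[R]_n => x i 0)); last exact: coord_continuous.
  by apply: (continuous_comp (f := y \o @pos_time R) (g := F)); [exact: cy|exact: cF].
have /(_ _)/cid2 Pr i := continuous_primitive (cf i).
pose P i := s2val (Pr i).
have P0 i : P i 0 = 0.
  by rewrite /P (s2valP' (Pr i))// set_itv1 Rintegral_set1.
exists (fun t => \col_i (x i 0 + P i t)); split; last first.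
  by apply/matrixP => i j; rewrite mxE ord1 P0 addr0.
split => //.
- move=> t; apply: (continuous_comp (f := w \o @pos_time R) (g := fun x => sigma *m x)).
    exact: cw.
  exact: mulmx_continuous.
- move=> t t0; rewrite /= pos_timeE// eq//; congr (_ + _).
  apply/matrixP => i j; rewrite !mxE ord1; congr (_ + _).
  rewrite /P (s2valP' (Pr i))//; apply: eq_Rintegral => s.
  by rewrite inE /= in_itv /= => /andP[s0 _]; rewrite pos_timeE.
- move=> t t0 i.
  have -> : (fun s => (\col_i (x i 0 + P i s)) i 0) = (fun s => x i 0 + P i s).
    by apply/funext => s; rewrite mxE.
  rewrite -[X in is_derive _ _ _ X]add0r; apply: is_deriveD.
  exact: (s2valP (Pr i)).
Qed.

End Bridge.

Section EulerScheme.
Context {R : realType} {n : nat}.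

Definition mesh (m : nat) : R := 2^-1 ^+ m.

Lemma mesh_gt0 m : 0 < mesh m.
Proof. by rewrite exprn_gt0// invr_gt0. Qed.

Fixpoint euler (F : 'cV[R]_n -> 'cV[R]_n) (d : R) (z : nat -> 'cV[R]_n)
    (x : 'cV[R]_n) (j : nat) : 'cV[R]_n :=
  if j is j'.+1 then let y := euler F d z x j' in y + d *: F y + z j' else x.

Variables (F : 'cV[R]_n -> 'cV[R]_n).
Hypothesis cF : continuous F.
Hypothesis locF : forall m, exists2 L, 0 <= L & forall x y : 'cV[R]_n,
  `|x| <= m -> `|y| <= m -> `|F x - F y| <= L * `|x - y|.

(* The stability constant on the ball of radius [sup |u| + 1] is enough: the error
   stays below 1 along the induction. *)
Lemma euler_converges (u g v : R -> 'cV[R]_n) (z : nat -> nat -> 'cV[R]_n) (T c : R) :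
  0 <= T -> 0 <= c -> driven F u g v ->
  (exists m0, forall m j, (m0 <= m)%N -> j.+1%:R * mesh m <= T ->
     `|z m j - (g (j.+1%:R * mesh m) - g (j%:R * mesh m))| <= c * mesh m ^+ 2) ->
  forall e, 0 < e -> exists m0, exists2 d, 0 < d & forall m x j, (m0 <= m)%N ->
    `|x - u 0| <= d -> j%:R * mesh m <= T ->
    `|euler F (mesh m) (z m) x j - u (j%:R * mesh m)| <= e.
Proof.
move=> T0 c0 [cu cg uvg dv] [m1 hz] e e0.
have [S S0 uS] := continuous_bounded_segment T cu.
have [L L0 FL] := locF (S + 1).
have E0 := expR_gt0 (L * T).
(* Chosen so that the final bound [expR (L * T) * (e1 * (1 + 2 * T))] equals [min e 1]: the 1 keeps
   the scheme in the ball where [L] is valid. *)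
pose e1 := Num.min e 1 / (expR (L * T) * (1 + 2 * T)).
have T1 : 0 < 1 + 2 * T by rewrite ltr_pwDl// mulr_ge0.
have e10 : 0 < e1 by rewrite divr_gt0 ?mulr_gt0// lt_min e0 ltr01.
have cFu : continuous (F \o u) by move=> t; apply: continuous_comp; [exact: cu|exact: cF].
have [d1 d10 Fd] := uniformly_continuous_segment T cFu e10.
have [m2 hm2] : exists m2, forall m, (m2 <= m)%N -> mesh m <= d1 /\ c * mesh m <= e1.
  have h : 0 < Num.min d1 (e1 / (c + 1)).
    by rewrite lt_min d10 divr_gt0// ltr_wpDl.
  have : mesh m @[m --> \oo] --> (0 : R).
    by apply: cvg_expr; rewrite ger0_norm ?invr_ge0// invf_lt1// ltr1n.
  move/cvgrPdist_le => /(_ _ h)[m2 _ hm2]; exists m2 => m /hm2 /=.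
  rewrite sub0r normrN gtr0_norm ?mesh_gt0// le_min => /andP[-> me]; split => //.
  apply: (@le_trans _ _ ((c + 1) * mesh m)).
    by apply: ler_wpM2r; [exact/ltW/mesh_gt0|rewrite lerDl].
  by rewrite mulrC -ler_pdivlMr// ltr_wpDl.
exists (maxn m1 m2), e1 => // m x j; rewrite geq_max => /andP[m1m m2m] xu jT.
have [md mc] := hm2 m m2m; have dm0 := mesh_gt0 m; set d := mesh m in md mc dm0 jT *.
pose er i := `|euler F d (z m) x i - u (i%:R * d)|.
(* [e1] is the initial error, and each step adds [2 * e1 * d]: one half from the modulus of
   continuity of [F \o u], the other from the noise error [c * d ^+ 2 <= e1 * d]. *)
have key i : i%:R * d <= T -> er i <= (1 + L * d) ^+ i * (e1 + i%:R * d * (2 * e1)).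
  have Ld0 : 0 <= L * d by rewrite mulr_ge0// ltW.
  elim: i => [|i IH] iT.
    by rewrite /er /= mul0r expr0 mul1r mul0r addr0.
  have iT' : i%:R * d <= T.
    by apply: le_trans iT; apply: ler_wpM2r; [exact: ltW|rewrite ler_nat].
  have eri := IH iT'.
  have id0 : 0 <= i%:R * d by rewrite mulr_ge0// ltW.
  have pow : (1 + L * d) ^+ i <= expR (L * T).
    apply: (@le_trans _ _ (expR (L * d) ^+ i)).
      by rewrite lerXn2r ?nnegrE ?expR_ge0 ?addr_ge0// expR_ge1Dx.
    by rewrite -expRM_natl ler_expR mulrCA ler_wpM2l.
  have er1 : er i <= 1.
    apply: le_trans eri _.
    apply: (@le_trans _ _ (expR (L * T) * (e1 * (1 + 2 * T)))).
      apply: ler_pM => //; first by rewrite exprn_ge0// addr_ge0.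
        by rewrite addr_ge0 ?(ltW e10)// mulr_ge0// mulr_ge0// ltW.
      by rewrite mulrDr mulr1 lerD2l; have := ler_wpM2r (ltW e10) iT'; lra.
    rewrite /e1; have -> : expR (L * T) * (Num.min e 1 / (expR (L * T) * (1 + 2 * T)) * (1 + 2 * T)) = Num.min e 1.
      by field; rewrite !gt_eqF.
    by rewrite ge_min lexx orbT.
  set s := i%:R * d; set s' := i.+1%:R * d.
  have s'E : s' = s + d by rewrite /s' /s -natr1 mulrDl mul1r.
  have sT : 0 <= s <= T by rewrite id0.
  set y := euler F d (z m) x i.
  have yS : `|y| <= S + 1.
    rewrite -[y](subrK (u s)); apply: le_trans (ler_normD _ _) _; rewrite addrC.
    by apply: lerD; [exact: uS|exact: er1].
  have us1 : `|u s| <= S + 1 by apply: le_trans (uS s sT) _; rewrite lerDl.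
  have hF : `|F y - F (u s)| <= L * er i := FL _ _ yS us1.
  have hz' : `|z m i - (g s' - g s)| <= c * d ^+ 2 by exact: hz.
  have hv : `|v s' - v s - d *: F (u s)| <= e1 * d.
    have ss' : s <= s' by rewrite s'E lerDl ltW.
    apply: norm_le_coord; first by rewrite mulr_ge0// ltW.
    move=> k; rewrite !mxE ler_norml.
    have Fk r : s <= r <= s' -> `|F (u r) k 0 - F (u s) k 0| <= e1.
      move=> /andP[sr rs'].
      have := coord_le_norm (F (u r) - F (u s)) k; rewrite mxE [X in _ + X]mxE => /le_trans; apply.
      apply: Fd => //; rewrite ger0_norm ?subr_ge0// lerBlDl.
      by apply: le_trans rs' _; rewrite s'E lerD2l.
    have h1 : v s' k 0 - v s k 0 <= (F (u s) k 0 + e1) * (s' - s).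
      apply: (@is_derive_growth _ (fun r => v r k 0) (fun r => F (u r) k 0)) => //.
        by move=> r /andP[sr _]; apply: dv; exact: le_trans sr.
      move=> r /andP[sr rs]; have := Fk r; rewrite (ltW sr) (ltW rs) => /(_ isT).
      by rewrite ler_norml; lra.
    have h2 : - v s' k 0 - - v s k 0 <= (- F (u s) k 0 + e1) * (s' - s).
      apply: (@is_derive_growth _ (fun r => - v r k 0) (fun r => - F (u r) k 0)) => //.
        by move=> r /andP[sr _]; apply: is_deriveN; apply: dv; exact: le_trans sr.
      move=> r /andP[sr rs]; have := Fk r; rewrite (ltW sr) (ltW rs) => /(_ isT).
      by rewrite ler_norml; lra.
    have sd : s' - s = d by rewrite s'E addrAC subrr add0r.
    by move: h1 h2; rewrite sd; lra.
  have -> : (1 + L * d) ^+ i.+1 * (e1 + i.+1%:R * d * (2 * e1)) =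
      (1 + L * d) * ((1 + L * d) ^+ i * (e1 + s * (2 * e1))) + (1 + L * d) ^+ i.+1 * (d * (2 * e1)).
    by rewrite exprS -/s' s'E; ring.
  have pow1 : 1 <= (1 + L * d) ^+ i.+1 by rewrite exprn_ege1// lerDl.
  have -> : er i.+1 = `|(y - u s) + d *: (F y - F (u s)) - (v s' - v s - d *: F (u s)) +
                        (z m i - (g s' - g s))|.
    have s'0 : 0 <= s' by rewrite s'E addr_ge0// ltW.
    rewrite /er /= -/y -/s' !uvg//.
    congr `|_|; rewrite scalerBr.
    move: (d *: F y) (d *: F _) (z m i) (v s') (v s) (g s') (g s) => ? ? ? ? ? ? ?.
    by apply/matrixP => a b; rewrite !mxE; ring.
  apply: le_trans (ler_normD _ _) _.
  have h1 := ler_normB ((y - u s) + d *: (F y - F (u s))) (v s' - v s - d *: F (u s)).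
  have h2 := ler_normD (y - u s) (d *: (F y - F (u s))).
  have h3 : `|d *: (F y - F (u s))| <= d * (L * er i).
    by rewrite normrZ gtr0_norm// ler_wpM2l// ltW.
  have h4 : (1 + L * d) * er i <= (1 + L * d) * ((1 + L * d) ^+ i * (e1 + s * (2 * e1))).
    by rewrite ler_wpM2l// addr_ge0.
  have h5 : c * d ^+ 2 <= e1 * d.
    by rewrite expr2 mulrA ler_wpM2r// ltW.
  have h6 : d * (2 * e1) <= (1 + L * d) ^+ i.+1 * (d * (2 * e1)).
    by rewrite ler_peMl// mulr_ge0 ?(ltW dm0)// mulr_ge0// ltW.
  have h7 : `|y - u s| = er i by [].
  by move: h1 h2 h3 h4 h5 h6 hz' hv; rewrite h7; lra.
have jd0 : 0 <= j%:R * d by rewrite mulr_ge0// ltW.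
apply: le_trans (key j jT) _.
have Ld0 : 0 <= L * d by rewrite mulr_ge0// ltW.
apply: (@le_trans _ _ (expR (L * T) * (e1 * (1 + 2 * T)))).
  apply: ler_pM.
  - by rewrite exprn_ge0// addr_ge0.
  - by rewrite addr_ge0 ?(ltW e10)// mulr_ge0// mulr_ge0// ltW.
  - apply: (@le_trans _ _ (expR (L * d) ^+ j)).
      by rewrite lerXn2r ?nnegrE ?expR_ge0 ?addr_ge0// expR_ge1Dx.
    by rewrite -expRM_natl ler_expR mulrCA ler_wpM2l.
  - by rewrite mulrDr mulr1 lerD2l; have := ler_wpM2r (ltW e10) jT; lra.
rewrite /e1; have -> : expR (L * T) * (Num.min e 1 / (expR (L * T) * (1 + 2 * T)) * (1 + 2 * T)) = Num.min e 1.
  by field; rewrite !gt_eqF.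
by rewrite ge_min lexx.
Qed.

End EulerScheme.

(** * Discretised noise as a finite chain *)

Lemma bounded_integrable d (T : measurableType d) (R : realType)
    (P : probability T R) (f : T -> R) (M : R) :
  measurable_fun setT f -> (forall w, `|f w| <= M) -> P.-integrable setT (EFin \o f).
Proof.
move=> mf fM; apply: measurable_bounded_integrable => //.
  by rewrite [ltLHS](probability_setT P) ltry.
exists M; split; first exact: num_real.
by move=> x Mx w _ /=; apply: le_trans (fM w) (ltW Mx).
Qed.

Lemma Rintegral_le_bound d (T : measurableType d) (R : realType)
    (P : probability T R) (f : T -> R) (M : R) :
  measurable_fun setT f -> (forall w, `|f w| <= M) -> `|\int[P]_w f w| <= M.
Proof.
move=> mf fM.
have intf := bounded_integrable P mf fM.
apply: le_trans (le_normr_Rintegral measurableT intf) _.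
apply: (@le_trans _ _ (\int[P]_w M)); last first.
  by rewrite Rintegral_cst// -[leRHS]mulr1 [X in _ * X](congr1 fine (probability_setT P)).
apply: le_Rintegral => //.
- apply: (@bounded_integrable _ _ _ P _ M) => //; first exact: measurableT_comp.
  by move=> w; rewrite normr_id.
- by apply: (@bounded_integrable _ _ _ P _ `|M|) => // w.
Qed.

Lemma bounded_convergence d (T : measurableType d) (R : realType)
    (P : probability T R) (f_ : nat -> T -> R) (f : T -> R) (M : R) :
  (forall k, measurable_fun setT (f_ k)) -> measurable_fun setT f ->
  (forall k w, `|f_ k w| <= M) ->
  {ae P, forall w, f_ ^~ w @ \oo --> f w} ->
  (\int[P]_w f_ k w)%R @[k --> \oo] --> (\int[P]_w f w)%R.
Proof.
move=> mf_ mf fM ae.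
have [] := @dominated_convergence _ _ _ P setT measurableT
  (fun k w => (f_ k w)%:E) (fun w => (f w)%:E) (fun=> M%:E).
- by move=> k; apply/measurable_EFinP.
- exact/measurable_EFinP.
- apply: filterS ae => w cw _; apply: cvg_EFin; [exact: nearW|exact: cw].
- by apply: (@bounded_integrable _ _ _ P _ `|M|) => // w.
- by apply: aeW => w k _; rewrite lee_fin.
move=> intf _ h; rewrite /Rintegral.
apply: fine_cvg; rewrite fineK//; exact: integrable_fin_num.
Qed.

Lemma Rintegral_sum d (T : measurableType d) (R : realType) (P : probability T R)
    (I : Type) (s : seq I) (f : I -> T -> R) :
  (forall i, P.-integrable setT (EFin \o f i)) ->
  \int[P]_w (\sum_(i <- s) f i w) = \sum_(i <- s) \int[P]_w f i w.
Proof.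
move=> intf.
have : P.-integrable setT (EFin \o (fun w => \sum_(i <- s) f i w)) /\
    \int[P]_w (\sum_(i <- s) f i w) = \sum_(i <- s) \int[P]_w f i w.
  elim: s => [|i s [ints IH]].
    split; last first.
      by rewrite big_nil; under eq_Rintegral do rewrite big_nil; rewrite Rintegral_cst// mul0r.
    apply: (@bounded_integrable _ _ _ P _ 0) => [|w]; last by rewrite big_nil normr0.
    by rewrite (_ : (fun w => _) = cst 0); [exact: measurable_cst|apply/funext => w; rewrite big_nil].
  split.
    have -> : EFin \o (fun w => \sum_(j <- i :: s) f j w) =
       (fun w => (EFin \o f i) w + (EFin \o (fun w => (\sum_(j <- s) f j w)%R)) w)%E.
      by apply/funext => w /=; rewrite big_cons.
    exact: integrableD.
  rewrite big_cons -IH -RintegralD//; apply: eq_Rintegral => w _.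
  by rewrite big_cons.
by case.
Qed.

Lemma borel_measurable_continuous (R : realType) (n : nat) (f : 'cV[R]_n -> R) :
  continuous f -> measurable_fun setT (f : borelV R n -> R).
Proof.
move=> cf; apply: (@measurability _ _ _ _ _ _ (@RGenOInfty.G R)).
  exact: RGenOInfty.measurableE.
move=> _ [_ [a ->] <-]; rewrite setTI; apply: sub_sigma_algebra.
by apply: open_comp => [x _|]; [exact: cf|exact: interval_open].
Qed.

Lemma measurable_coord (R : realType) (n : nat) (i : 'I_n) :
  measurable_fun setT (fun x : borelV R n => (x : 'cV[R]_n) i 0).
Proof. by apply: borel_measurable_continuous; exact: coord_continuous. Qed.

Section FiniteChain.
Context d (T : measurableType d) (R : realType) (P : probability T R).
Context (V : Type) (I : finType) (st : V -> I -> V) (xi : nat -> T -> I) (p : I -> R).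
Hypothesis mxi : forall j c, measurable [set w | xi j w = c].
Hypothesis indep : forall k (c : nat -> I),
  P [set w | forall j, (j < k)%N -> xi j w = c j] = (\prod_(j < k) p (c j))%:E.

(** The noise is consumed at the front, from index [j] on, which suits conditioning on the past;
    [chain_runS] gives the recursion at the back, that of [euler]. *)
Fixpoint chain_run (j k : nat) (y : V) (w : T) : V :=
  if k is k'.+1 then chain_run j.+1 k' (st y (xi j w)) w else y.

Definition chain_op (f : V -> R) (y : V) : R := \sum_c p c * f (st y c).

Lemma chain_runS j k y w : chain_run j k.+1 y w = st (chain_run j k y w) (xi (j + k) w).
Proof.
elim: k j y => [|k IH] j y; first by rewrite /= addn0.
have -> : chain_run j k.+2 y w = chain_run j.+1 k.+1 (st y (xi j w)) w by [].
by rewrite IH addSnnS.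
Qed.

Let pre k (c : nat -> I) := [set w | forall j, (j < k)%N -> xi j w = c j].

Let mpre k c : measurable (pre k c).
Proof.
have -> : pre k c = \bigcap_(j in [set j | (j < k)%N]) [set w | xi j w = c j].
  by apply/seteqP; split => w h j; exact: h.
by apply: bigcap_measurableType => j _; exact: mxi.
Qed.

Let run_split (f : V -> R) k j y w :
  f (chain_run j k.+1 y w) = \sum_c \1_[set w | xi j w = c] w * f (chain_run j.+1 k (st y c) w).
Proof.
rewrite (bigD1 (xi j w))//= indicE mem_set//= mul1r big1 ?addr0// => c cx.
rewrite indicE memNset ?mul0r//= => /esym/eqP; exact/negP.
Qed.

Lemma measurable_chain_run (f : V -> R) j k y :
  measurable_fun setT (fun w => f (chain_run j k y w)).
Proof.
elim: k j y => [|k IH] j y; first by rewrite /=; exact: measurable_cst.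
rewrite (_ : (fun w => _) = (fun w => \sum_c \1_[set w | xi j w = c] w *
    f (chain_run j.+1 k (st y c) w))); last by apply/funext => w; exact: run_split.
apply: measurable_sum => c; apply: measurable_funM; last exact: IH.
exact: measurable_indic.
Qed.

Lemma integral_chain_run (f : V -> R) (M : R) k y : (forall x, `|f x| <= M) ->
  \int[P]_w f (chain_run 0 k y w) = iter k chain_op f y.
Proof.
move=> fM.
(* The indicator of a prescribed past of length [l] is carried along, so that summing over the next
   noise value only lengthens the past and [indep] is applied once, at the end. *)
suff h l c : \int[P]_w (\1_(pre l c) w * f (chain_run l k y w)) =
    (\prod_(j < l) p (c j)) * iter k chain_op f y.
  have := h 0%N (fun=> xi 0%N point); rewrite big_ord0 mul1r => <-.
  by apply: eq_Rintegral => w _; rewrite indicE mem_set ?mul1r.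
elim: k l c y => [|k IH] l c y /=.
  rewrite RintegralZr//; last first.
    apply: (@bounded_integrable _ _ _ P _ 1); first exact: measurable_indic.
    by move=> w; rewrite indicE; case: (_ \in _); rewrite ?normr1 ?normr0.
  congr (_ * _); rewrite /Rintegral integral_indic// setIT.
  exact: (congr1 fine (indep l c)).
pose c' a j := if (j < l)%N then c j else a.
have E w : \1_(pre l c) w * f (chain_run l k.+1 y w) =
    \sum_a \1_(pre l.+1 (c' a)) w * f (chain_run l.+1 k (st y a) w).
  rewrite run_split mulr_sumr; apply: eq_bigr => a _; rewrite mulrA; congr (_ * _).
  rewrite -[RHS]/(\1_(pre l.+1 (c' a)) w).
  have -> : pre l.+1 (c' a) = pre l c `&` [set w | xi l w = a].
    apply/seteqP; split => v /=.
      move=> h; split; last by have := h l (leqnn _); rewrite /c' ltnn.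
      by move=> j jl; have := h j (ltnW jl); rewrite /c' jl.
    move=> [h1 h2] j; rewrite ltnS leq_eqVlt /c' => /predU1P[->|jl].
      by rewrite ltnn.
    by rewrite jl; exact: h1.
  by rewrite indicI.
transitivity (\int[P]_w (\sum_a \1_(pre l.+1 (c' a)) w * f (chain_run l.+1 k (st y a) w))).
  by apply: eq_Rintegral => w _; exact: E.
rewrite Rintegral_sum; last first.
  move=> a; apply: (@bounded_integrable _ _ _ P _ M).
    apply: measurable_funM; [exact: measurable_indic|exact: measurable_chain_run].
  move=> w; rewrite normrM indicE; case: (_ \in _); rewrite ?normr1 ?normr0 ?mul1r// mul0r.
  exact: le_trans (normr_ge0 _) (fM y).
rewrite /chain_op mulr_sumr; apply: eq_bigr => a _; rewrite IH mulrA; congr (_ * _).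
rewrite big_ord_recr /= /c' ltnn; congr (_ * _).
by apply: eq_bigr => j _; rewrite ltn_ord.
Qed.

End FiniteChain.

Section Discretization.
Context {R : realType} {n : nat}.
Variable m : nat.

(** The cells have width [1 / 4 ^ m], the square of the time step: with [2 ^ m] steps per unit of
    time the accumulated rounding error still tends to 0. Only [[-1, 1]] is resolved, and values
    outside fall into some cell; over short steps a continuous path has no such increments. *)
Definition grid_index := {ffun 'I_n -> 'I_(2 * 4 ^ m).+1}.

Definition grid_cell (k : 'I_(2 * 4 ^ m).+1) : set R :=
  [set a | inord (Num.truncn ((a + 1) * (4 ^ m)%:R)) = k].

Definition grid_code (y : 'cV[R]_n) : grid_index :=
  [ffun i => inord (Num.truncn ((y i 0 + 1) * (4 ^ m)%:R))].

Definition grid_value (c : grid_index) : 'cV[R]_n :=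
  \col_i ((c i : nat)%:R / (4 ^ m)%:R - 1).

Lemma grid_codeP (y : 'cV[R]_n) c : grid_code y = c <-> forall i, grid_cell (c i) (y i 0).
Proof.
split=> [<- i|h]; first by rewrite /grid_cell /= ffunE.
by apply/ffunP => i; rewrite ffunE; exact: h.
Qed.

Lemma measurable_truncn_eq r : measurable [set a : R | Num.truncn ((a + 1) * (4 ^ m)%:R) = r].
Proof.
have mf : measurable_fun setT (fun a : R => (a + 1) * (4 ^ m)%:R).
  by apply: measurable_funM => //; apply: measurable_funD.
have lt k : measurable [set a : R | (a + 1) * (4 ^ m)%:R < k%:R].
  rewrite -[X in measurable X]setTI.
  have -> : [set a : R | (a + 1) * (4 ^ m)%:R < k%:R] =
      (fun a : R => (a + 1) * (4 ^ m)%:R) @^-1` `]-oo, k%:R[%classic.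
    by apply/seteqP; split => a /=; rewrite in_itv.
  exact: mf.
(* For [r = 0] nothing is removed: negative arguments have [truncn] equal to 0. *)
have -> : [set a : R | Num.truncn ((a + 1) * (4 ^ m)%:R) = r] =
   [set a : R | (a + 1) * (4 ^ m)%:R < r.+1%:R] `\`
   (if r is r'.+1 then [set a : R | (a + 1) * (4 ^ m)%:R < r%:R] else set0).
  apply/seteqP; split => a /=.
    move=> h; split; first by rewrite -truncn_le_nat h.
    by case: r h => [|r] h //=; rewrite -truncn_le_nat h ltnn.
  move=> []; rewrite -truncn_le_nat => h1 h2; apply/eqP; rewrite eqn_leq h1 /=.
  by case: r h1 h2 => [|r] _ //=; rewrite -truncn_le_nat => /negP; rewrite -ltnNge.
apply: measurableD; first exact: lt.
by case: r.
Qed.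

Lemma measurable_grid_cell k : measurable (grid_cell k).
Proof.
have -> : grid_cell k = \bigcup_(r in [set r : nat | inord r = k])
    [set a : R | Num.truncn ((a + 1) * (4 ^ m)%:R) = r].
  apply/seteqP; split => a /=.
    by move=> h; exists (Num.truncn ((a + 1) * (4 ^ m)%:R)).
  by move=> [r /= rk h]; rewrite /grid_cell /= h.
apply: bigcup_measurable => r _; exact: measurable_truncn_eq.
Qed.

Lemma grid_value_close (y : 'cV[R]_n) : `|y| <= 1 ->
  `|grid_value (grid_code y) - y| <= (mesh m) ^+ 2.
Proof.
move=> y1; have N0 : 0 < (4 ^ m)%:R :> R by rewrite ltr0n expn_gt0.
have meshE : mesh m ^+ 2 = (4 ^ m)%:R^-1 :> R.
  by rewrite /mesh !exprVn -exprM mulnC exprM natrX; congr (_ ^+ _)^-1; ring.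
apply: norm_le_coord; first by rewrite sqr_ge0.
move=> i; rewrite !mxE ffunE meshE.
set x := (y i 0 + 1) * (4 ^ m)%:R.
have := le_trans (coord_le_norm y i) y1; rewrite ler_norml => /andP[yl yu].
have x0 : 0 <= x by rewrite mulr_ge0 ?(ltW N0)//; lra.
have xN : x < (2 * 4 ^ m).+1%:R.
  rewrite -natr1 natrM ltr_pwDr// ler_wpM2r ?(ltW N0)//; lra.
rewrite inordK; last by rewrite ltnS truncn_le_nat.
have /andP[t1 t2] := truncn_itv x0.
have yE : y i 0 = x / (4 ^ m)%:R - 1 by rewrite /x; field; rewrite gt_eqF.
have -> : (Num.truncn x)%:R / (4 ^ m)%:R - 1 - y i 0 = ((Num.truncn x)%:R - x) / (4 ^ m)%:R.
  by rewrite yE; field; rewrite gt_eqF.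
rewrite normrM [X in _ * X]gtr0_norm ?invr_gt0// ler_piMl ?invr_ge0 ?(ltW N0)//.
by move: t2; rewrite -natr1 ler_norml; lra.
Qed.

End Discretization.

Section BrownianGrid.
Context {R : realType} {n : nat} {d : measure_display} {Omega : measurableType d}.
Variables (P : probability Omega R) (W : R -> Omega -> borelV R n).
Hypothesis BM : standard_brownian_motion P W.

Definition grid_noise m j w : grid_index (n := n) m :=
  grid_code m ((W (j.+1%:R * mesh m) w : 'cV[R]_n) - W (j%:R * mesh m) w).

Definition grid_prob m (c : grid_index (n := n) m) : R :=
  \prod_i fine (normal_prob 0 (Num.sqrt (mesh m)) (grid_cell (c i))).

Let time_ge0 m j : 0 <= j%:R * mesh m :> R.
Proof. by rewrite mulr_ge0// ltW// mesh_gt0. Qed.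

Lemma measurable_brownian_coord t i : 0 <= t ->
  measurable_fun setT (fun w => (W t w : 'cV[R]_n) i 0).
Proof.
move=> t0; have [mW _ _ _ _] := BM.
exact: (measurableT_comp (measurable_coord i) (mW t t0)).
Qed.

Lemma measurable_grid_noise m j c : measurable [set w | grid_noise m j w = c].
Proof.
have -> : [set w | grid_noise m j w = c] = \bigcap_(i in [set: 'I_n])
  [set w | grid_cell (c i) ((W (j.+1%:R * mesh m) w : 'cV[R]_n) i 0 - (W (j%:R * mesh m) w : 'cV[R]_n) i 0)].
  apply/seteqP; split => w /=.
    by move/grid_codeP => h i _; have := h i; rewrite !mxE.
  by move=> h; apply/grid_codeP => i; have := h i I; rewrite !mxE.
apply: fin_bigcap_measurable => // i _.
rewrite -[X in measurable X]setTI.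
apply: (measurable_funB (measurable_brownian_coord i (time_ge0 m j.+1))
  (measurable_brownian_coord i (time_ge0 m j))) => //.
exact: measurable_grid_cell.
Qed.

Lemma grid_noise_law m j c : P [set w | grid_noise m j w = c] = (grid_prob c)%:E.
Proof.
have [_ _ _ _ law] := BM.
have lt : j%:R * mesh m < j.+1%:R * mesh m :> R.
  by rewrite ltr_pM2r ?mesh_gt0// ltr_nat.
have := law _ _ (time_ge0 m j) lt (fun i => grid_cell (c i)) (fun i => measurable_grid_cell (c i)).
have -> : j.+1%:R * mesh m - j%:R * mesh m = mesh m :> R.
  by rewrite -natr1; ring.
have -> : [set w | forall i, grid_cell (c i)
    (((W (j.+1%:R * mesh m) w : 'cV[R]_n) - W (j%:R * mesh m) w) i 0)] =
    [set w | grid_noise m j w = c].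
  by apply/seteqP; split => w /grid_codeP.
move=> ->; rewrite /grid_prob -prodEFin; apply: eq_bigr => i _.
rewrite fineK// fin_num_measure//; exact: measurable_grid_cell.
Qed.

Lemma grid_noise_indep m k (c : nat -> grid_index m) :
  P [set w | forall j, (j < k)%N -> grid_noise m j w = c j] =
  (\prod_(j < k) grid_prob (c j))%:E.
Proof.
have [_ _ _ ind _] := BM.
have mono j : j%:R * mesh m <= j.+1%:R * mesh m :> R.
  by rewrite ler_wpM2r ?(ltW (mesh_gt0 _))// ler_nat.
have mE (j : 'I_k) : measurable ([set z : borelV R n | grid_code m z = c j]).
  have -> : [set z : borelV R n | grid_code m z = c j] = \bigcap_(i in [set: 'I_n])
    [set z : borelV R n | grid_cell (c j i) ((z : 'cV[R]_n) i 0)].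
    apply/seteqP; split => z /=; first by move/grid_codeP => h i _; exact: h.
    by move=> h; apply/grid_codeP => i; exact: h.
  apply: fin_bigcap_measurable => // i _.
  rewrite -[X in measurable X]setTI.
  by apply: (measurable_coord i) => //; exact: measurable_grid_cell.
have := ind k (fun j => j%:R * mesh m) (time_ge0 m 0) mono _ mE.
have -> : [set w | forall j : 'I_k, [set z : borelV R n | grid_code m z = c j]
    ((W (j.+1%:R * mesh m) w : 'cV[R]_n) - W (j%:R * mesh m) w)] =
    [set w | forall j, (j < k)%N -> grid_noise m j w = c j].
  apply/seteqP; split => w /=; first by move=> h j jk; exact: (h (Ordinal jk)).
  by move=> h j; exact: h.
by move=> ->; rewrite -prodEFin; apply: eq_bigr => j _; rewrite -(grid_noise_law j (c j)).
Qed.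

End BrownianGrid.

(** * The Markov semigroup on bounded continuous functions *)

Definition Cb (R : realType) (n : nat) (f : 'cV[R]_n -> R) : Prop :=
  continuous f /\ exists M, forall x, `|f x| <= M.

(* The [h_ m] need not be continuous, which allows for the operators of the Euler
   scheme with discretised noise. *)
Lemma sequential_continuity_of_limit (R : realType) (V : normedModType R)
    (h_ : nat -> V -> R) (h : V -> R) :
  (forall x (x_ : nat -> V), x_ @ \oo --> x -> h_ m (x_ m) @[m --> \oo] --> h x) ->
  continuous h.
Proof.
move=> hc y; apply/cvgrPdist_le => e e0; apply: contrapT => nc.
have bad k : exists x, `|y - x| <= k.+1%:R^-1 /\ e < `|h y - h x|.
  apply: contrapT => nb; apply: nc.
  have k0 : 0 < k.+1%:R^-1 :> R by rewrite invr_gt0.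
  apply: filterS (nbhsx_ballx y _ k0) => x; rewrite -ball_normE /= => yx.
  by rewrite leNgt; apply/negP => lt; apply: nb; exists x; rewrite ltW.
have /(_ _)/cid {}bad k := bad k.
pose z k := projT1 (bad k).
have zP k : `|y - z k| <= k.+1%:R^-1 /\ e < `|h y - h (z k)| := projT2 (bad k).
have e2 : 0 < e / 2 by rewrite divr_gt0.
have cst k : exists M, forall m, (M <= m)%N -> `|h (z k) - h_ m (z k)| <= e / 2.
  have ck : (fun _ : nat => z k) @ \oo --> z k by exact: cvg_cst.
  have /cvgrPdist_le/(_ _ e2)[M _ hM] := hc (z k) _ ck.
  by exists M => m Mm; exact: hM.
have /(_ _)/cid {}cst k := cst k.
pose M k := projT1 (cst k).
have MP k m : (M k <= m)%N -> `|h (z k) - h_ m (z k)| <= e / 2 := projT2 (cst k) m.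
(* The largest index [k <= m] at which [h_ m] is already accurate at [z k]. It tends to infinity, so
   [z (kk m)] tends to [y] while [h_ m] stays close to [h] along it. *)
pose kk m := \max_(k in [pred k : 'I_m.+1 | (M k <= m)%N]) (k : nat).
have kkM m : (M 0%N <= m)%N -> (M (kk m) <= m)%N.
  move=> M0m.
  rewrite /kk; have [|k Mk ->] := @eq_bigmax_cond _ [pred k : 'I_m.+1 | (M k <= m)%N] (fun k => k : nat).
    by apply/card_gt0P; exists ord0.
  exact: Mk.
have kkge K m : (K <= m)%N -> (M K <= m)%N -> (K <= kk m)%N.
  move=> Km MKm; have Km1 : (K < m.+1)%N by [].
  exact: (@leq_bigmax_cond _ [pred k : 'I_m.+1 | (M k <= m)%N] (fun k => k : nat) (Ordinal Km1)).
have cx : (fun m => z (kk m)) @ \oo --> y.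
  apply/cvgrPdist_le => r r0.
  pose K := Num.truncn r^-1.
  exists (maxn K (M K)) => // m /=; rewrite geq_max => /andP[Km MKm].
  apply: le_trans (zP _).1 _.
  rewrite invf_ple ?posrE//; apply: (@le_trans _ _ K.+1%:R).
    by rewrite ltW// truncnS_gt.
  by rewrite ler_nat ltnS kkge.
have /cvgrPdist_lt/(_ _ e2)[N _ hN] := hc y _ cx.
pose m := maxn N (M 0%N).
have h1 := hN m (leq_maxl _ _).
have h2 := MP (kk m) m (kkM _ (leq_maxr _ _)).
have := (zP (kk m)).2; rewrite ltNge => /negP; apply.
have -> : h y - h (z (kk m)) = (h y - h_ m (z (kk m))) - (h (z (kk m)) - h_ m (z (kk m))) by ring.
apply: le_trans (ler_normB _ _) _; move: h1 => /=; lra.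
Qed.

Section Semigroup.
Context {R : realType} {n : nat}.
Variables (F : 'cV[R]_n -> 'cV[R]_n) (sigma : 'M[R]_n).
Hypothesis cF : continuous F.
Hypothesis locF : forall m, exists2 L, 0 <= L & forall x y : 'cV[R]_n,
  `|x| <= m -> `|y| <= m -> `|F x - F y| <= L * `|x - y|.
Context {d : measure_display} {Omega : measurableType d}.
Variables (P : probability Omega R) (W : R -> Omega -> borelV R n).
Hypothesis BM : standard_brownian_motion P W.
Variable (X : 'cV[R]_n -> R -> Omega -> borelV R n).
Hypothesis sol : forall x : 'cV[R]_n, sde_solution P F sigma W x (X x).

Let u x w : R -> 'cV[R]_n := fun t => X x (pos_time t) w.
Let g w : R -> 'cV[R]_n := fun t => sigma *m (W (pos_time t) w : 'cV[R]_n).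

Lemma solution_driven x : {ae P, forall w, exists v,
  [/\ driven F (u x w) (g w) v, v 0 = x, continuous (fun t => W (pos_time t) w : 'cV[R]_n) & u x w 0 = x]}.
Proof.
have [_ W0 cW _ _] := BM.
have [_ ae] := sol x.
apply: filterS3 ae W0 cW => w [cX eX] w0 cw.
have [v [dv v0]] := integral_equation_driven cF cX cw eX.
exists v; split; [exact: dv|exact: v0|exact: continuous_pos_time cw|].
have [_ _ uE _] := dv; have := uE 0 (lexx _).
by rewrite /u /= => ->; rewrite v0 pos_timeE// w0 mulmx0 addr0.
Qed.

Lemma measurable_solution (f : 'cV[R]_n -> R) x t : 0 <= t -> continuous f ->
  measurable_fun setT (fun w => f (X x t w)).
Proof.
move=> t0 cf; have [mX _] := sol x.
exact: (measurableT_comp (borel_measurable_continuous cf) (mX t t0)).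
Qed.

Definition semi (t : R) (f : 'cV[R]_n -> R) (x : 'cV[R]_n) : R :=
  \int[P]_w f (X x t w).

Definition grid_step m (y : 'cV[R]_n) (c : grid_index (n := n) m) : 'cV[R]_n :=
  y + mesh m *: F y + sigma *m (grid_value c : 'cV[R]_n).

Definition grid_run m := chain_run (grid_step (m := m)) (grid_noise W m).

Definition grid_op m := chain_op (grid_step (m := m)) (@grid_prob R n m).

Lemma grid_run_euler m k x w : grid_run m 0 k x w =
  euler F (mesh m) (fun j => sigma *m grid_value (grid_noise W m j w)) x k.
Proof.
elim: k => [//|k IH].
by rewrite /grid_run chain_runS -/(grid_run m) IH add0n.
Qed.

(** The number of steps of length [mesh m] in the time [i%:R * mesh b], for [b <= m]: every finer
    scheme hits a dyadic time exactly. *)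
Definition refine b m i : nat := (i * 2 ^ (m - b))%N.

Lemma refine_time b m i : (b <= m)%N -> (refine b m i)%:R * mesh m = i%:R * mesh b :> R.
Proof.
move=> bm; rewrite /refine natrM natrX -mulrA; congr (_ * _).
rewrite /mesh -{2}(subnK bm) exprD mulrA -exprMn divff ?pnatr_eq0// expr1n mul1r//.
Qed.

(** On a continuous noise path the increments eventually lie in [[-1, 1]], where rounding costs
    [mesh m ^+ 2], and [euler_converges] applies. The null set depends on [x] but not on the
    approximating sequence [x_]. *)
Lemma grid_run_cvg x b i : {ae P, forall w, forall x_ : nat -> 'cV[R]_n, x_ @ \oo --> x ->
  (fun m => grid_run m 0 (refine b m i) (x_ m) w) @ \oo --> (X x (i%:R * mesh b) w : 'cV[R]_n)}.
Proof.
apply: filterS (solution_driven x) => w [v [dv v0 cw u0]] x_ cx.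
have [K K0 sK] := mulmx_bounded sigma.
pose T : R := i%:R * mesh b.
have T0 : 0 <= T by rewrite mulr_ge0// ltW// mesh_gt0.
pose z m j := sigma *m grid_value (grid_noise W m j w).
have hz : exists m0, forall m j, (m0 <= m)%N -> j.+1%:R * mesh m <= T ->
     `|z m j - (g w (j.+1%:R * mesh m) - g w (j%:R * mesh m))| <= K * mesh m ^+ 2.
  have [d0 d00 Wd] := uniformly_continuous_segment T cw ltr01.
  have : mesh m @[m --> \oo] --> (0 : R).
    by apply: cvg_expr; rewrite ger0_norm ?invr_ge0// invf_lt1// ltr1n.
  move/cvgrPdist_le => /(_ _ d00)[m0 _ hm0]; exists m0 => m j /hm0 /=.
  rewrite sub0r normrN gtr0_norm ?mesh_gt0// => md jT.
  rewrite /z /g -!mulmxBr; apply: le_trans (sK _) _; apply: ler_wpM2l => //.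
  have jm k : 0 <= k%:R * mesh m :> R by rewrite mulr_ge0// ltW// mesh_gt0.
  rewrite !pos_timeE//; apply: grid_value_close.
  have jj : j%:R * mesh m <= j.+1%:R * mesh m :> R.
    by rewrite ler_wpM2r ?(ltW (mesh_gt0 _))// ler_nat.
  have := Wd (j.+1%:R * mesh m) (j%:R * mesh m).
  rewrite /= !pos_timeE//; apply; first by rewrite jm (le_trans jj).
  by rewrite -mulrBl -natrB// subSnn mul1r gtr0_norm ?mesh_gt0.
have ec := euler_converges cF locF T0 K0 dv hz.
apply/cvgrPdist_le => e e0.
have [m0 [d0 d00 hm0]] := ec e e0.
have /cvgrPdist_le/(_ _ d00)[m1 _ hm1] := cx.
exists (maxn (maxn m0 m1) b) => // m /=; rewrite !geq_max => /andP[/andP[m0m m1m] bm].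
rewrite grid_run_euler.
have := hm0 m (x_ m) (refine b m i) m0m; rewrite (refine_time i bm) -/T => /(_ _ (lexx _)).
have uT : u x w T = X x T w by rewrite /u pos_timeE.
by rewrite uT u0 => h; rewrite distrC; apply: h; rewrite distrC; exact: hm1.
Qed.

Lemma measurable_grid_run m (f : 'cV[R]_n -> R) j k x :
  measurable_fun setT (fun w => f (grid_run m j k x w)).
Proof. by apply: measurable_chain_run => *; exact: (measurable_grid_noise BM). Qed.

Lemma grid_op_integral m (f : 'cV[R]_n -> R) (M : R) k x : (forall x, `|f x| <= M) ->
  iter k (grid_op m) f x = \int[P]_w f (grid_run m 0 k x w).
Proof.
move=> fM; symmetry; apply: (@integral_chain_run _ _ R P _ _ (grid_step (m := m))
  (grid_noise W m) (@grid_prob R n m) _ _ f M k x fM).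
- by move=> *; exact: (measurable_grid_noise BM).
- by move=> *; exact: grid_noise_indep.
Qed.

Lemma grid_op_bound m (f : 'cV[R]_n -> R) (M : R) k x : (forall x, `|f x| <= M) ->
  `|iter k (grid_op m) f x| <= M.
Proof.
move=> fM; rewrite (grid_op_integral _ _ _ fM); apply: Rintegral_le_bound => //.
exact: measurable_grid_run.
Qed.

Lemma semi_bound t f M x : 0 <= t -> continuous f -> (forall x, `|f x| <= M) ->
  `|semi t f x| <= M.
Proof.
move=> t0 cf fM; apply: Rintegral_le_bound => //; exact: measurable_solution.
Qed.

(** Convergence along moving starting points is what yields both the continuity of the limit and the
    passage to the limit in a composition of two operators. *)
Lemma grid_op_cvg b i f x (x_ : nat -> 'cV[R]_n) : Cb f -> x_ @ \oo --> x ->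
  iter (refine b m i) (grid_op m) f (x_ m) @[m --> \oo] --> semi (i%:R * mesh b) f x.
Proof.
move=> [cf [M fM]] cx.
under eq_fun do rewrite (grid_op_integral _ _ _ fM).
have t0 : 0 <= i%:R * mesh b :> R by rewrite mulr_ge0// ltW// mesh_gt0.
apply: (@bounded_convergence _ _ _ _ _ _ M) => //.
- by move=> m; exact: measurable_grid_run.
- exact: measurable_solution.
apply: filterS (grid_run_cvg x b i) => w /(_ _ cx) h.
exact: (cvg_comp _ _ h (cf _)).
Qed.

Lemma semi_continuous b i f : Cb f -> continuous (semi (i%:R * mesh b) f).
Proof.
move=> bf.
apply: (@sequential_continuity_of_limit R 'cV[R]_n (fun m => iter (refine b m i) (grid_op m) f)).
by move=> x x_; exact: grid_op_cvg.
Qed.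

Lemma semi_Cb b i f : Cb f -> Cb (semi (i%:R * mesh b) f).
Proof.
move=> bf; split; first exact: semi_continuous.
have [cf [M fM]] := bf; exists M => x; apply: semi_bound => //.
by rewrite mulr_ge0// ltW// mesh_gt0.
Qed.

(** The iterates of [grid_op] compose exactly. In the limit the inner operator is evaluated along
    Euler runs that converge to [X x t w], which [grid_op_cvg] allows for each fixed [w]. *)
Lemma semi_markov b i j f x : Cb f ->
  semi ((i + j)%:R * mesh b) f x = semi (i%:R * mesh b) (semi (j%:R * mesh b) f) x.
Proof.
move=> bf; have [cf [M fM]] := bf.
have cx : (fun _ : nat => x) @ \oo --> x by exact: cvg_cst.
have h1 := @grid_op_cvg b (i + j) f x _ bf cx.
apply: (@cvg_unique _ (@Rhausdorff R) _ _ _ _ h1).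
have iM m k y : `|iter k (grid_op m) f y| <= M by exact: grid_op_bound.
have -> : (fun m => iter (refine b m (i + j)) (grid_op m) f x) =
    (fun m => \int[P]_w (iter (refine b m j) (grid_op m) f) (grid_run m 0 (refine b m i) x w)).
  apply/funext => m; rewrite -(grid_op_integral _ _ _ (iM m _)) -iterD.
  by rewrite /refine -mulnDl.
have t0 k : 0 <= k%:R * mesh b :> R by rewrite mulr_ge0// ltW// mesh_gt0.
apply: (@bounded_convergence _ _ _ _ _ _ M) => //.
- by move=> m; exact: measurable_grid_run.
- by apply: measurable_solution => //; exact: semi_continuous.
apply: filterS (grid_run_cvg x b i) => w /(_ _ cx) h.
exact: grid_op_cvg.
Qed.

Lemma semi_time_cvg f x (t : R) (t_ : nat -> R) : Cb f -> 0 <= t -> (forall k, 0 <= t_ k) ->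
  t_ @ \oo --> t -> semi (t_ k) f x @[k --> \oo] --> semi t f x.
Proof.
move=> [cf [M fM]] t0 tk0 ct; apply: (@bounded_convergence _ _ _ _ _ _ M) => //.
- by move=> k; exact: measurable_solution.
- exact: measurable_solution.
apply: filterS (solution_driven x) => w [v [[cu _ _ _] _ _ _]].
have -> : (fun k => f (X x (t_ k) w)) = (fun k => f (u x w (t_ k))).
  by apply/funext => k; rewrite /u pos_timeE.
have -> : f (X x t w) = f (u x w t) by rewrite /u pos_timeE.
have h : (fun k => u x w (t_ k)) @ \oo --> u x w t by exact: (cvg_comp _ _ ct (cu t)).
exact: (cvg_comp _ _ h (cf _)).
Qed.

End Semigroup.

(** * Riesz representation of tight functionals *)

Section CbTheory.
Context {R : realType} {n : nat}.
Implicit Types f g : 'cV[R]_n -> R.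

Lemma Cb_cst (c : R) : Cb (fun _ : 'cV[R]_n => c).
Proof. by split; [exact: cst_continuous|exists `|c|]. Qed.

Lemma Cb_add f g : Cb f -> Cb g -> Cb (fun x => f x + g x).
Proof.
move=> [cf [M fM]] [cg [N gN]]; split.
  by move=> x; apply: continuousD; [exact: cf|exact: cg].
by exists (M + N) => x; apply: le_trans (ler_normD _ _) _; apply: lerD.
Qed.

Lemma Cb_mul f g : Cb f -> Cb g -> Cb (fun x => f x * g x).
Proof.
move=> [cf [M fM]] [cg [N gN]]; split.
  by move=> x; apply: continuousM; [exact: cf|exact: cg].
by exists (M * N) => x; rewrite normrM ler_pM.
Qed.

Lemma Cb_scale (a : R) f : Cb f -> Cb (fun x => a * f x).
Proof. exact: (Cb_mul (Cb_cst a)). Qed.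

Lemma Cb_sub f g : Cb f -> Cb g -> Cb (fun x => f x - g x).
Proof.
move=> bf bg; have -> : (fun x => f x - g x) = (fun x => f x + (-1) * g x).
  by apply/funext => x; rewrite mulN1r.
by apply: Cb_add => //; exact: Cb_scale.
Qed.

Lemma Cb_sum (I : Type) (s : seq I) (h : I -> 'cV[R]_n -> R) :
  (forall i, Cb (h i)) -> Cb (fun x => \sum_(i <- s) h i x).
Proof.
move=> bh; elim: s => [|i s IH].
  by rewrite (_ : (fun x => _) = fun=> 0); [exact: Cb_cst|apply/funext => x; rewrite big_nil].
rewrite (_ : (fun x => _) = fun x => h i x + \sum_(j <- s) h j x).
  exact: Cb_add.
by apply/funext => x; rewrite big_cons.
Qed.

Definition clamp (y : R) : R := Num.min 1 (Num.max 0 y).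

Lemma clamp_ge0 y : 0 <= clamp y.
Proof. by rewrite /clamp le_min ler01 le_max lexx. Qed.

Lemma clamp_le1 y : clamp y <= 1.
Proof. by rewrite /clamp ge_min lexx. Qed.

Lemma clamp_eq0 y : y <= 0 -> clamp y = 0.
Proof. by move=> y0; rewrite /clamp max_l// min_r. Qed.

Lemma clamp_eq1 y : 1 <= y -> clamp y = 1.
Proof. by move=> y1; rewrite /clamp max_r ?min_l// (le_trans _ y1). Qed.

Lemma clamp_cases (y : R) :
  [\/ y <= 0 /\ clamp y = 0, 0 <= y <= 1 /\ clamp y = y | 1 <= y /\ clamp y = 1].
Proof.
have [y0|/ltW y0] := lerP y 0; first by constructor 1; rewrite clamp_eq0.
have [y1|/ltW y1] := lerP y 1; last by constructor 3; rewrite clamp_eq1.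
by constructor 2; split; [apply/andP|rewrite /clamp max_r// min_r].
Qed.

Lemma clamp_mono y z : y <= z -> clamp y <= clamp z.
Proof.
by case: (clamp_cases y) => -[hy ->]; case: (clamp_cases z) => -[hz ->]; lra.
Qed.

Lemma clamp_lipschitz y z : `|clamp y - clamp z| <= `|y - z|.
Proof.
rewrite ler_norml lerNl opprB.
have h1 := ler_norm (y - z); have h2 := ler_norm (z - y); rewrite distrC in h2.
by apply/andP; split; move: h1 h2; move: `|_| => r;
  case: (clamp_cases y) => -[hy ->]; case: (clamp_cases z) => -[hz ->]; lra.
Qed.

Lemma Cb_clamp f : continuous f -> Cb (fun x => clamp (f x)).
Proof.
move=> cf; split.
  move=> x; apply: (continuous_comp (f := f) (g := clamp)); first exact: cf.
  by apply: (@locally_lipschitz_continuous _ R R) => y; exists 1 => z _; rewrite mul1r clamp_lipschitz.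
by exists 1 => x; rewrite ger0_norm ?clamp_le1// clamp_ge0.
Qed.

(** Layer-cake decomposition with continuous layers: the [j]-th one is the part of [y] between [j]
    and [j + 1]. *)
Lemma sum_clamp (y : R) N : 0 <= y -> \sum_(j < N) clamp (y - j%:R) = Num.min y N%:R.
Proof.
move=> y0; elim: N => [|N IH]; first by rewrite big_ord0 min_r.
rewrite big_ord_recr /= IH -natr1; move: (N%:R : R) => i.
case: (clamp_cases (y - i)) => -[hy ->].
- by rewrite !min_l ?addr0; lra.
- by rewrite min_r ?min_l; lra.
- by rewrite !min_r; lra.
Qed.

(** The distance to the complement of [U], capped at 1 so that the infimum makes sense when the
    complement is empty. *)
Let gap (U : set 'cV[R]_n) (x : 'cV[R]_n) : R :=
  inf [set r : R | r = 1 \/ exists2 y : 'cV[R]_n, ~ U y & r = `|x - y|].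

Let gap_has_inf (U : set 'cV[R]_n) (x : 'cV[R]_n) :
  has_inf [set r : R | r = 1 \/ exists2 y : 'cV[R]_n, ~ U y & r = `|x - y|].
Proof.
split; first by exists 1; left.
by exists 0 => r /= [->//|[y _ ->]].
Qed.

Let gap_le U x x' : gap U x <= gap U x' + `|x - x'|.
Proof.
rewrite -lerBlDr; apply: lb_le_inf; first by exists 1; left.
move=> r [->|[y Uy ->]]; rewrite lerBlDr.
  by apply: le_trans (ge_inf (gap_has_inf U x).2 _) _; [left; reflexivity|rewrite lerDl].
apply: le_trans (ge_inf (gap_has_inf U x).2 _) _; first by right; exists y.
have -> : x - y = (x - x') + (x' - y) by rewrite addrA subrK.
by rewrite [leRHS]addrC ler_normD.
Qed.

Let gap_continuous U : continuous (gap U).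
Proof.
apply: (@locally_lipschitz_continuous _ 'cV[R]_n R) => x; exists 1 => y _; rewrite mul1r ler_norml.
have := gap_le U x y; have := gap_le U y x; rewrite (distrC y); lra.
Qed.

Lemma open_indicator_approx (U : set 'cV[R]_n) : open U ->
  exists phi : nat -> 'cV[R]_n -> R,
  [/\ forall k, Cb (phi k), forall k x, 0 <= phi k x <= 1,
      forall k x, phi k x <= phi k.+1 x, forall k x, ~ U x -> phi k x = 0 &
      forall x, U x -> exists k0, forall k, (k0 <= k)%N -> phi k x = 1].
Proof.
move=> oU.
have gap0 x : 0 <= gap U x.
  by apply: lb_le_inf; [exists 1; left|move=> r [->//|[y _ ->]]].
exists (fun k x => clamp (k%:R * gap U x)); split.
- move=> k; apply: Cb_clamp => x.
  by apply: (@continuousM R 'cV[R]_n (fun=> k%:R) (gap U)); [exact: cst_continuous|exact: gap_continuous].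
- by move=> k x; rewrite clamp_ge0 clamp_le1.
- by move=> k x; apply: clamp_mono; rewrite ler_wpM2r// ler_nat.
- move=> k x Ux; apply: clamp_eq0.
  have : gap U x <= 0.
    by apply: ge_inf (gap_has_inf U x).2 _ _; right; exists x => //; rewrite subrr normr0.
  by move=> h; rewrite mulr_ge0_le0.
- move=> x Ux; have /nbhs_ballP[e /= e0 he] := oU x Ux.
  have e1 : 0 < Num.min 1 e by rewrite lt_min ltr01 e0.
  have eg : Num.min 1 e <= gap U x.
    apply: lb_le_inf; first by exists 1; left.
    move=> r [->|[y Uy ->]]; first by rewrite ge_min lexx.
    rewrite ge_min; apply/orP; right; rewrite leNgt; apply/negP => xy; apply: Uy.
    by apply: he; rewrite -ball_normE.
  exists (Num.truncn (Num.min 1 e)^-1).+1 => k hk; apply: clamp_eq1.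
  apply: (@le_trans _ _ (k%:R * Num.min 1 e)); last by rewrite ler_wpM2l.
  rewrite -ler_pdivrMr// mul1r; apply: le_trans (ltW (truncnS_gt _)) _.
  by rewrite ler_nat.
Qed.

Lemma compact_ball (r : R) : compact [set x : 'cV[R]_n | `|x| <= r].
Proof.
have -> : [set x : 'cV[R]_n | `|x| <= r] = trmx @` [set v : 'rV[R]_n | `|v| <= r].
  apply/seteqP; split => [x /= xr|_ [v /= vr <-]].
    by exists x^T; rewrite ?trmxK //= (le_trans (norm_trmx _)).
  exact: le_trans (norm_trmx _) vr.
apply: continuous_compact.
  apply: continuous_subspaceT; apply: (@locally_lipschitz_continuous _ 'rV[R]_n 'cV[R]_n).
  by move=> x; exists 1 => y _; rewrite mul1r -linearB /= norm_trmx.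
apply: bounded_closed_compact.
  by exists r; split; [exact: num_real|move=> M M1 v /= /le_trans; apply; exact: ltW].
have -> : [set v : 'rV[R]_n | `|v| <= r] = (@Num.norm _ 'rV[R]_n) @^-1` [set x | x <= r] by [].
apply: closed_comp; last exact: closed_le.
by move=> v _; exact: norm_continuous.
Qed.

End CbTheory.

Section Riesz.
Context {R : realType} {n : nat}.
Variable L : ('cV[R]_n -> R) -> R.
Hypothesis L_add : forall f g, Cb f -> Cb g -> L (fun x => f x + g x) = L f + L g.
Hypothesis L_scale : forall a f, Cb f -> L (fun x => a * f x) = a * L f.
Hypothesis L_mono : forall f g, Cb f -> Cb g -> (forall x, f x <= g x) -> L f <= L g.
Hypothesis L_one : L (fun=> 1) = 1.
Hypothesis L_tight : forall e, 0 < e -> exists r : R, forall f, Cb f ->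
  (forall x, 0 <= f x <= 1) -> (forall x, `|x| <= r -> f x = 0) -> L f <= e.

Let L_cst a : L (fun=> a) = a.
Proof.
rewrite -[RHS]mulr1 -L_one -(L_scale a (Cb_cst 1)); congr L.
by apply/funext => x; rewrite mulr1.
Qed.

Let L_ge0 f : Cb f -> (forall x, 0 <= f x) -> 0 <= L f.
Proof. by move=> bf f0; rewrite -(L_cst 0); apply: L_mono => //; exact: Cb_cst. Qed.

Let L_sub f g : Cb f -> Cb g -> L (fun x => f x - g x) = L f - L g.
Proof.
move=> bf bg; rewrite -mulN1r -(L_scale _ bg) -L_add//; last exact: Cb_scale.
by congr L; apply/funext => x; rewrite mulN1r.
Qed.

Let L_sum k (h : nat -> 'cV[R]_n -> R) : (forall i, Cb (h i)) ->
  L (fun x => \sum_(i < k) h i x) = \sum_(i < k) L (h i).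
Proof.
move=> bh; elim: k => [|k IH].
  rewrite big_ord0 -[RHS](L_cst 0); congr L; apply/funext => x; exact: big_ord0.
rewrite big_ord_recr /= -IH -L_add//; last first.
  exact: (Cb_sum (index_enum 'I_k) (h := fun i : 'I_k => h i)).
by congr L; apply/funext => x; rewrite big_ord_recr.
Qed.

(** The covers of Daniell's extension: increasing sequences of continuous functions that end up
    above the indicator of [E], at cost [c]. The infimum of the costs is the outer measure. *)
Let cover (E : set 'cV[R]_n) (g : nat -> 'cV[R]_n -> R) (c : R) :=
  [/\ forall k, Cb (g k), forall k x, 0 <= g k x, forall k x, g k x <= g k.+1 x,
      forall k, L (g k) <= c & forall x, E x -> exists k, 1 <= g k x].

Let cover_le E g c k l x : cover E g c -> (k <= l)%N -> g k x <= g l x.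
Proof.
move=> [_ _ up _ _]; elim: l => [|l IH]; first by rewrite leqn0 => /eqP ->.
rewrite leq_eqVlt => /predU1P[->//|]; rewrite ltnS => /IH /le_trans; apply; exact: up.
Qed.

Let outer (E : set 'cV[R]_n) : R := inf [set c | exists g, cover E g c].

Let outer_has_inf E : has_inf [set c | exists g, cover E g c].
Proof.
split.
  exists 1; exists (fun _ _ => 1); split => //; first by move=> _; exact: Cb_cst.
  - by move=> k; rewrite L_one.
exists 0 => c [g [bg g0 _ gc _]]; apply: le_trans (gc 0%N); exact: L_ge0.
Qed.

Let outer_le E g c : cover E g c -> outer E <= c.
Proof. by move=> h; apply: ge_inf (outer_has_inf E).2 _ _; exists g. Qed.

Let outer_ge E a : (forall g c, cover E g c -> a <= c) -> a <= outer E.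
Proof.
by move=> h; apply: lb_le_inf => [|c [g /h]//]; exact: (outer_has_inf E).1.
Qed.

Let outer_cover E e : 0 < e -> exists g, cover E g (outer E + e).
Proof.
move=> /inf_adherent /(_ (outer_has_inf E))[c [g [bg g0 up gc hE]] ce].
by exists g; split => // k; exact: le_trans (gc k) (ltW ce).
Qed.

Let outer_ge0 E : 0 <= outer E.
Proof. by apply: outer_ge => g c [bg g0 _ gc _]; apply: le_trans (gc 0%N); exact: L_ge0. Qed.

Let outer_set0 : outer set0 = 0.
Proof.
apply/eqP; rewrite eq_le outer_ge0 andbT; apply: (@outer_le _ (fun _ _ => 0)).
by split => //; [move=> _; exact: Cb_cst|move=> k; rewrite L_cst].
Qed.

Let outer_mono E F : E `<=` F -> outer E <= outer F.
Proof.
move=> EF; apply: outer_ge => g c [bg g0 up gc hF]; apply: (@outer_le _ g).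
by split => // x /EF; exact: hF.
Qed.

(** Diagonal cover: its [k]-th function adds the [k]-th functions of the first [k] covers, so each
    cost is a finite sum; the errors [e / 2 ^ i.+1] add up to at most [e]. *)
Let outer_sub (E : (set 'cV[R]_n)^nat) s :
  (forall k, \sum_(i < k) outer (E i) <= s) -> outer (\bigcup_i E i) <= s.
Proof.
move=> hs; apply/ler_addgt0Pr => e e0.
pose ei i : R := e * 2^-1 ^+ i.+1.
have ei0 i : 0 < ei i by rewrite /ei mulr_gt0// exprn_gt0.
have /choice[g hg] : forall i, exists g, cover (E i) g (outer (E i) + ei i).
  by move=> i; exact: outer_cover.
have sei k : \sum_(i < k) ei i <= e.
  suff -> : \sum_(i < k) ei i = e * (1 - 2^-1 ^+ k).
    by rewrite ger_pMr// gerBl exprn_ge0.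
  elim: k => [|k IH]; first by rewrite big_ord0 expr0 subrr mulr0.
  by rewrite big_ord_recr /= IH /ei exprS; field.
apply: (@outer_le _ (fun k x => \sum_(i < k) g i k x)); split.
- move=> k; apply: (Cb_sum (index_enum 'I_k) (h := fun i : 'I_k => g i k)) => i.
  by have [] := hg i.
- by move=> k x; apply: sumr_ge0 => i _; have [_ + _ _ _] := hg i; apply.
- move=> k x; rewrite big_ord_recr /= -[leLHS]addr0; apply: lerD.
    by apply: ler_sum => i _; have [_ _ + _ _] := hg i; apply.
  by have [_ + _ _ _] := hg k; apply.
- move=> k; rewrite (L_sum k (h := fun i => g i k)); last by move=> i; have [] := hg i.
  apply: le_trans (lerD (hs k) (sei k)); rewrite -big_split /=.
  by apply: ler_sum => i _; have [_ _ _ + _] := hg i; apply.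
- move=> x [i _ Ex]; have [_ _ _ _ /(_ x Ex)[k hk]] := hg i.
  exists (maxn i.+1 k); rewrite (bigD1 (Ordinal (leq_maxl i.+1 k)))//=.
  rewrite -[leLHS]addr0; apply: lerD.
    by apply: le_trans hk _; apply: cover_le (hg i) _; exact: leq_maxr.
  by apply: sumr_ge0 => j _; have [_ + _ _ _] := hg j; apply.
Qed.

(** Caratheodory's condition. With [phi k] increasing to the indicator of [U], a cover [g] of [E]
    splits: [g k * phi k] covers the part in [U], and for each fixed [k] the sequence
    [g l * (1 - phi k)] covers the other part at cost [c - L (g k * phi k)]. *)
Let outer_split E U : open U -> outer (E `&` U) + outer (E `&` ~` U) <= outer E.
Proof.
move=> /open_indicator_approx[phi [bphi phi01 up0 phi0 phi1]].
apply: outer_ge => g c cg; have [bg g0 up gc hE] := cg.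
have bgp k l : Cb (fun x => g k x * phi l x) by exact: Cb_mul.
have upl k l x : (k <= l)%N -> phi k x <= phi l x.
  elim: l => [|l IH]; first by rewrite leqn0 => /eqP ->.
  by rewrite leq_eqVlt => /predU1P[->//|]; rewrite ltnS => /IH /le_trans; apply.
have gplek k l m x : (k <= l)%N -> g k x * phi m x <= g l x * phi m x.
  by move=> kl; apply: ler_wpM2r; [have /andP[] := phi01 m x|exact: cover_le cg kl].
have hin k : outer (E `&` ~` U) <= c - L (fun x => g k x * phi k x).
  apply: (@outer_le _ (fun l x => g l x * (1 - phi k x))); split.
  - by move=> l; apply: Cb_mul => //; apply: Cb_sub => //; exact: Cb_cst.
  - by move=> l x; rewrite mulr_ge0// subr_ge0; have /andP[] := phi01 k x.
  - by move=> l x; rewrite ler_wpM2r// subr_ge0; have /andP[] := phi01 k x.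
  - move=> l; pose l' := maxn k l.
    apply: (@le_trans _ _ (L (fun x => g l' x - g l' x * phi k x))).
      apply: L_mono.
      - by apply: Cb_mul => //; apply: Cb_sub => //; exact: Cb_cst.
      - exact: Cb_sub.
      - move=> x; rewrite -{1}[g l' x]mulr1 -mulrBr ler_wpM2r//.
          by rewrite subr_ge0; have /andP[] := phi01 k x.
        by apply: cover_le cg _; exact: leq_maxr.
    rewrite L_sub//; apply: lerD => //; rewrite lerN2; apply: L_mono => // x.
    by apply: gplek; exact: leq_maxl.
  - move=> x [Ex Ux]; have [l hl] := hE x Ex; exists l.
    by rewrite phi0// subr0 mulr1.
rewrite -lerBrDr; apply: (@outer_le _ (fun k x => g k x * phi k x)); split.
- by [].
- by move=> k x; rewrite mulr_ge0//; have /andP[] := phi01 k x.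
- move=> k x; apply: le_trans (gplek k k.+1 k x (leqnSn k)) _.
  by apply: ler_wpM2l => //; exact: up0.
- by move=> k; have := hin k; lra.
- move=> x [Ex Ux]; have [k hk] := hE x Ex; have [l hl] := phi1 x Ux.
  exists (maxn k l); rewrite (hl _ (leq_maxr _ _)) mulr1.
  by apply: le_trans hk _; apply: cover_le cg _; exact: leq_maxl.
Qed.

(** Tightness prevents a loss of mass at infinity. By compactness some [g k] is nearly 1 on a large
    ball, and what it lacks elsewhere is a function vanishing on that ball, on which [L] is
    small. *)
Let outer_setT : outer setT = 1.
Proof.
apply/eqP; rewrite eq_le; apply/andP; split.
  apply: (@outer_le _ (fun _ _ => 1)); split => //; first by move=> _; exact: Cb_cst.
  - by move=> k; rewrite L_one.
apply: outer_ge => g c cg; have [bg g0 up gc hE] := cg.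
apply/ler_addgt0Pr => e e0; have e20 : 0 < e / 2 by rewrite divr_gt0.
have [r hr] := L_tight e20.
have [k hk] : exists k, forall x : 'cV[R]_n, `|x| <= r -> 1 - e / 2 <= g k x.
  have /compact_near_coveringP/(_ nat \oo
      (fun k x => 1 - e / 2 <= g k x)) := @compact_ball R n r.
  case=> [x _|k0 _ hk0]; last first.
    by exists k0 => x xr; exact: (hk0 k0 (leqnn _) x xr).
  have [k hk] := hE x I.
  have [U Ux hU] : exists2 U : set 'cV[R]_n, nbhs x U & forall y, U y -> 1 - e / 2 <= g k y.
    have [cgk _] := bg k.
    have := cgk x; move/cvgrPdist_le => /(_ _ e20) hU; exists [set y | `|g k x - g k y| <= e / 2] => //.
    by move=> y /= /ler_normlP[]; move: hk; lra.
  exists (U, [set l | (k <= l)%N]); first by split => //; exists k.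
  by move=> [y l] /= [/hU h1 kl]; apply: le_trans h1 _; exact: cover_le cg kl.
have bf : Cb (fun x => clamp (1 - e / 2 - g k x)).
  by apply: Cb_clamp; have [] := Cb_sub (Cb_cst (1 - e / 2)) (bg k).
have h1 : L (fun x => clamp (1 - e / 2 - g k x)) <= e / 2.
  apply: hr => // [x|x xr]; first by rewrite clamp_ge0 clamp_le1.
  by apply: clamp_eq0; rewrite subr_le0; exact: hk.
have : L (fun=> 1 - e / 2) <= L (fun x => g k x + clamp (1 - e / 2 - g k x)).
  apply: L_mono; [exact: Cb_cst|exact: Cb_add|move=> x].
  have := g0 k x; case: (clamp_cases (1 - e / 2 - g k x)) => -[h ->]; move: h e0; lra.
rewrite L_cst L_add//; have := gc k; move: h1; lra.
Qed.

Let outer_measure_borel :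
  exists mu : probability (borelV R n) R, forall E, mu E = (outer E)%:E.
Proof.
pose om_ (E : set 'cV[R]_n) : \bar R := (outer E)%:E.
have om0 : om_ set0 = 0%E by rewrite /om_ outer_set0.
have om_ge0 E : (0 <= om_ E)%E by rewrite lee_fin.
have om_le : {homo om_ : A B / A `<=` B >-> (A <= B)%E}.
  by move=> A B AB; rewrite lee_fin; exact: outer_mono.
have om_sub : sigma_subadditive om_.
  move=> E; have hk k : (\sum_(i < k) om_ (E i) <= \sum_(i <oo) om_ (E i))%E.
    rewrite -(big_mkord xpredT (fun i => om_ (E i))).
    by apply: (nneseries_lim_ge k) => i _ _.
  have := nneseries_ge0 (fun i (_ : (0 <= i)%N) (_ : xpredT i) => om_ge0 (E i)).
  move: hk; case: (\sum_(i <oo) om_ (E i))%E => [s hk _|_ _|//]; last by rewrite leey.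
  by rewrite lee_fin; apply: outer_sub => k; rewrite -lee_fin -sumEFin; exact: hk.
pose om : {outer_measure set 'cV[R]_n -> \bar R} :=
  HB.pack om_ (isOuterMeasure.Build R 'cV[R]_n om_ om0 om_ge0 om_le om_sub).
have cara (E : set (borelV R n)) : measurable E -> om.-cara.-measurable E.
  apply: smallest_sub; first exact: sigma_algebra_measurable.
  move=> U oU; apply: le_caratheodory_measurable => E'.
  by rewrite -EFinD lee_fin; exact: outer_split.
have om_sigma : semi_sigma_additive (om_ : set (borelV R n) -> \bar R).
  move=> F mF tF mUF; apply: (@caratheodory_measure_sigma_additive _ _ om) => //.
    by move=> i; exact: cara.
  exact: cara.
have [mu0 mu0E] : exists mu0 : {measure set (borelV R n) -> \bar R}, forall E, mu0 E = om_ E.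
  pose mu0 : {measure set (borelV R n) -> \bar R} :=
    HB.pack om_ (isMeasure.Build _ (borelV R n) R om_ om0 om_ge0 om_sigma).
  by exists mu0.
have om1 : mu0 setT = 1%E by rewrite mu0E /om_ outer_setT.
(* The total mass is 1, so normalising changes nothing except the type. *)
exists (mnormalize mu0 (dirac (0 : borelV R n))) => E.
rewrite /= /mnormalize om1 /= onee_eq0 /= invr1 mule1; exact: mu0E.
Qed.

Theorem riesz_probability : exists mu : probability (borelV R n) R,
  forall f, Cb f -> \int[mu]_x f x = L f.
Proof.
have [mu muE] := outer_measure_borel; exists mu.
have Cb_int f : Cb f -> mu.-integrable setT (EFin \o (f : borelV R n -> R)).
  move=> [cf [M fM]]; apply: (@bounded_integrable _ _ _ mu _ M) => //.
  exact: borel_measurable_continuous.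
have int_cst (a : R) : \int[mu]_x a = a.
  by rewrite Rintegral_cst// [X in _ * X](congr1 fine (probability_setT mu)) mulr1.
(* [N f] is cut into [N] layers [h j]. The set [A j] where [h j] reaches 1 has the constant sequence
   [h j] as a cover, so its measure is at most [L (h j)]; the shift by one layer costs [1 / N]. *)
have upper f : Cb f -> (forall x, 0 <= f x <= 1) -> \int[mu]_x f x <= L f.
  move=> bf f01; apply/ler_addgt0Pr => e e0.
  pose N := (Num.truncn e^-1).+1.
  have N0 : (0 : R) < N%:R by rewrite ltr0n.
  have Ne : 1 <= N%:R * e.
    by rewrite -ler_pdivrMr// mul1r; exact: ltW (truncnS_gt _).
  pose h j x := clamp (N%:R * f x - j%:R).
  have bh j : Cb (h j).
    by apply: Cb_clamp; have [] := Cb_sub (Cb_scale N%:R bf) (Cb_cst j%:R).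
  pose A j : set (borelV R n) := [set x | 1 <= h j x].
  have mA j : measurable (A j).
    have := @borel_measurable_continuous R n (h j) (proj1 (bh j)).
    move=> /(_ measurableT `[1, +oo[%classic (measurable_itv _)); rewrite setTI.
    by congr measurable; apply/seteqP; split=> x /=; rewrite in_itv/= andbT.
  have intA j : mu.-integrable setT (EFin \o (\1_(A j) : borelV R n -> R)).
    apply: (@bounded_integrable _ _ _ mu _ 1) => //.
    by move=> x; rewrite indicE; case: (_ \in _); rewrite ?normr1 ?normr0.
  have muA j : \int[mu]_x (\1_(A j) x) <= L (h j).
    have -> : \int[mu]_x (\1_(A j) x) = outer (A j).
      by rewrite /Rintegral integral_indic// setIT; exact: (congr1 fine (muE (A j))).
    apply: (@outer_le _ (fun=> h j)).
    by split => // k x; exact: clamp_ge0.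
  have pt x : N%:R * f x <= 1 + \sum_(j < N) \1_(A j) x.
    have /andP[f0 f1] := f01 x; have [y1|y1] := lerP 1 (N%:R * f x); last first.
      by rewrite (le_trans (ltW y1))// lerDl sumr_ge0.
    have y2 : N%:R * f x <= N%:R by rewrite ger_pMr.
    have := @sum_clamp R (N%:R * f x - 1) N; rewrite subr_ge0 => /(_ y1).
    rewrite min_l; last by rewrite lerBlDr (le_trans y2)// lerDl.
    move=> sE; rewrite -lerBlDl -sE; apply: ler_sum => j _; rewrite indicE.
    case: (clamp_cases (N%:R * f x - 1 - j%:R)) => -[hj ->]; first by case: (_ \in _).
      rewrite mem_set ?(andP hj).2// /A /h /= clamp_eq1//.
      by move: hj; rewrite addrAC; lra.
    rewrite mem_set// /A /h /= clamp_eq1//.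
    by move: hj; rewrite addrAC; lra.
  have : \int[mu]_x (N%:R * f x) <= \int[mu]_x (1 + \sum_(j < N) \1_(A j) x).
    apply: le_Rintegral => //; first exact: (Cb_int _ (Cb_scale _ bf)).
    apply: (@bounded_integrable _ _ _ mu _ (1 + N%:R)) => //.
      by apply: measurable_funD => //; apply: measurable_sum => j; exact: measurable_indic.
    move=> x; apply: le_trans (ler_normD _ _) _; rewrite normr1 lerD2l.
    apply: le_trans (ler_norm_sum _ _ _) _.
    rewrite -[X in _ <= X%:R]card_ord -sum1_card natr_sum.
    by apply: ler_sum => j _; rewrite indicE; case: (_ \in _); rewrite ?normr1 ?normr0.
  rewrite RintegralZl//; last exact: Cb_int.
  rewrite RintegralD//; [|exact: (Cb_int _ (Cb_cst 1))|]; last first.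
    apply: (@bounded_integrable _ _ _ mu _ N%:R) => //.
      by apply: measurable_sum => j; exact: measurable_indic.
    move=> x; apply: le_trans (ler_norm_sum _ _ _) _.
    rewrite -[X in _ <= X%:R]card_ord -sum1_card natr_sum.
    by apply: ler_sum => j _; rewrite indicE; case: (_ \in _); rewrite ?normr1 ?normr0.
  rewrite int_cst (Rintegral_sum (index_enum 'I_N) (fun j : 'I_N => intA j)).
  have sL : \sum_(j < N) L (h j) = N%:R * L f.
    rewrite -(L_sum N bh) -L_scale//; congr L; apply/funext => x.
    have /andP[f0 f1] := f01 x.
    by rewrite sum_clamp ?mulr_ge0// min_l// ger_pMr.
  have : \sum_(j < N) \int[mu]_x (\1_(A j) x) <= N%:R * L f.
    by rewrite -sL; apply: ler_sum => j _; exact: muA.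
  move=> h1 h2; rewrite -(ler_pM2l N0) mulrDr; move: h1 h2 Ne; lra.
(* The reverse inequality is [upper] for [1 - f]. *)
have eq01 f : Cb f -> (forall x, 0 <= f x <= 1) -> \int[mu]_x f x = L f.
  move=> bf f01; apply/eqP; rewrite eq_le upper//=.
  have := upper _ (Cb_sub (Cb_cst 1) bf); rewrite L_sub ?L_cst//; last exact: Cb_cst.
  rewrite RintegralB//; [|exact: (Cb_int _ (Cb_cst 1))|exact: Cb_int].
  by rewrite int_cst lerD2l lerN2; apply => x; have := f01 x; lra.
move=> f bf; have [cf [M0 fM0]] := bf.
pose M := `|M0| + 1; have M1 : 0 < M by rewrite ltr_wpDl.
have fM x : `|f x| <= M by rewrite (le_trans (fM0 x))// (le_trans (ler_norm _))// lerDl.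
pose g x := (2 * M)^-1 * (f x + M).
have bg : Cb g by apply: Cb_scale; apply: Cb_add => //; exact: Cb_cst.
have g01 x : 0 <= g x <= 1.
  have M2 : 0 < 2 * M by rewrite mulr_gt0.
  rewrite /g mulrC divr_ge0 ?(ltW M2) ?ler_pdivrMr//=; have /ler_normlP[] := fM x; lra.
have fE : f = fun x => 2 * M * g x + (- M).
  by apply/funext => x; rewrite /g mulVKf ?addrK// mulf_neq0 ?pnatr_eq0// gt_eqF.
have bsg := Cb_scale (2 * M) bg.
rewrite fE L_add//; last exact: Cb_cst.
rewrite (L_scale _ bg) L_cst -eq01//.
rewrite RintegralD//; [|exact: Cb_int|exact: (Cb_int _ (Cb_cst (- M)))].
by rewrite int_cst RintegralZl//; exact: Cb_int.
Qed.

End Riesz.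

(** * Exponential moments of the noise *)

Section MeanBound.
Context {d : measure_display} {T : measurableType d} {R : realType}.
Variable P : probability T R.
Implicit Types (Y Z : T -> R) (a b c : R).

(** Integrability is bundled with the bound, since the real-valued integral of a nonnegative
    function with infinite mean is 0 by convention. *)
Definition mean_le Y c :=
  P.-integrable setT (EFin \o Y) /\ \int[P]_w Y w <= c.

Lemma mean_le_cst a : mean_le (fun=> a) a.
Proof.
split; first by apply: (@bounded_integrable _ _ _ P _ `|a|).
by rewrite Rintegral_cst// [X in _ * X](congr1 fine (probability_setT P)) mulr1.
Qed.

Lemma mean_le_add Y Z a b : mean_le Y a -> mean_le Z b ->
  mean_le (fun w => Y w + Z w) (a + b).
Proof.
move=> [iY Ya] [iZ Zb]; split; last by rewrite RintegralD// lerD.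
by have := integrableD measurableT iY iZ.
Qed.

Lemma mean_le_scale a Y c : 0 <= a -> mean_le Y c -> mean_le (fun w => a * Y w) (a * c).
Proof.
move=> a0 [iY Yc]; split; last by rewrite RintegralZl// ler_wpM2l.
by have := @integrableZl _ _ _ P setT measurableT a _ iY.
Qed.

Lemma mean_le_sum (I : Type) (s : seq I) (Y : I -> T -> R) (c : I -> R) :
  (forall i, mean_le (Y i) (c i)) ->
  mean_le (fun w => \sum_(i <- s) Y i w) (\sum_(i <- s) c i).
Proof.
move=> Yc; elim: s => [|i s IH].
  rewrite big_nil (_ : (fun w => _) = fun=> 0); first exact: mean_le_cst.
  by apply/funext => w; rewrite big_nil.
rewrite big_cons (_ : (fun w => _) = fun w => Y i w + \sum_(j <- s) Y j w).
  exact: mean_le_add.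
by apply/funext => w; rewrite big_cons.
Qed.

Lemma mean_le_weak Y a b : a <= b -> mean_le Y a -> mean_le Y b.
Proof. by move=> ab [iY Ya]; split => //; exact: le_trans ab. Qed.

Lemma mean_le_dom Y Z c : measurable_fun setT Y ->
  (forall w, 0 <= Y w <= Z w) -> mean_le Z c -> mean_le Y c.
Proof.
move=> mY YZ [iZ Zc].
have iY : P.-integrable setT (EFin \o Y).
  apply: le_integrable iZ => //; first exact/measurable_EFinP.
  move=> w _ /=; have /andP[Y0 h] := YZ w.
  by rewrite lee_fin !ger0_norm// (le_trans Y0 h).
split => //; apply: le_trans Zc; apply: le_Rintegral => // w _.
by have /andP[] := YZ w.
Qed.

Lemma mean_le_dom_ae Y Z c : measurable_fun setT Y ->
  {ae P, forall w, 0 <= Y w <= Z w} -> mean_le Z c -> mean_le Y c.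
Proof.
move=> mY YZ [iZ Zc].
have iY : P.-integrable setT (EFin \o Y).
  apply/integrableP; split; first exact/measurable_EFinP.
  have /integrableP[mZ] := iZ; apply: le_lt_trans.
  apply: ae_ge0_le_integral => //.
  - by apply: measurableT_comp => //; exact/measurable_EFinP.
  - exact: measurableT_comp.
  - apply: filterS YZ => w /andP[Y0 h] _ /=.
    by rewrite lee_fin !ger0_norm// (le_trans Y0 h).
split => //; apply: le_trans Zc; rewrite /Rintegral fine_le//.
- exact: integrable_fin_num.
- exact: integrable_fin_num.
have h1 : (\int[P]_x (Y x)%:E = \int[P]_x `|(Y x)%:E|)%E.
  apply: ae_eq_integral => //; [exact/measurable_EFinP| |].
    by apply: measurableT_comp => //; exact/measurable_EFinP.
  by apply: filterS YZ => w /andP[Y0 h] _ /=; rewrite ger0_norm.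
have mZ : measurable_fun setT Z by apply/measurable_EFinP; exact: measurable_int iZ.
have h2 : (\int[P]_x (Z x)%:E = \int[P]_x `|(Z x)%:E|)%E.
  apply: ae_eq_integral => //; [exact/measurable_EFinP| |].
    by apply: measurableT_comp => //; exact/measurable_EFinP.
  by apply: filterS YZ => w /andP[Y0 h] _ /=; rewrite ger0_norm// (le_trans Y0).
rewrite h1 h2; apply: ae_ge0_le_integral => //.
- by apply: measurableT_comp => //; exact/measurable_EFinP.
- by apply: measurableT_comp => //; exact/measurable_EFinP.
- apply: filterS YZ => w /andP[Y0 h] _ /=.
  by rewrite lee_fin !ger0_norm// (le_trans Y0 h).
Qed.

Lemma mean_le_ge0 Y c : measurable_fun setT Y -> (forall w, 0 <= Y w) ->
  (\int[P]_w (Y w)%:E <= c%:E)%E -> mean_le Y c.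
Proof.
move=> mY Y0 h.
have iY : P.-integrable setT (EFin \o Y).
  apply/integrableP; split; first exact/measurable_EFinP.
  under eq_integral do rewrite /= ger0_norm//.
  by rewrite (le_lt_trans h)// ltry.
by split => //; rewrite -lee_fin /Rintegral fineK//; exact: integrable_fin_num.
Qed.

Lemma mean_le_integral Y c : mean_le Y c -> (\int[P]_w (Y w)%:E <= c%:E)%E.
Proof.
by move=> [iY Yc]; rewrite -[leLHS]fineK ?lee_fin//; exact: integrable_fin_num.
Qed.

Lemma mean_le_fatou (Y_ : nat -> T -> R) Y c : (forall k w, 0 <= Y_ k w) ->
  (forall k, mean_le (Y_ k) c) -> (forall w, Y_ ^~ w @ \oo --> Y w) ->
  measurable_fun setT Y /\ mean_le Y c.
Proof.
move=> Y0 Yc cY.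
have mY_ k : measurable_fun setT (Y_ k).
  by apply/measurable_EFinP; exact: measurable_int (Yc k).1.
have mY : measurable_fun setT Y by apply: (measurable_fun_cvg mY_) => w _; exact: cY.
split => //; apply: mean_le_ge0 => // [w|].
  apply: (@closed_cvg _ _ _ eventually_filter (Y_ ^~ w) [set y | 0 <= y]) (cY w).
    exact: closed_ge.
  by apply: nearW => k; exact: Y0.
have := @fatou _ _ _ P setT measurableT (fun k w => (Y_ k w)%:E).
have -> : (\int[P]_x limn_einf (fun k => (Y_ k x)%:E) = \int[P]_x (Y x)%:E)%E.
  apply: eq_integral => w _; rewrite is_cvg_limn_einfE; last first.
    by apply/cvg_ex; exists (Y w)%:E; apply: cvg_EFin (cY w); exact: nearW.
  by apply: cvg_lim => //; apply: cvg_EFin (cY w); exact: nearW.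
move=> h; apply: le_trans (h _ _) _.
- by move=> k; exact/measurable_EFinP.
- by move=> k w _; rewrite lee_fin.
rewrite limn_einf_lim; apply: lime_le; first exact: is_cvg_einfs.
apply: nearW => k; apply: (@le_trans _ _ (\int[P]_w (Y_ k w)%:E)%E).
  by apply: ereal_inf_lbound; exists k => /=.
exact: mean_le_integral.
Qed.

End MeanBound.

(** Convexity is given by supporting lines; summing the line at the mean cancels its linear part. *)
Lemma jensen_mean (R : realType) (phi slope : R -> R) (y : nat -> R) (N : nat) :
  (forall m z, 0 <= m -> 0 <= z -> phi m + slope m * (z - m) <= phi z) ->
  (forall i, 0 <= y i) ->
  phi (N.+1%:R^-1 * \sum_(i < N.+1) y i) <= N.+1%:R^-1 * \sum_(i < N.+1) phi (y i).
Proof.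
move=> tan y0; set m := N.+1%:R^-1 * _.
have N0 : (N.+1%:R : R) != 0 by rewrite pnatr_eq0.
have Ni : 0 < N.+1%:R^-1 :> R by rewrite invr_gt0.
have m0 : 0 <= m by rewrite mulr_ge0 ?(ltW Ni)// sumr_ge0.
have -> : phi m = N.+1%:R^-1 * \sum_(i < N.+1) (phi m + slope m * (y i - m)).
  rewrite big_split /= -mulr_sumr sumrB !sumr_const !card_ord.
  have -> : \sum_(i < N.+1) y i = N.+1%:R * m by rewrite /m mulVKf.
  by rewrite -[phi m *+ _]mulr_natl -[m *+ _]mulr_natl subrr mulr0 addr0 mulKf.
by rewrite ler_pM2l//; apply: ler_sum => i _; exact: tan.
Qed.

Lemma expR_tangent (R : realType) (a m z : R) :
  expR (a * m) + a * expR (a * m) * (z - m) <= expR (a * z).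
Proof.
have -> : expR (a * m) + a * expR (a * m) * (z - m) = expR (a * m) * (1 + a * (z - m)) by ring.
have -> : expR (a * z) = expR (a * m) * expR (a * (z - m)) by rewrite -expRD; congr expR; ring.
by rewrite ler_wpM2l ?expR_ge0// expR_ge1Dx.
Qed.

Lemma power_tangent (R : realType) k (m z : R) : 0 <= m -> 0 <= z ->
  m ^+ k.+1 + k.+1%:R * m ^+ k * (z - m) <= z ^+ k.+1.
Proof.
move=> m0 z0; elim: k => [|k IH]; first by rewrite expr0 !expr1; lra.
rewrite [leRHS]exprS; apply: le_trans (ler_wpM2l z0 IH).
rewrite -subr_ge0.
have -> : z * (m ^+ k.+1 + k.+1%:R * m ^+ k * (z - m)) -
    (m ^+ k.+2 + k.+2%:R * m ^+ k.+1 * (z - m)) =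
    k.+1%:R * m ^+ k * (z - m) ^+ 2.
  by rewrite !exprS -[k.+2%:R]natr1; ring.
by rewrite mulr_ge0 ?sqr_ge0// mulr_ge0// exprn_ge0.
Qed.

Lemma riemann_sum_cvg (R : realType) (f I : R -> R) (T : R) : 0 < T -> continuous f ->
  (forall t : R, 0 <= t -> is_derive t (1:R) I (f t)) -> I 0 = 0 ->
  N.+1%:R^-1 * \sum_(i < N.+1) (T * f (i%:R * (T / N.+1%:R))) @[N --> \oo] --> I T.
Proof.
move=> T0 cf dI I0; apply/cvgrPdist_le => e e0.
have e1 : 0 < e / T by rewrite divr_gt0.
have [dl dl0 hd] := uniformly_continuous_segment T cf e1.
exists (Num.truncn (T / dl)) => // N /= hN.
set h := T / N.+1%:R.
have N0 : (0 : R) < N.+1%:R by rewrite ltr0n.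
have h0 : 0 < h by rewrite divr_gt0.
have hdl : h <= dl.
  rewrite ler_pdivrMr// mulrC -ler_pdivrMr//; apply: le_trans (ltW (truncnS_gt _)) _.
  by rewrite ler_nat.
have step (i : nat) : (i < N.+1)%N ->
    `|I (i.+1%:R * h) - I (i%:R * h) - h * f (i%:R * h)| <= h * (e / T).
  move=> iN.
  have ih0 : 0 <= i%:R * h by rewrite mulr_ge0// ltW.
  have iT : i%:R * h <= T.
    rewrite /h mulrCA ger_pMr// ler_pdivrMr// mul1r ler_nat; exact: ltnW.
  have le : i%:R * h <= i.+1%:R * h by rewrite ler_pM2r// ler_nat.
  have dif : i.+1%:R * h - i%:R * h = h by rewrite -natr1; ring.
  have osc s : i%:R * h < s < i.+1%:R * h -> `|f (i%:R * h) - f s| <= e / T.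
    move=> /andP[s1 s2]; rewrite distrC; apply: hd; first exact/andP.
    by rewrite ger0_norm; move: s1 s2 dif hdl; lra.
  have up : I (i.+1%:R * h) - I (i%:R * h) <= (f (i%:R * h) + e / T) * h.
    rewrite -[X in _ <= _ * X]dif; apply: (@is_derive_growth _ I f) => // s.
      by move=> /andP[s1 _]; apply: dI; exact: le_trans s1.
    by move=> /osc/ler_normlP[]; lra.
  have dn : (- I) (i.+1%:R * h) - (- I) (i%:R * h) <= (- f (i%:R * h) + e / T) * h.
    rewrite -[X in _ <= _ * X]dif; apply: (@is_derive_growth _ (- I) (fun s => - f s)) => // s.
      by move=> /andP[s1 _]; apply: is_deriveN; apply: dI; exact: le_trans s1.
    by move=> /osc/ler_normlP[]; lra.
  move: up dn; rewrite /= !fctE ler_norml => up dn; apply/andP; split; move: up dn; lra.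
have tele (k : nat) : (k <= N.+1)%N ->
    `|I (k%:R * h) - \sum_(i < k) (h * f (i%:R * h))| <= k%:R * h * (e / T).
  elim: k => [_|k IH kN]; first by rewrite big_ord0 !mul0r I0 subrr normr0.
  rewrite big_ord_recr /=.
  have -> : I (k.+1%:R * h) - (\sum_(i < k) (h * f (i%:R * h)) + h * f (k%:R * h)) =
     (I (k%:R * h) - \sum_(i < k) (h * f (i%:R * h))) +
     (I (k.+1%:R * h) - I (k%:R * h) - h * f (k%:R * h)) by ring.
  have -> : k.+1%:R * h * (e / T) = k%:R * h * (e / T) + h * (e / T) by rewrite -natr1; ring.
  by apply: le_trans (ler_normD _ _) _; apply: lerD; [exact/IH/ltnW|exact: step].
have := tele N.+1 (leqnn _).
have -> : N.+1%:R * h = T by rewrite /h mulrC divfK// gt_eqF.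
rewrite -mulr_sumr -mulr_sumr.
have -> : T * (e / T) = e by rewrite mulrC divfK// gt_eqF.
by rewrite mulrA /h [_^-1 * T]mulrC.
Qed.

(** By Jensen's inequality [phi] of a time integral is at most the time average of [phi (T * f t)].
    The argument runs on Riemann sums, for which measurability at each fixed time is enough, and
    ends with Fatou's lemma, which also gives the measurability of the limit. *)
Lemma path_average (R : realType) d (Omega : measurableType d) (P : probability Omega R)
    (f I : R -> Omega -> R) (phi slope : R -> R) (T c : R) : 0 < T ->
  (forall t w, 0 <= t -> 0 <= f t w) ->
  (forall w, continuous (f ^~ w)) ->
  (forall w (t : R), 0 <= t -> is_derive t (1:R) (I ^~ w) (f t w)) ->
  (forall w, I 0 w = 0) ->
  (forall m z, 0 <= m -> 0 <= z -> phi m + slope m * (z - m) <= phi z) ->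
  continuous phi -> (forall z, 0 <= z -> 0 <= phi z) ->
  (forall t, 0 <= t <= T -> mean_le P (fun w => phi (T * f t w)) c) ->
  (forall t, 0 <= t -> measurable_fun setT (f t)) ->
  measurable_fun setT (fun w => phi (I T w)) /\ mean_le P (fun w => phi (I T w)) c.
Proof.
move=> T0 f0 cf dI I0 tan cphi phi0 fc mf.
have time N (i : 'I_N.+1) : 0 <= i%:R * (T / N.+1%:R) <= T.
  have N0 : (0 : R) < N.+1%:R by rewrite ltr0n.
  rewrite mulr_ge0 ?divr_ge0 ?(ltW T0)//= mulrCA ger_pMr//.
  by rewrite ler_pdivrMr// mul1r ler_nat ltnW.
pose Y N w := N.+1%:R^-1 * \sum_(i < N.+1) (T * f (i%:R * (T / N.+1%:R)) w).
have Yt N w : 0 <= Y N w.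
  rewrite mulr_ge0// sumr_ge0// => i _; rewrite mulr_ge0 ?(ltW T0)// f0//.
  by have /andP[] := time N i.
apply: (@mean_le_fatou _ _ _ P (fun N w => phi (Y N w))).
- by move=> N w; exact: phi0.
- move=> N; apply: (@mean_le_dom _ _ _ _ _
    (fun w => N.+1%:R^-1 * \sum_(i < N.+1) phi (T * f (i%:R * (T / N.+1%:R)) w))).
  + apply: (measurableT_comp (f := phi)); first exact: continuous_measurable_fun.
    apply: measurable_funM => //; apply: measurable_sum => i.
    by apply: measurable_funM => //; apply: mf; have /andP[] := time N i.
  + move=> w; rewrite phi0//=.
    apply: (@jensen_mean _ phi slope (fun i => T * f (i%:R * (T / N.+1%:R)) w)) => // i.
    by rewrite mulr_ge0 ?(ltW T0)// f0// mulr_ge0// divr_ge0// ltW.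
  + have -> : c = N.+1%:R^-1 * \sum_(i < N.+1) c.
      by rewrite sumr_const card_ord -[c *+ _]mulr_natl mulKf// pnatr_eq0.
    apply: mean_le_scale => //; apply: mean_le_sum => i; exact/fc/time.
- move=> w; apply: continuous_cvg; first exact: cphi.
  exact: (riemann_sum_cvg T0 (cf w) (dI w) (I0 w)).
Qed.

Section NormalDensity.
Import HBNNSimple.

Lemma integral_normal_prob (R : realType) (s : R) (f : _ -> \bar R) :
  measurable_fun setT f -> (forall x, (0 <= f x)%E) ->
  (\int[normal_prob 0 s]_x f x =
   \int[lebesgue_measure]_x (f x * (normal_pdf 0 s x)%:E))%E.
Proof.
move=> mf f0; pose h := nnsfun_approx measurableT mf.
have mp : measurable_fun setT (fun x => (normal_pdf 0 s x)%:E).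
  by apply/measurable_EFinP; exact: measurable_normal_pdf.
have p0 x : (0 <= (normal_pdf 0 s x)%:E)%E by rewrite lee_fin normal_pdf_ge0.
transitivity (lim (\int[normal_prob 0 s]_x (h k x)%:E @[k --> \oo])%E).
  rewrite -monotone_convergence//=.
  - apply: eq_integral => ? /[!inE] xD; apply/esym/cvg_lim => //=.
    exact: cvg_nnsfun_approx.
  - by move=> k; exact/measurable_EFinP/measurable_funTS.
  - by move=> k ? _; rewrite lee_fin.
  - by move=> ? _ ? ? mn; rewrite lee_fin; exact/lefP/nd_nnsfun_approx.
transitivity (lim (\int[lebesgue_measure]_x ((h k x)%:E * (normal_pdf 0 s x)%:E) @[k --> \oo])%E);
  last first.
  rewrite -monotone_convergence//=.
  - apply: eq_integral => ? /[!inE] xD; apply/cvg_lim => //=.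
    by apply: cvgeZr => //; exact: cvg_nnsfun_approx.
  - by move=> k; apply: emeasurable_funM => //; exact/measurable_EFinP/measurable_funTS.
  - by move=> k ? _; rewrite mule_ge0// lee_fin.
  - move=> ? _ ? ? mn; apply: lee_wpmul2r => //; rewrite lee_fin.
    exact/lefP/nd_nnsfun_approx.
congr (lim (_ @ \oo)); apply/funext => k.
have mi r : measurable_fun setT (fun x => (r * \1_(h k @^-1` [set r]) x)%:E).
  by apply/measurable_EFinP; exact: measurable_funM.
transitivity (\int[normal_prob 0 s]_x
    (\sum_(y \in range (h k)) (y * \1_(h k @^-1` [set y]) x)%:E))%E.
  by apply: eq_integral => t tE; rewrite /= fimfunE -fsumEFin.
rewrite ge0_integral_fsum//; last by move=> m y Ey; exact: nnfun_muleindic_ge0.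
transitivity (\int[lebesgue_measure]_x (\sum_(y \in range (h k))
    (y * \1_(h k @^-1` [set y]) x)%:E * (normal_pdf 0 s x)%:E))%E; last first.
  apply: eq_integral => x _; rewrite -ge0_mule_fsuml => [|y]; last exact: nnfun_muleindic_ge0.
  by rewrite fsumEFin // -(fimfunE _ x).
rewrite ge0_integral_fsum//; last 2 first.
  - by move=> y; exact: emeasurable_funM.
  - by move=> m y Ey; rewrite mule_ge0// nnfun_muleindic_ge0.
apply: eq_fsbigr => r rhk.
have r0 : 0 <= r by move: rhk; rewrite inE => -[x _ <-].
under eq_integral do rewrite EFinM.
rewrite ge0_integralZl_EFin//; [|by apply/measurable_EFinP; exact: measurable_indic].
under [RHS]eq_integral do rewrite EFinM -muleA.
rewrite ge0_integralZl_EFin//; [|by move=> x _; rewrite mule_ge0// lee_fin|]; last first.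
  by apply: emeasurable_funM => //; apply/measurable_EFinP; exact: measurable_indic.
congr (_ * _)%E; rewrite integral_indic// setIT.
transitivity (\int[lebesgue_measure]_(x in h k @^-1` [set r]) (normal_pdf 0 s x)%:E)%E => //.
rewrite [LHS]integral_mkcond /=; apply: eq_integral => x _.
by rewrite patchE indicE; case: ifP => _; rewrite ?mul1e ?mul0e.
Qed.

End NormalDensity.

(** Completing the square: [exp (b x)] times the centered density is a constant times the density
    centered at [b s^2]. *)
Lemma normal_mgf (R : realType) (s b : R) : s != 0 ->
  (\int[normal_prob 0 s]_x (expR (b * x))%:E = (expR (b ^+ 2 * s ^+ 2 / 2))%:E)%E.
Proof.
move=> s0; rewrite integral_normal_prob//; last first.
  apply/measurable_EFinP; apply: measurableT_comp => //; exact: measurable_funM.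
transitivity (\int[lebesgue_measure]_x ((expR (b ^+ 2 * s ^+ 2 / 2))%:E *
    (normal_pdf (b * s ^+ 2) s x)%:E))%E; last first.
  rewrite ge0_integralZl_EFin ?integral_normal_pdf ?mule1 ?expR_ge0//.
    by move=> x _; rewrite lee_fin normal_pdf_ge0.
  by apply/measurable_EFinP; exact: measurable_normal_pdf.
apply: eq_integral => x _; rewrite -!EFinM; congr EFin.
rewrite !normal_pdfE// /normal_fun mulrCA [RHS]mulrCA; congr (_ * _).
rewrite -!expRD; congr expR; field.
exact: s0.
Qed.

Lemma norm_bigmax (R : realType) (n : nat) (x : 'cV[R]_n) :
  `|x| = \big[Num.max/0]_(i < n) `|x i 0|.
Proof.
apply/eqP; rewrite eq_le; apply/andP; split.
  apply: norm_le_coord => [|i]; last exact: (le_bigmax _ (fun i => `|x i 0|) i).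
  by elim/big_ind: _ => // y z y0 z0; rewrite le_max y0.
by apply/bigmax_leP; split => // i _; exact: coord_le_norm.
Qed.

Section BrownianMoments.
Context {R : realType} {n : nat} {d : measure_display} {Omega : measurableType d}.
Variables (P : probability Omega R) (W : R -> Omega -> borelV R n).
Hypothesis BM : standard_brownian_motion P W.

(** The law is prescribed for increments, and [W 0] vanishes only almost surely. *)
Let inc t w : 'cV[R]_n := (W t w : 'cV[R]_n) - W 0 w.

Lemma measurable_increment t i : 0 <= t -> measurable_fun setT (fun w => inc t w i 0).
Proof.
move=> t0; rewrite (_ : (fun w => _) = fun w => (W t w : 'cV[R]_n) i 0 - (W 0 w : 'cV[R]_n) i 0).
  exact: (measurable_funB (measurable_brownian_coord BM i t0)
    (measurable_brownian_coord BM i (lexx _))).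
by apply/funext => w; rewrite !mxE.
Qed.

Lemma increment_law t i (E : set R) : 0 < t -> measurable E ->
  P [set w | E (inc t w i 0)] = normal_prob 0 (Num.sqrt t) E.
Proof.
move=> t0 mE; have [_ _ _ _ law] := BM.
have -> : [set w | E (inc t w i 0)] =
    [set w | forall j, (if j == i then E else setT) (inc t w j 0)].
  apply/seteqP; split => w /=; first by move=> Ew j; case: eqP => [->|].
  by move=> /(_ i); rewrite eqxx.
have law' := law 0 t (lexx _) t0 (fun j => if j == i then E else setT).
rewrite subr0 in law'; rewrite law'; last by move=> j; case: ifP.
rewrite (bigD1 i)//= eqxx big1 ?mule1// => j /negbTE ->.
exact: probability_setT.
Qed.

Lemma increment_mgf t i c : 0 < t ->
  mean_le P (fun w => expR (c * inc t w i 0)) (expR (c ^+ 2 * t / 2)).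
Proof.
move=> t0.
have mi := @measurable_increment t i (ltW t0).
have me : measurable_fun setT (fun x : R => expR (c * x)).
  by apply: measurableT_comp => //; exact: measurable_funM.
apply: mean_le_ge0.
- exact: (measurableT_comp me mi).
- by move=> w; exact: expR_ge0.
have s0 : Num.sqrt t != 0 by rewrite gt_eqF// sqrtr_gt0.
have -> : expR (c ^+ 2 * t / 2) = expR (c ^+ 2 * Num.sqrt t ^+ 2 / 2) by rewrite sqr_sqrtr// ltW.
rewrite -(normal_mgf c s0).
have mi' : @measurable_fun _ _ Omega (measurableTypeR R) setT (fun w => inc t w i 0) by exact: mi.
have [Z ZE] : exists Z : {RV P >-> measurableTypeR R}, forall w, Z w = inc t w i 0.
  by exists (@mfun_Sub _ _ Omega (measurableTypeR R) _ (mem_set mi')).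
have meE : measurable_fun setT (fun x : measurableTypeR R => (expR (c * x))%:E) by exact/measurable_EFinP.
have e1 : (\int[distribution P Z]_y (expR (c * y))%:E = \int[P]_w (expR (c * inc t w i 0))%:E)%E.
  rewrite (ge0_integral_distribution Z meE); last by move=> y; rewrite lee_fin expR_ge0.
  by apply: eq_integral => w _; rewrite [in LHS]/= ZE.
rewrite -e1 le_eqVlt; apply/orP; left; apply/eqP.
apply: eq_measure_integral => E mE _.
apply: etrans (increment_law i t0 mE).
by congr (P _); apply/seteqP; split => w /=; rewrite ZE.
Qed.

(* [e^u - 1 <= th + (e^u - 1)^2 / (4 th)] and [(e^u - 1)^2 <= e^(2u) + e^(-2u) - 2] turn the
   absolute value into a symmetric exponential moment, of the second order in [b]. *)
Lemma expR_norm_le (u th : R) : 0 < th ->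
  expR `|u| <= (1 + th - (2 * th)^-1) +
    ((4 * th)^-1 * expR (2 * u) + (4 * th)^-1 * expR (- 2 * u)).
Proof.
move=> th0.
have -> : (4 * th)^-1 * expR (2 * u) + (4 * th)^-1 * expR (- 2 * u) =
    (4 * th)^-1 * (expR (2 * `|u|) + expR (- 2 * `|u|)).
  rewrite -mulrDr; have [u0|/ltW u0] := lerP 0 u; first by rewrite ger0_norm.
  by rewrite ler0_norm// !mulrN !mulNr opprK [in RHS]addrC.
have := normr_ge0 u; move: `|u| => z z0.
have e1 : 1 <= expR z by rewrite -expR0 ler_expR.
have -> : expR (2 * z) = expR z ^+ 2 by rewrite expr2 -expRD; congr expR; ring.
have -> : expR (- 2 * z) = (expR z)^-1 ^+ 2 by rewrite -expRN expr2 -expRD; congr expR; ring.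
move: (expR z) e1 => y y1.
have y0 : 0 < y by lra.
have cosh : (y - 1) ^+ 2 <= y ^+ 2 + y^-1 ^+ 2 - 2.
  have -> : y ^+ 2 + y^-1 ^+ 2 - 2 = (y - 1) ^+ 2 + (y - 1) ^+ 2 * (2 * y + 1) / y ^+ 2.
    by field; rewrite gt_eqF.
  by rewrite lerDl divr_ge0 ?sqr_ge0// mulr_ge0 ?sqr_ge0//; lra.
have amgm : y - 1 <= th + (4 * th)^-1 * (y - 1) ^+ 2.
  rewrite -subr_ge0.
  have -> : th + (4 * th)^-1 * (y - 1) ^+ 2 - (y - 1) = (y - 1 - 2 * th) ^+ 2 / (4 * th).
    by field; rewrite gt_eqF.
  by rewrite divr_ge0 ?sqr_ge0// mulr_ge0// ltW.
have i0 : 0 <= (4 * th)^-1 by rewrite invr_ge0 mulr_ge0// ltW.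
have := ler_wpM2l i0 cosh.
have -> : (2 * th)^-1 = 2 * (4 * th)^-1 by field; rewrite gt_eqF.
move: amgm; move: (_^-1 ^+ 2) => z2; move: ((4 * th)^-1) => i; lra.
Qed.

(** Each coordinate contributes the mean excess over 1 of its bound in [expR_norm_le]. The parameter
    [th] is free: for [b^2 t] much smaller than [th] the whole is [1 + O(th)]. *)
Definition exp_moment_bound (b t th : R) : R :=
  1 + n%:R * (th + (2 * th)^-1 * (expR (2 * b ^+ 2 * t) - 1)).

(** The max norm is attained at one coordinate and every [Z i] is at least 1, so the exponential is
    at most [1 + \sum_i (Z i - 1)]. Summing excesses instead of the exponentials keeps the bound
    close to 1. *)
Lemma increment_exp_moment t b th : 0 <= t -> 0 <= b -> 0 < th ->
  mean_le P (fun w => expR (b * `|inc t w|)) (exp_moment_bound b t th).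
Proof.
rewrite le_eqVlt => /predU1P[<-|t0] b0 th0.
  have -> : (fun w => expR (b * `|inc 0 w|)) = fun=> 1.
    by apply/funext => w; rewrite /inc subrr normr0 mulr0 expR0.
  apply: mean_le_weak (mean_le_cst P 1); rewrite lerDl mulr_ge0// mulr0 expR0.
  by rewrite subrr mulr0 addr0 ltW.
pose Z i w := (1 + th - (2 * th)^-1) + ((4 * th)^-1 * expR ((2 * b) * inc t w i 0) +
  (4 * th)^-1 * expR ((- 2 * b) * inc t w i 0)).
have i0 : 0 <= (4 * th)^-1 by rewrite invr_ge0 mulr_ge0// ltW.
have ZE i w : expR (b * `|inc t w i 0|) <= Z i w.
  rewrite -{1}(ger0_norm b0) -normrM /Z -!mulrA; exact: expR_norm_le.
pose cz := (1 + th - (2 * th)^-1) + ((4 * th)^-1 * expR (2 * b ^+ 2 * t) +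
  (4 * th)^-1 * expR (2 * b ^+ 2 * t)).
have mZ i : mean_le P (Z i) cz.
  apply: mean_le_add; first exact: mean_le_cst.
  apply: mean_le_add; apply: mean_le_scale => //.
    have -> : 2 * b ^+ 2 * t = (2 * b) ^+ 2 * t / 2 by field.
    exact: increment_mgf.
  have -> : 2 * b ^+ 2 * t = (- 2 * b) ^+ 2 * t / 2 by field.
  exact: increment_mgf.
have mY : measurable_fun setT (fun w => expR (b * `|inc t w|)).
  have mn : measurable_fun setT (fun w => `|inc t w|).
    under eq_fun do rewrite norm_bigmax.
    elim: (index_enum _) => [|i s IH].
      by under eq_fun do rewrite big_nil; exact: measurable_cst.
    under eq_fun do rewrite big_cons.
    apply: measurable_maxr => //; apply: measurableT_comp => //.
    exact: measurable_increment (ltW t0).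
  by apply: measurableT_comp => //; exact: measurable_funM.
apply: (@mean_le_dom _ _ _ _ _ (fun w => 1 + \sum_(i < n) (Z i w + (-1)))) => //.
- move=> w; rewrite expR_ge0 /=.
  have [->|[i hi]] : `|inc t w| = 0 \/ exists i, `|inc t w| = `|inc t w i 0|.
    rewrite norm_bigmax; elim/big_ind: _ => [|y z hy hz|i _]; [by left| |by right; exists i].
    by rewrite /Num.max; case: ifP.
  + rewrite mulr0 expR0 lerDl; apply: sumr_ge0 => i _; rewrite subr_ge0.
    by apply: le_trans (ZE i w); rewrite -expR0 ler_expR mulr_ge0.
  + rewrite hi (bigD1 i)//=.
    have : 0 <= \sum_(j < n | j != i) (Z j w + -1).
      apply: sumr_ge0 => j _; rewrite subr_ge0.
      by apply: le_trans (ZE j w); rewrite -expR0 ler_expR mulr_ge0.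
    by have := ZE i w; lra.
- have -> : exp_moment_bound b t th = 1 + \sum_(i < n) (cz + (-1)).
    rewrite /exp_moment_bound sumr_const card_ord -[(cz - 1) *+ n]mulr_natl; congr (_ + _); congr (_ * _).
    by rewrite /cz; field; rewrite gt_eqF.
  apply: mean_le_add; first exact: mean_le_cst.
  by apply: mean_le_sum => i; apply: mean_le_add => //; exact: mean_le_cst.
Qed.

End BrownianMoments.

(** * Moment drift condition *)

Lemma powerD_le (R : realType) (x y : R) p : 0 <= x -> 0 <= y ->
  (x + y) ^+ p <= 2 ^+ p * (x ^+ p + y ^+ p).
Proof.
move=> x0 y0; wlog xy : x y x0 y0 / x <= y => [h|].
  by have [/h|/ltW/h] := lerP x y; [exact|rewrite addrC [x ^+ p + _]addrC; exact].
apply: (@le_trans _ _ ((2 * y) ^+ p)).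
  by rewrite lerXn2r ?nnegrE ?addr_ge0 ?mulr_ge0//; lra.
by rewrite exprMn ler_wpM2l ?exprn_ge0// lerDr exprn_ge0.
Qed.

Lemma mulr_le_sqrD (R : realType) (x y : R) : x * y <= x ^+ 2 + y ^+ 2.
Proof.
by have := sqr_ge0 (x - y); have := sqr_ge0 x; have := sqr_ge0 y; rewrite !expr2; lra.
Qed.

(** Young's inequality with a weight: a small [th] lets [v] be replaced by [v + g] without spoiling
    a contraction factor. *)
Lemma dotv_add_le (R : realType) (n : nat) (v g : 'cV[R]_n) (th : R) : 0 < th ->
  dotv (v + g) (v + g) <= (1 + th) * dotv v v + (1 + th^-1) * dotv g g.
Proof.
move=> th0; rewrite /dotv !mulr_sumr -big_split /=; apply: ler_sum => i _.
rewrite !mxE; move: (v i 0) (g i 0) => a b; rewrite -subr_ge0.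
have -> : (1 + th) * (a * a) + (1 + th^-1) * (b * b) - (a + b) * (a + b) =
    (th * a - b) ^+ 2 / th by field; rewrite gt_eqF.
by rewrite divr_ge0 ?sqr_ge0// ltW.
Qed.

Lemma expR_linear (R : realType) (y : R) : 0 <= y <= 2^-1 -> expR y - 1 <= 2 * y.
Proof.
move=> /andP[y0 y1]; have h := expR_ge1Dx (- y).
have e0 := expR_gt0 y; move: h; rewrite expRN => h.
have : (1 - y) * expR y <= 1.
  by rewrite -[leRHS](mulVf (lt0r_neq0 e0)) ler_pM2r.
move: e0; move: (expR y) => z z0 hz.
suff : z <= 2 by move=> z2; have := ler_wpM2l y0 z2; lra.
have : z * y <= z * 2^-1 by rewrite ler_pM2l.
lra.
Qed.

Section Moments.
Context {R : realType} {n : nat}.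
Variables (F : 'cV[R]_n -> 'cV[R]_n) (sigma : 'M[R]_n).
Hypothesis cF : continuous F.
Context {d : measure_display} {Omega : measurableType d}.
Variables (P : probability Omega R) (W : R -> Omega -> borelV R n).
Hypothesis BM : standard_brownian_motion P W.
Variable (X : 'cV[R]_n -> R -> Omega -> borelV R n).
Hypothesis sol : forall x : 'cV[R]_n, sde_solution P F sigma W x (X x).
Variables (K C : R).
Hypothesis K1 : 1 <= K.
Hypothesis sK : forall x : 'cV[R]_n, `|sigma *m x| <= K * `|x|.
Hypothesis qK : forall x : 'cV[R]_n, dotv x x <= K * `|x| ^+ 2.
Hypothesis C0 : 0 <= C.
Hypothesis crude : forall (u g v : R -> 'cV[R]_n) (G H : R -> R) (T : R),
  0 <= T -> driven F u g v ->
  (forall t : R, 0 <= t -> is_derive t (1:R) G `|g t|) -> G 0 = 0 ->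
  (forall t : R, 0 <= t -> is_derive t (1:R) H ((1 + `|g t|) ^+ 3)) -> H 0 = 0 ->
  dotv (v T) (v T) <= expR (C * G T) * (dotv (v 0) (v 0) + C * H T).
Variable c : R.
Hypothesis c0 : 0 < c.
Hypothesis contraction : forall T S : R, 0 < T -> 0 <= S ->
  exists M : R, forall (u g v : R -> 'cV[R]_n) (G : R -> R), driven F u g v ->
  (forall t : R, 0 <= t -> is_derive t (1:R) G `|g t|) -> G 0 = 0 ->
  (forall t, 0 <= t <= T -> `|g t| <= S) ->
  dotv (v T) (v T) <= dotv (v 0) (v 0) * expR (C * G T - c * T) + M.

Let K0 : 0 <= K. Proof. by rewrite (le_trans _ K1). Qed.

(** A version of [sigma W] that is continuous for every [w], set to 0 on a null set, so that its
    primitives exist and the bounds hold for every [w]. *)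
Lemma noise_process : exists g : R -> Omega -> 'cV[R]_n,
  [/\ forall w, continuous (g ^~ w),
      forall t, 0 <= t -> measurable_fun setT (fun w => `|g t w|),
      forall t w, 0 <= t -> `|g t w| <= K * `|(W t w : 'cV[R]_n) - W 0 w| &
      {ae P, forall w, forall t, g t w = sigma *m (W (pos_time t) w : 'cV[R]_n)}].
Proof.
have [_ W0 cW _ _] := BM.
have [N [mN PN0 hN]] : {ae P, forall w, (W 0 w = 0 :> 'cV[R]_n) /\
    continuous (fun t => W (pos_time t) w : 'cV[R]_n)}.
  by apply: filterS2 W0 cW => w w0 /continuous_pos_time cw; split.
have good w : ~ N w -> (W 0 w = 0 :> 'cV[R]_n) /\
    continuous (fun t => W (pos_time t) w : 'cV[R]_n).
  by move=> nN; apply: contrapT => h; apply: nN; exact: hN.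
pose inc t w : 'cV[R]_n := (W t w : 'cV[R]_n) - W 0 w.
exists (fun t w => \1_(~` N) w *: (sigma *m inc (pos_time t) w)); split.
- move=> w; rewrite indicE; case: (boolP (w \in ~` N)) => [|_].
    rewrite inE => /good[w0 cw].
    have -> : (fun t => true%:R *: (sigma *m inc (pos_time t) w)) =
        (fun t => sigma *m (W (pos_time t) w : 'cV[R]_n)).
      by apply/funext => t; rewrite scale1r /inc w0 subr0.
    move=> t; apply: (continuous_comp (f := fun t => W (pos_time t) w : 'cV[R]_n)
      (g := fun x => sigma *m x)); first exact: cw.
    exact: mulmx_continuous.
  under eq_fun do rewrite scale0r; exact: cst_continuous.
- move=> t t0; under eq_fun do rewrite normrZ (pos_timeE t0).
  apply: measurable_funM; first by apply: measurableT_comp => //; apply: measurable_indic; exact: measurableC.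
  under eq_fun do rewrite norm_bigmax.
  elim: (index_enum _) => [|i s IH].
    by under eq_fun do rewrite big_nil; exact: measurable_cst.
  under eq_fun do rewrite big_cons.
  apply: measurable_maxr => //; apply: measurableT_comp => //.
  under eq_fun do rewrite mxE.
  apply: measurable_sum => j; apply: measurable_funM => //.
  exact: (measurable_increment BM j t0).
- move=> t w t0; rewrite normrZ pos_timeE// indicE.
  have h := sK (inc t w); case: (_ \in _); first by rewrite normr1 mul1r.
  by rewrite normr0 mul0r mulr_ge0.
- exists N; split => // w /=; apply: contra_notP => nN; have [w0 cw] := good w nN.
  by move=> t; rewrite indicE mem_set// scale1r /inc w0 subr0.
Qed.

(** Bounds the moment of order [k.+1] of [growth_factor] for all [T <= 1], after its sum and its
    product are split by [powerD_le] and [mulr_le_sqrD]. *)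
Definition growth_const k : R := let emb := @exp_moment_bound R n in
  6 ^+ k.+1 * (emb ((2 * k.+1)%:R * C * K) 1 1 +
     2 ^+ (2 * k.+1) * (1 + C ^+ (2 * k.+1) * emb ((3 * (2 * k.+1))%:R * K) 1 1)) +
    (4 * K) ^+ k.+1 * emb ((2 * k.+1)%:R * K) 1 1.

Section Noise.
Variable g : R -> Omega -> 'cV[R]_n.
Hypothesis cg : forall w, continuous (g ^~ w).
Hypothesis mg : forall t, 0 <= t -> measurable_fun setT (fun w => `|g t w|).
Hypothesis gK : forall t w, 0 <= t -> `|g t w| <= K * `|(W t w : 'cV[R]_n) - W 0 w|.
Variables (G H : R -> Omega -> R).
Hypothesis dG : forall w (t : R), 0 <= t -> is_derive t (1:R) (G ^~ w) `|g t w|.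
Hypothesis G0 : forall w, G 0 w = 0.
Hypothesis dH : forall w (t : R), 0 <= t -> is_derive t (1:R) (H ^~ w) ((1 + `|g t w|) ^+ 3).
Hypothesis H0 : forall w, H 0 w = 0.

Let emb := @exp_moment_bound R n.

Lemma exp_moment_bound_mono b b' t t' th : 0 < th -> 0 <= b <= b' -> 0 <= t <= t' ->
  emb b t th <= emb b' t' th.
Proof.
move=> th0 /andP[b0 bb] /andP[t0 tt]; rewrite /emb /exp_moment_bound lerD2l ler_wpM2l// lerD2l.
rewrite ler_wpM2l// ?invr_ge0 ?mulr_ge0 ?(ltW th0)// lerD2r ler_expR.
apply: ler_pM => //; first by rewrite mulr_ge0// exprn_ge0.
by rewrite ler_pM2l// lerXn2r ?nnegrE// (le_trans b0).
Qed.

Lemma noise_exp_moment a t T th : 0 <= a -> 0 <= t <= T -> 0 < th ->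
  mean_le P (fun w => expR (a * `|g t w|)) (emb (a * K) T th).
Proof.
move=> a0 /andP[t0 tT] th0.
apply: (@mean_le_dom _ _ _ _ _ (fun w => expR (a * K * `|(W t w : 'cV[R]_n) - W 0 w|))).
- by apply: measurableT_comp => //; apply: measurable_funM => //; exact: mg.
- by move=> w; rewrite expR_ge0 ler_expR -mulrA ler_wpM2l// gK.
apply: mean_le_weak (increment_exp_moment BM t0 _ th0); last exact: mulr_ge0.
by apply: exp_moment_bound_mono => //; rewrite ?lexx ?mulr_ge0// t0.
Qed.

Let cn w : continuous (fun t => `|g t w|).
Proof. by move=> t; apply: (@continuous_comp _ _ _ (g ^~ w) (@Num.norm _ 'cV[R]_n)); [exact: cg|exact: norm_continuous]. Qed.

Lemma primitive_exp_moment a T th : 0 <= a -> 0 < T -> 0 < th ->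
  measurable_fun setT (fun w => expR (a * G T w)) /\
  mean_le P (fun w => expR (a * G T w)) (emb (a * T * K) T th).
Proof.
move=> a0 T0 th0.
apply: (@path_average _ _ _ P (fun t w => `|g t w|) G (fun z => expR (a * z))
  (fun m => a * expR (a * m))) => //.
- by move=> m z _ _; exact: expR_tangent.
- move=> z; apply: (continuous_comp (f := fun z => a * z) (g := @expR R)).
    exact: mulrl_continuous.
  exact: continuous_expR.
- move=> t tT; have := noise_exp_moment (mulr_ge0 a0 (ltW T0)) tT th0; congr mean_le.
  by apply/funext => w; rewrite mulrA.
Qed.

Lemma primitive_power_moment k T : 0 < T <= 1 ->
  mean_le P (fun w => H T w ^+ k.+1) (emb ((3 * k.+1)%:R * K) 1 1).
Proof.
move=> /andP[T0 T1].
have [] := @path_average _ _ _ P (fun t w => (1 + `|g t w|) ^+ 3) H (fun z => z ^+ k.+1)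
  (fun m => k.+1%:R * m ^+ k) T (emb ((3 * k.+1)%:R * K) 1 1) => //.
- move=> w t; apply: (continuous_comp (f := fun t => 1 + `|g t w|) (g := fun x => x ^+ 3)).
    by apply: continuousD; [exact: cst_continuous|exact: cn].
  exact: exprn_continuous.
- by move=> m z; exact: power_tangent.
- exact: exprn_continuous.
- by move=> z z0; exact: exprn_ge0.
- move=> t /andP[t0 tT].
  apply: (@mean_le_dom _ _ _ _ _ (fun w => expR ((3 * k.+1)%:R * `|g t w|))).
  + apply: measurable_funX; apply: measurable_funM => //; apply: measurable_funX.
    by apply: measurable_funD => //; exact: mg.
  + move=> w; have h : 0 <= (1 + `|g t w|) ^+ 3 by rewrite exprn_ge0// addr_ge0.
    rewrite exprn_ge0 ?mulr_ge0 ?(ltW T0)//=.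
    apply: (@le_trans _ _ ((1 + `|g t w|) ^+ (3 * k.+1))).
      rewrite exprM lerXn2r ?nnegrE ?mulr_ge0 ?(ltW T0)//.
      by rewrite ler_piMl.
    rewrite expRM_natl lerXn2r ?nnegrE ?addr_ge0 ?expR_ge0//; exact: expR_ge1Dx.
  + by apply: noise_exp_moment => //; rewrite t0 (le_trans tT).
- by move=> t t0; apply: measurable_funX; apply: measurable_funD => //; exact: mg.
Qed.

Let V (x : 'cV[R]_n) : R := 1 + dotv x x.

Let V1 x : 1 <= V x. Proof. by rewrite lerDl dotv_ge0. Qed.

(* Dominates [V (X x T)^p / V(x)^p] uniformly in [x]. *)
Definition growth_factor T w : R :=
  3 * (expR (C * G T w) * (1 + C * H T w)) + 2 * K * `|g T w| ^+ 2.

Let G_ge0 T w : 0 <= T -> 0 <= G T w.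
Proof.
move=> T0; rewrite -(G0 w); apply: (@is_derive_ndecr _ (G ^~ w) (fun s => `|g s w|)) => //.
by move=> s /andP[s0 _]; exact: dG.
Qed.

Let H_ge0 T w : 0 <= T -> 0 <= H T w.
Proof.
move=> T0; rewrite -(H0 w).
apply: (@is_derive_ndecr _ (H ^~ w) (fun s => (1 + `|g s w|) ^+ 3)) => //.
by move=> s /andP[s0 _]; exact: dH.
Qed.

Lemma growth_factor_ge T w : 0 <= T -> 0 <= c * T -> expR (C * G T w - c * T) <= growth_factor T w.
Proof.
move=> T0 cT; apply: (@le_trans _ _ (expR (C * G T w))); first by rewrite ler_expR gerBl.
have e0 := expR_ge0 (C * G T w).
have CH : 0 <= C * H T w by rewrite mulr_ge0// H_ge0.
have : 0 <= 2 * K * `|g T w| ^+ 2 by rewrite !mulr_ge0.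
have : expR (C * G T w) * 1 <= expR (C * G T w) * (1 + C * H T w) by rewrite ler_wpM2l// lerDl.
have : 0 <= expR (C * G T w) * (1 + C * H T w) by rewrite mulr_ge0// addr_ge0.
rewrite /growth_factor; lra.
Qed.

Lemma growth_bound x T w u v : 0 <= T -> driven F u (g ^~ w) v -> v 0 = x ->
  V (u T) <= V x * growth_factor T w.
Proof.
move=> T0 dr v0; have [_ _ uE _] := dr.
have := crude T0 dr (dG w) (G0 w) (dH w) (H0 w); rewrite v0.
have := dotv_add_le (v T) (g T w) ltr01; rewrite -uE// invr1.
have := qK (g T w); rewrite /V /growth_factor.
have := expR_gt1 (C * G T w).
have e1 : 1 <= expR (C * G T w) by rewrite -expR0 ler_expR mulr_ge0// G_ge0.
have h0 : 0 <= C * H T w by rewrite mulr_ge0// H_ge0.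
have n0 : 0 <= K * `|g T w| ^+ 2 by rewrite mulr_ge0.
move: (expR _) (C * H T w) e1 h0 => e h e1 h0 _ h1 h2 h3.
move: n0 h1; rewrite -[2 * K * _]mulrA; move: (K * _) => r r0 h1.
have x0 := dotv_ge0 x; move: (dotv x x) x0 h3 => q q0 h3.
move: h2 h3 h1; move: (dotv (u T) (u T)) (dotv (v T) (v T)) (dotv (g T w) (g T w)) => a b g2 h2 h3 h1.
have p1 : e * (q + h) <= e * ((1 + q) * (1 + h)) by rewrite ler_wpM2l; nra.
have p2 : 1 * (1 * 1) <= e * ((1 + q) * (1 + h)).
  by rewrite !ler_pM// lerDl.
have p3 : r <= (1 + q) * r by nra.
rewrite mulrDr; move: p1 p2 p3.
have -> : (1 + q) * (3 * (e * (1 + h))) = 3 * (e * ((1 + q) * (1 + h))) by ring.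
have -> : (1 + q) * (2 * r) = 2 * ((1 + q) * r) by ring.
lra.
Qed.

Lemma growth_moment k T : 0 < T <= 1 -> measurable_fun setT (growth_factor T) ->
  mean_le P (fun w => growth_factor T w ^+ k.+1) (growth_const k).
Proof.
set p := k.+1; move=> T01 mD; have /andP[T0 T1] := T01.
have T00 := ltW T0.
apply: (@mean_le_dom _ _ _ _ _ (fun w =>
   6 ^+ p * (expR ((2 * p)%:R * C * G T w) +
     2 ^+ (2 * p) * (1 + C ^+ (2 * p) * H T w ^+ (2 * p))) +
    (4 * K) ^+ p * expR ((2 * p)%:R * `|g T w|))).
- exact: measurable_funX.
- move=> w; have e0 := expR_ge0 (C * G T w).
  have h0 : 0 <= C * H T w by rewrite mulr_ge0// H_ge0.
  have h1 : 0 <= 1 + C * H T w by rewrite addr_ge0.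
  have a0 : 0 <= 3 * (expR (C * G T w) * (1 + C * H T w)) by rewrite !mulr_ge0.
  have b0 : 0 <= 2 * K * `|g T w| ^+ 2 by rewrite !mulr_ge0.
  rewrite exprn_ge0 ?addr_ge0//=.
  apply: le_trans (powerD_le p a0 b0) _; rewrite mulrDr -!exprMn; apply: lerD.
    rewrite (_ : 2 * (3 * _) = 6 * (expR (C * G T w) * (1 + C * H T w))); last by ring.
    rewrite [leLHS]exprMn ler_wpM2l ?exprn_ge0// [leLHS]exprMn.
    apply: le_trans (mulr_le_sqrD _ _) _; rewrite -!exprM ![(p * 2)%N]mulnC; apply: lerD.
      by rewrite -expRM_natl mulrA.
    apply: le_trans (powerD_le _ ler01 h0) _.
    by rewrite expr1n exprMn.
  have -> : 2 * (2 * K * `|g T w| ^+ 2) = (4 * K) * `|g T w| ^+ 2 by ring.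
  rewrite exprMn ler_wpM2l ?exprn_ge0 ?mulr_ge0// -exprM expRM_natl lerXn2r ?nnegrE ?expR_ge0//.
  by apply: le_trans (expR_ge1Dx _); rewrite lerDr.
have K4 : 0 <= 4 * K by rewrite mulr_ge0.
apply: mean_le_add; apply: mean_le_scale; rewrite ?exprn_ge0//; last first.
  by apply: noise_exp_moment => //; rewrite T00.
apply: mean_le_add.
  have pC0 : 0 <= (2 * p)%:R * C by rewrite mulr_ge0.
  have [_] := primitive_exp_moment pC0 T0 ltr01.
  apply: mean_le_weak; apply: exp_moment_bound_mono => //; last by rewrite T00.
  rewrite !mulr_ge0//=; rewrite -!mulrA ler_wpM2l// ler_wpM2l//.
  by rewrite ler_piMl.
apply: mean_le_scale; first exact: exprn_ge0.
apply: mean_le_add; first exact: mean_le_cst.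
apply: mean_le_scale; first exact: exprn_ge0.
by have := primitive_power_moment (2 * k.+1).-1 T01.
Qed.

Lemma measurable_growth_factor T : 0 < T <= 1 -> measurable_fun setT (growth_factor T) /\
  measurable_fun setT (fun w => expR (C * G T w)).
Proof.
move=> T01; have /andP[T0 T1] := T01.
have [mG _] := primitive_exp_moment C0 T0 ltr01.
have [iH _] := primitive_power_moment 0 T01.
have mH : measurable_fun setT (H T) by apply/measurable_EFinP; exact: measurable_int iH.
have mg' := mg (ltW T0).
split => //; apply: measurable_funD.
  apply: measurable_funM => //; apply: measurable_funM => //.
  by apply: measurable_funD => //; exact: measurable_funM.
by apply: measurable_funM => //; exact: measurable_funX.
Qed.

End Noise.

Let V (x : 'cV[R]_n) : R := 1 + dotv x x.

Let V1 x : 1 <= V x. Proof. by rewrite lerDl dotv_ge0. Qed.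

Let V0 x : 0 < V x. Proof. exact: lt_le_trans (V1 x). Qed.

Lemma mesh_small (e : R) : 0 < e -> exists m, mesh m <= e :> R.
Proof.
move=> e0; have : (fun m => mesh m : R) @ \oo --> (0 : R).
  by apply: cvg_expr; rewrite ger0_norm// invf_lt1// ltr1n.
by move=> /cvgrPdist_le/(_ _ e0)[m _ /(_ m (leqnn m))]; rewrite sub0r normrN => /ler_normlP[_ h]; exists m.
Qed.

(* The exponential moment is [1 + o(T)] and the contraction factor [1 - k T + o(T)];
   [th] is taken of order [T]. *)
Lemma contraction_time a k : 0 <= a -> 0 < k -> exists m th, 0 < th /\
  @exp_moment_bound R n (a * mesh m * K) (mesh m) th * expR (- (k * mesh m)) < 1.
Proof.
move=> a0 k0; set s := a * K.
have s0 : 0 <= s by rewrite mulr_ge0.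
(* With [th = e * T] the term [n * th] is at most [k T / 4]. The third bound on [mesh m] below gives
   as much for the other term, of order [T^2], so the moment is at most [1 + k T / 2]. *)
pose e := k / (4 * n.+1%:R).
have n0 : (0 : R) < n.+1%:R by rewrite ltr0n.
have e0 : 0 < e by rewrite divr_gt0// mulr_gt0.
have [m hm] : exists m, mesh m <= Num.min 1 (Num.min (4 * s ^+ 2 + 1)^-1 (k * e / (8 * n%:R * s ^+ 2 + 1))) :> R.
  have s20 : 0 <= s ^+ 2 by exact: sqr_ge0.
  apply: mesh_small; rewrite !lt_min ltr01 invr_gt0 divr_gt0 ?mulr_gt0// ltr_wpDl// !mulr_ge0//.
have T0 : (0 : R) < mesh m by exact: mesh_gt0.
move: hm T0; rewrite !le_min; set T := mesh m => /and3P[T1 T2 T3] T0.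
exists m, (e * T); split; first by rewrite mulr_gt0.
have s2 : 0 <= s ^+ 2 by exact: sqr_ge0.
have c1 : 4 * s ^+ 2 * T <= 1.
  move: T2; rewrite -[leRHS]mul1r ler_pdivlMr; last by rewrite ltr_wpDl// mulr_ge0.
  by rewrite mulrDr mulr1 mulrC; apply: le_trans; rewrite lerDl ltW.
have c2 : 8 * n%:R * s ^+ 2 * T <= k * e.
  move: T3; rewrite ler_pdivlMr; last by rewrite ltr_wpDl// !mulr_ge0.
  by rewrite mulrDr mulr1 mulrC; apply: le_trans; rewrite lerDl ltW.
have y0 : 0 <= 2 * (a * T * K) ^+ 2 * T <= 2^-1.
  rewrite !mulr_ge0 ?sqr_ge0 ?(ltW T0)//=.
  have -> : 2 * (a * T * K) ^+ 2 * T = (4 * s ^+ 2 * T) * T ^+ 2 / 2 by rewrite /s; field.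
  rewrite ler_pdivrMr// mulVf//; apply: mulr_ile1 => //.
  - by rewrite !mulr_ge0// ltW.
  - exact: sqr_ge0.
  - by rewrite exprn_ile1// ltW.
have emb_le : @exp_moment_bound R n (a * T * K) T (e * T) <= 1 + k * T / 2.
  rewrite /exp_moment_bound lerD2l.
  apply: (@le_trans _ _ (n%:R * (e * T + (2 * (e * T))^-1 * (2 * (2 * (a * T * K) ^+ 2 * T))))).
    have i0 : 0 <= (2 * (e * T))^-1 by rewrite invr_ge0 ltW// !mulr_gt0.
    apply: ler_wpM2l => //; rewrite lerD2l; apply: (ler_wpM2l i0); exact: expR_linear.
  have -> : n%:R * (e * T + (2 * (e * T))^-1 * (2 * (2 * (a * T * K) ^+ 2 * T))) =
    n%:R * e * T + (8 * n%:R * s ^+ 2 * T) * T / (4 * e).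
    by rewrite /s; field; rewrite (gt_eqF T0) (gt_eqF e0).
  have -> : k * T / 2 = k * T / 4 + k * e * T / (4 * e) by field; rewrite (gt_eqF e0).
  apply: lerD.
    rewrite [leRHS]mulrAC ler_wpM2r ?(ltW T0)//.
    have gen (i : R) : 0 < i -> k / 4 = i * (k / (4 * i)) by move=> i0; field; rewrite gt_eqF.
    rewrite (gen _ n0) -/e.
    by rewrite ler_pM2r// ler_nat.
  have e4 : 0 <= (4 * e)^-1 by rewrite invr_ge0 ltW// mulr_gt0.
  by apply: (ler_wpM2r e4); apply: (ler_wpM2r (ltW T0)).
have kT : 0 < k * T by rewrite mulr_gt0.
apply: (@le_lt_trans _ _ (expR (k * T / 2) * expR (- (k * T)))).
  by rewrite ler_wpM2r ?expR_ge0// (le_trans emb_le)// expR_ge1Dx.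
by rewrite -expRD -[ltRHS]expR0 ltr_expR; move: kT; lra.
Qed.

Lemma primitive_from0 (f : R -> R) : continuous f ->
  exists G : R -> R, (forall t : R, 0 <= t -> is_derive t (1:R) G (f t)) /\ G 0 = 0.
Proof.
move=> /continuous_primitive[G dG _]; exists (fun t => G t - G 0); split; last by rewrite subrr.
move=> t t0; have := dG t t0 => h; rewrite -[f t]subr0.
exact: is_deriveB.
Qed.

Lemma noise_with_primitives : exists (g : R -> Omega -> 'cV[R]_n) (G H : R -> Omega -> R),
  [/\ [/\ forall w, continuous (g ^~ w),
      forall t, 0 <= t -> measurable_fun setT (fun w => `|g t w|),
      forall t w, 0 <= t -> `|g t w| <= K * `|(W t w : 'cV[R]_n) - W 0 w| &
      forall x, {ae P, forall w, exists u v, [/\ driven F u (g ^~ w) v, v 0 = x,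
         forall t, 0 <= t -> u t = X x t w & X x 0 w = x]}],
    forall w (t : R), 0 <= t -> is_derive t (1:R) (G ^~ w) `|g t w|, forall w, G 0 w = 0,
    forall w (t : R), 0 <= t -> is_derive t (1:R) (H ^~ w) ((1 + `|g t w|) ^+ 3) &
    forall w, H 0 w = 0].
Proof.
have [g [cg mg gK gE]] := noise_process.
have cn w : continuous (fun t => `|g t w|).
  by move=> t; apply: (@continuous_comp _ _ _ (g ^~ w) (@Num.norm _ 'cV[R]_n)); [exact: cg|exact: norm_continuous].
have /choice[G hG] : forall w, exists G : R -> R,
    (forall t : R, 0 <= t -> is_derive t (1:R) G `|g t w|) /\ G 0 = 0.
  by move=> w; exact: primitive_from0.
have /choice[H hH] : forall w, exists H : R -> R,
    (forall t : R, 0 <= t -> is_derive t (1:R) H ((1 + `|g t w|) ^+ 3)) /\ H 0 = 0.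
  move=> w; apply: (@primitive_from0 (fun t => (1 + `|g t w|) ^+ 3)) => t.
  apply: (continuous_comp (f := fun t => 1 + `|g t w|) (g := fun x => x ^+ 3)).
    by apply: continuousD; [exact: cst_continuous|exact: cn].
  exact: exprn_continuous.
exists g, (fun t w => G w t), (fun t w => H w t); split.
- split => // x; apply: filterS2 gE (solution_driven cF BM sol x) => w gE [v [dr v0 _ u0]].
  exists (fun t => X x (pos_time t) w), v; split => //.
  + by rewrite (_ : g ^~ w = fun t => sigma *m (W (pos_time t) w : 'cV[R]_n))//; apply/funext.
  + by move=> t t0; rewrite pos_timeE.
  + by rewrite -[RHS]u0 pos_timeE.
- by move=> w t t0; have [+ _] := hG w; apply.
- by move=> w; have [] := hG w.
- by move=> w t t0; have [+ _] := hH w; apply.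
- by move=> w; have [] := hH w.
Qed.

Lemma V_continuous : continuous V.
Proof.
apply: (@locally_lipschitz_continuous _ 'cV[R]_n R) => x; exists (n%:R * (2 * (`|x| + 1))) => y xy.
have -> : V x - V y = dotv (x - y) (x + y).
  rewrite /V opprD addrACA subrr add0r.
  by rewrite /dotv -sumrB; apply: eq_bigr => i _; rewrite !mxE; ring.
apply: le_trans (dotv_le_norm _ _) _; rewrite -mulrA ler_wpM2l// mulrC ler_wpM2r//.
have : `|y| <= `|x| + 1.
  by rewrite -[y](subrK x) addrC (le_trans (ler_normD _ _))// lerD2l distrC.
by have := ler_normD x y; lra.
Qed.

Lemma Vpower_continuous k : continuous (fun x => V x ^+ k).
Proof.
move=> x; apply: (continuous_comp (f := V) (g := fun y => y ^+ k)); first exact: V_continuous.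
exact: exprn_continuous.
Qed.

Lemma moment_growth k : exists2 L, 0 <= L & forall T x, 0 <= T <= 1 ->
  mean_le P (fun w => V (X x T w) ^+ k.+1) (L * V x ^+ k.+1).
Proof.
have [g [G [H [[cg mg gK dr] dG G0 dH H0]]]] := noise_with_primitives.
exists (Num.max 1 (growth_const k)); first by rewrite le_max ler01.
move=> T x /andP[]; rewrite le_eqVlt => /predU1P[<- _|T0 T1].
  apply: (@mean_le_dom_ae _ _ _ _ _ (fun=> V x ^+ k.+1)).
  - by apply: (measurable_solution sol (f := fun y => V y ^+ k.+1)) => //; exact: Vpower_continuous.
  - apply: filterS (dr x) => w [u [v [_ _ _ ->]]].
    by rewrite lexx exprn_ge0// ltW.
  - apply: mean_le_weak (mean_le_cst P _).
    by rewrite ler_peMl ?exprn_ge0 ?(ltW (V0 x))// le_max lexx.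
have T01 : 0 < T <= 1 by rewrite T0.
have [mD _] := measurable_growth_factor cg mg gK dG G0 dH H0 T01.
have gm := growth_moment cg mg gK dG G0 dH H0 k T01 mD.
have Vx : 0 <= V x ^+ k.+1 by rewrite exprn_ge0// ltW.
apply: (@mean_le_dom_ae _ _ _ _ _ (fun w => V x ^+ k.+1 * growth_factor g G H T w ^+ k.+1)).
- by apply: (measurable_solution sol (f := fun y => V y ^+ k.+1)); [exact: ltW|exact: Vpower_continuous].
- apply: filterS (dr x) => w [u [v [dru v0 uX _]]].
  rewrite exprn_ge0 ?(ltW (V0 _))//= -exprMn lerXn2r ?nnegrE ?(ltW (V0 _))//.
    apply: le_trans (growth_bound dG G0 dH H0 (ltW T0) dru v0); exact: ltW (V0 _).
  by rewrite -uX ?(ltW T0)//; exact: (growth_bound dG G0 dH H0 (ltW T0) dru v0).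
- apply: mean_le_weak (mean_le_scale Vx gm).
  by rewrite mulrC ler_wpM2r// le_max lexx orbT.
Qed.

Lemma dominated_convergence_real (f_ : nat -> Omega -> R) (f D : Omega -> R) :
  (forall k, measurable_fun setT (f_ k)) -> measurable_fun setT f ->
  P.-integrable setT (EFin \o D) ->
  {ae P, forall w, forall k, `|f_ k w| <= D w} ->
  {ae P, forall w, f_ ^~ w @ \oo --> f w} ->
  (\int[P]_w f_ k w)%R @[k --> \oo] --> (\int[P]_w f w)%R.
Proof.
move=> mf_ mf iD fD ae.
have [] := @dominated_convergence _ _ _ P setT measurableT
  (fun k w => (f_ k w)%:E) (fun w => (f w)%:E) (EFin \o D).
- by move=> k; apply/measurable_EFinP.
- exact/measurable_EFinP.
- apply: filterS ae => w cw _; apply: cvg_EFin; [exact: nearW|exact: cw].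
- exact: iD.
- by apply: filterS fD => w h k _; rewrite lee_fin.
move=> intf _ h; rewrite /Rintegral.
apply: fine_cvg; rewrite fineK//; exact: integrable_fin_num.
Qed.

(** The existence of [L] comes from a contradiction, with [gam] strictly between [gam0] and 1: the
    limit of the rescaled moments would be both at least [gam] and at most [gam0]. *)
Lemma moment_drift k : exists m gam L, [/\ 0 <= gam, gam < 1, 0 <= L &
  forall x, mean_le P (fun w => V (X x (mesh m) w) ^+ k.+1) (gam * V x ^+ k.+1 + L)].
Proof.
have [g [G [H [[cg mg gK dr] dG G0 dH H0]]]] := noise_with_primitives.
set p := k.+1.
have pC0 : 0 <= p%:R * C by rewrite mulr_ge0.
have pc0 : 0 < p%:R * c by rewrite mulr_gt0.
have [m [th [th0 lt1]]] := contraction_time pC0 pc0.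
have T0 : (0 : R) < mesh m by exact: mesh_gt0.
have T1 : mesh m <= 1 :> R by rewrite exprn_ile1// invf_le1// ler1n.
move: T0 T1 lt1; set T := mesh m => T0 T1 lt1; have T00 := ltW T0.
have T01 : 0 < T <= 1 by rewrite T0.
have [mD mE] := measurable_growth_factor cg mg gK dG G0 dH H0 T01.
have [iD _] := growth_moment cg mg gK dG G0 dH H0 k T01 mD.
pose E0 w := expR (C * G T w - c * T).
have E00 w : 0 < E0 w by exact: expR_gt0.
have mE0 : measurable_fun setT E0.
  rewrite (_ : E0 = fun w => expR (C * G T w) * expR (- (c * T))).
    exact: measurable_funM.
  by apply/funext => w; rewrite -expRD.
set gam0 := _ * expR (- _) in lt1.
have meanE : mean_le P (fun w => E0 w ^+ p) gam0.
  have [_ h] := primitive_exp_moment cg mg gK dG G0 pC0 T0 th0.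
  have := mean_le_scale (expR_ge0 (- (p%:R * c * T))) h; rewrite [_ * exp_moment_bound _ _ _]mulrC.
  congr mean_le; apply/funext => w; rewrite /E0 -expRM_natl -expRD; congr expR; ring.
have gam00 : 0 <= gam0.
  have [iE] := meanE; apply: le_trans; apply: Rintegral_ge0 => w _.
  by rewrite exprn_ge0// ltW.
(* A sequence of counterexamples [x_ j] tends to infinity, and the rescaled moments at
   [x_ j] converge to the mean of [E0 ^+ p], which is at most [gam0]. *)
exists m, ((1 + gam0) / 2); apply: contrapT => nope.
set gam := (1 + gam0) / 2 in nope.
have gam_0 : 0 <= gam by rewrite divr_ge0// addr_ge0.
have gam_1 : gam < 1 by rewrite ltr_pdivrMr//; lra.
have /choice[x_ hx] : forall j : nat, exists x,
    ~ mean_le P (fun w => V (X x T w) ^+ p) (gam * V x ^+ p + j%:R).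
  move=> j; apply: contrapT => h; apply: nope; exists j%:R; split => // x.
  by apply: contrapT => h'; apply: h; exists x.
have [L L0 hL] := moment_growth k.
have Vp x : 0 < V x ^+ p by rewrite exprn_gt0.
have large j : gam * V (x_ j) ^+ p + j%:R < \int[P]_w V (X (x_ j) T w) ^+ p.
  rewrite ltNge; apply/negP => h; apply: (hx j); split => //.
  by have [] := hL T (x_ j) (introT andP (conj T00 T1)).
(* The moment at [x_ j] exceeds [j] but is at most [L * V (x_ j) ^+ p] by [moment_growth]. *)
have xoo (b : R) : exists N, forall j, (N <= j)%N -> b <= V (x_ j).
  exists (Num.truncn (L * (`|b| ^+ p))).+1 => j hj; rewrite leNgt; apply/negP => lt.
  have [_ h1] : mean_le P (fun w => V (X (x_ j) T w) ^+ p) (L * V (x_ j) ^+ p) by apply: hL; rewrite T00.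
  have h2 := large j; have h3 := mulr_ge0 gam_0 (ltW (Vp (x_ j))).
  have h4 : L * V (x_ j) ^+ p <= L * `|b| ^+ p.
    rewrite ler_wpM2l// lerXn2r ?nnegrE ?(ltW (V0 _))//.
    by rewrite (le_trans (ltW lt))// ler_norm.
  have h5 := truncnS_gt (L * `|b| ^+ p).
  have h6 : (Num.truncn (L * (`|b| ^+ p))).+1%:R <= j%:R :> R by rewrite ler_nat.
  by move: h1 h2 h3 h4 h5 h6; lra.
(* The quotient is only asymptotically at most [E0]; the maximum turns this into convergence to
   [E0], to which dominated convergence applies. *)
pose z j w := Num.max (V (X (x_ j) T w) / V (x_ j)) (E0 w) ^+ p.
have mV j : measurable_fun setT (fun w => V (X (x_ j) T w)).
  by apply: (measurable_solution sol (f := V)); [exact: ltW|exact: V_continuous].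
have mz j : measurable_fun setT (z j).
  by apply: measurable_funX; apply: measurable_maxr => //; exact: measurable_funM.
have aedr : {ae P, forall w, forall j, exists u v, [/\ driven F u (g ^~ w) v, v 0 = x_ j,
         forall t, 0 <= t -> u t = X (x_ j) t w & X (x_ j) 0 w = x_ j]}.
  by apply/ae_foralln => j; exact: dr.
have cvgz : \int[P]_w z j w @[j --> \oo] --> \int[P]_w E0 w ^+ p.
  apply: (@dominated_convergence_real _ _ (fun w => growth_factor g G H T w ^+ p)) => //.
  - exact: measurable_funX.
  - apply: filterS aedr => w hw j; have [u [v [dru v0 uX _]]] := hw j.
    have gb := growth_bound dG G0 dH H0 T00 dru v0; rewrite uX// in gb.
    have m0 : 0 <= Num.max (V (X (x_ j) T w) / V (x_ j)) (E0 w) by rewrite le_max (ltW (E00 w)) orbT.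
    have m1 : Num.max (V (X (x_ j) T w) / V (x_ j)) (E0 w) <= growth_factor g G H T w.
      rewrite ge_max ler_pdivrMr// mulrC gb /=.
      by apply: (growth_factor_ge G dH H0) => //; exact: mulr_ge0 (ltW c0) _.
    by rewrite ger0_norm ?exprn_ge0// lerXn2r ?nnegrE// (le_trans m0).
  - apply: filterS aedr => w hw.
    suff h : (fun j => Num.max (V (X (x_ j) T w) / V (x_ j)) (E0 w)) @ \oo --> E0 w.
      exact: (cvg_comp _ _ h (@exprn_continuous R p (E0 w))).
    have [S S0 gS] := continuous_bounded_segment T (cg w).
    have [M hM] := contraction T0 S0.
    apply/cvgrPdist_le => e e0.
    (* Makes [t * E0 w] at most [e / 2]; the other half pays for [r], which collects the terms that
       stay bounded as [j] grows. *)
    pose t := e / (2 * (E0 w + 1)).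
    have E1 : 0 < E0 w + 1 by rewrite addr_gt0.
    have t0 : 0 < t by rewrite divr_gt0// mulr_gt0.
    pose r := 1 + (1 + t) * `|M| + (1 + t^-1) * dotv (g T w) (g T w).
    have [N hN] := xoo (2 * r / e); exists N => // j /= /hN hj.
    have [u [v [dru v0 uX _]]] := hw j.
    have h1 := hM _ _ _ _ dru (dG w) (G0 w) gS; rewrite v0 -/(E0 w) in h1.
    have h2 := dotv_add_le (v T) (g T w) t0.
    have [_ _ uE _] := dru; rewrite -uE// uX// in h2.
    have rV : r <= e / 2 * V (x_ j).
      by move: hj; rewrite ler_pdivrMr// mulrC; lra.
    have tE : t * E0 w <= e / 2.
      have -> : e / 2 = t * (E0 w + 1) by rewrite /t; field; rewrite gt_eqF.
      by rewrite ler_pM2l// lerDl.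
    have h3 : V (X (x_ j) T w) <= (E0 w + e) * V (x_ j).
      have h4 : (1 + t) * dotv (v T) (v T) <= (1 + t) * (V (x_ j) * E0 w + `|M|).
        rewrite ler_pM2l ?addr_gt0//; apply: le_trans h1 _; apply: lerD; last exact: ler_norm.
        by rewrite ler_pM2r// /V lerDr.
      have h5 := ler_wpM2r (ltW (V0 (x_ j))) tE.
      rewrite {1}/V; move: h2 h4 h5 rV; rewrite /r; lra.
    have h4 : V (X (x_ j) T w) / V (x_ j) <= E0 w + e by rewrite ler_pdivrMr.
    rewrite distrC ger0_norm ?subr_ge0 ?le_max ?lexx ?orbT//.
    by rewrite lerBlDl ge_max h4 lerDl ltW.
have lim_ge : gam <= \int[P]_w E0 w ^+ p.
  apply: (@closed_cvg _ _ _ eventually_filter (fun j => \int[P]_w z j w) [set y | gam <= y]) cvgz.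
    exact: closed_ge.
  apply: nearW => j /=; have lj := large j.
  have [iV _] : mean_le P (fun w => V (X (x_ j) T w) ^+ p) (L * V (x_ j) ^+ p) by apply: hL; rewrite T00.
  apply: (@le_trans _ _ (\int[P]_w ((V (x_ j) ^+ p)^-1 * V (X (x_ j) T w) ^+ p))).
    rewrite RintegralZl// mulrC ler_pdivlMr//; apply: ltW; apply: le_lt_trans lj.
    by rewrite lerDl.
  apply: le_Rintegral => //.
  - exact: (integrableZl measurableT _ iV).
  - have V0' : 0 <= (V (x_ j) ^+ p)^-1 by rewrite invr_ge0 ltW.
    have hV : mean_le P (fun w => V (X (x_ j) T w) ^+ p) (L * V (x_ j) ^+ p) by apply: hL; rewrite T00.
    have [] := mean_le_dom (mz j) _ (mean_le_add (mean_le_scale V0' hV) meanE) => // w.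
    have a0 : 0 <= V (X (x_ j) T w) / V (x_ j) by rewrite divr_ge0// ltW.
    have -> : (V (x_ j) ^+ p)^-1 * V (X (x_ j) T w) ^+ p = (V (X (x_ j) T w) / V (x_ j)) ^+ p.
      by rewrite mulrC -exprVn -exprMn.
    rewrite /z exprn_ge0 ?le_max ?a0//= /Num.max; case: ifP => _.
      by rewrite lerDr exprn_ge0.
    by rewrite lerDl exprn_ge0// ltW.
  - move=> w _; rewrite /z mulrC -exprVn -exprMn lerXn2r ?nnegrE ?divr_ge0 ?(ltW (V0 _))//.
      by rewrite le_max (ltW (E00 w)) orbT.
    by rewrite le_max lexx.
have [_ h] := meanE; move: (le_trans lim_ge h); rewrite /gam; move: lt1; lra.
Qed.

End Moments.

(** * Krylov-Bogoliubov averages *)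

Lemma ultrafilter_bounded_cvg (R : realType) (U : set_system nat) (u : nat -> R) (M : R) :
  UltraFilter U -> (forall k, `|u k| <= M) -> exists l : R, u @ U --> l.
Proof.
move=> UU uM.
have segM : (u @ U) `[- M, M]%classic.
  by apply: nearW => k /=; rewrite in_itv /= -ler_norml.
have [p [_ clp]] := @segment_compact R (- M) M (u @ U) _ segM.
exists p => B pB; have [//|UnB] := in_ultra_setVsetC (u @^-1` B) UU.
by have [y [nBy By]] := clp (~` B) B UnB pB.
Qed.

(** One ultrafilter serves all test functions at once, so the limit is a functional on all of [Cb]
    without extracting subsequences. *)
Lemma ultralimit (R : realType) (n : nat) (a : ('cV[R]_n -> R) -> nat -> R) :
  (forall f, Cb f -> exists M, forall N, `|a f N| <= M) ->
  exists (U : set_system nat) (L : ('cV[R]_n -> R) -> R),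
  [/\ ProperFilter U, \oo `<=` U & forall f, Cb f -> a f @ U --> L f].
Proof.
move=> aM; have [U [UU ooU]] := @ultraFilterLemma nat \oo _.
have /choice[L hL] : forall f, exists l : R, Cb f -> a f @ U --> l.
  move=> f; have [bf|nbf] := pselect (Cb f); last by exists 0.
  have [M hM] := aM f bf; have [l hl] := ultrafilter_bounded_cvg UU hM.
  by exists l.
by exists U, L; split => //; exact: ultra_proper.
Qed.

Section StationaryMeasure.
Context {R : realType} {n : nat} {d : measure_display} {Omega : measurableType d}.
Variables (P : probability Omega R) (X : 'cV[R]_n -> R -> Omega -> borelV R n).
Let V (x : 'cV[R]_n) : R := 1 + dotv x x.
Let S := semi P X.
Hypothesis mX : forall x t, 0 <= t -> measurable_fun setT (X x t).
Hypothesis cV : continuous V.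
Hypothesis sCb : forall b i f, Cb f -> Cb (S (i%:R * mesh b) f).
Hypothesis smk : forall b i j f x, Cb f ->
  S ((i + j)%:R * mesh b) f x = S (i%:R * mesh b) (S (j%:R * mesh b) f) x.
Hypothesis stc : forall f x (t : R) (t_ : nat -> R), Cb f -> 0 <= t -> (forall k, 0 <= t_ k) ->
  t_ @ \oo --> t -> S (t_ k) f x @[k --> \oo] --> S t f x.
Hypothesis growth : forall k, exists2 L, 0 <= L & forall T x, 0 <= T <= 1 ->
  mean_le P (fun w => V (X x T w) ^+ k.+1) (L * V x ^+ k.+1).
Hypothesis contract : forall k, exists m gam L, [/\ 0 <= gam, gam < 1, 0 <= L &
  forall x, mean_le P (fun w => V (X x (mesh m) w) ^+ k.+1) (gam * V x ^+ k.+1 + L)].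

Let V1 x : 1 <= V x. Proof. by rewrite lerDl dotv_ge0. Qed.

Let time_ge0 i b : 0 <= i%:R * mesh b :> R.
Proof. by rewrite mulr_ge0// ltW// mesh_gt0. Qed.

Let mfX (f : 'cV[R]_n -> R) x t : 0 <= t -> continuous f ->
  measurable_fun setT (fun w => f (X x t w)).
Proof. by move=> t0 cf; exact: (measurableT_comp (borel_measurable_continuous cf) (mX x t0)). Qed.

Lemma semi_bounded f M x t : 0 <= t -> continuous f -> (forall y, `|f y| <= M) -> `|S t f x| <= M.
Proof. by move=> t0 cf fM; apply: Rintegral_le_bound => //; exact: mfX. Qed.

Lemma semi_integrable f x t : 0 <= t -> Cb f -> P.-integrable setT (EFin \o (fun w => f (X x t w))).
Proof.
by move=> t0 [cf [M fM]]; apply: (@bounded_integrable _ _ _ P _ M) => //; exact: mfX.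
Qed.

Lemma semi_le f h c x t : 0 <= t -> Cb f -> (forall y, f y <= h y) ->
  mean_le P (fun w => h (X x t w)) c -> S t f x <= c.
Proof.
move=> t0 bf fh [ih hc]; apply: le_trans hc; apply: le_Rintegral => //.
exact: semi_integrable.
Qed.

Definition truncated_power k (M : R) (x : 'cV[R]_n) : R := Num.min (V x ^+ k.+1) M.

Let tp_continuous k M : continuous (truncated_power k M).
Proof.
move=> x; apply: (continuous_comp (f := V) (g := fun y => Num.min (y ^+ k.+1) M)); first exact: cV.
apply: continuous_min; [exact: exprn_continuous|exact: cst_continuous].
Qed.

Lemma truncated_power_Cb k M : 0 <= M -> Cb (truncated_power k M).
Proof.
move=> M0; split; first exact: tp_continuous.
exists M => x; rewrite ger0_norm /truncated_power ?ge_min ?lexx ?orbT//.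
by rewrite le_min M0 exprn_ge0// (le_trans _ (V1 x)).
Qed.

(** The Markov property is available on bounded continuous functions, so the drift condition is
    iterated on truncated powers, with bounds independent of the truncation [M]. *)
Lemma semi_truncated_le k : exists (m : nat) (C : R), 0 <= C /\ forall b i M, (m <= b)%N -> 0 <= M ->
  S (i%:R * mesh b) (truncated_power k M) 0 <= C.
Proof.
have [L L0 hL] := growth k; have [m [gam [L' [g0 g1 L'0 hL']]]] := contract k.
(* The fixed point of [y |-> gam * y + L'], towards which the iterated bound relaxes
   geometrically. *)
pose a := L' / (1 - gam).
have g1' : 0 < 1 - gam by rewrite subr_gt0.
have a0 : 0 <= a by rewrite divr_ge0// ltW.
have aE : L' = a * (1 - gam) by rewrite /a divfK// gt_eqF.
clearbody a.
have claim j M x : 0 <= M ->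
    S (j%:R * mesh m) (truncated_power k M) x <= L * (gam ^+ j * V x ^+ k.+1 + a * (1 - gam ^+ j)).
  move=> M0; have bt := truncated_power_Cb k M0.
  elim: j x => [|j IH] x.
    rewrite mul0r expr0 mul1r subrr mulr0 addr0.
    apply: (semi_le (h := fun y => V y ^+ k.+1)) => //; last by apply: hL; rewrite lexx ler01.
    by move=> y; rewrite /truncated_power ge_min lexx.
  rewrite -[j.+1]add1n smk//.
  apply: (semi_le (h := fun y => L * (gam ^+ j * V y ^+ k.+1 + a * (1 - gam ^+ j)))) => //.
    exact: sCb.
  apply: (@mean_le_weak _ _ _ _ _ (L * (gam ^+ j * (gam * V x ^+ k.+1 + L') + a * (1 - gam ^+ j)))).
    by rewrite ler_wpM2l// add1n [gam ^+ j.+1]exprS aE le_eqVlt; apply/orP; left; apply/eqP; ring.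
  apply: mean_le_scale => //; apply: mean_le_add; last exact: mean_le_cst.
  apply: mean_le_scale; first exact: exprn_ge0.
  by rewrite mul1r; exact: hL'.
exists m, (L * (L + a)); split; first by rewrite mulr_ge0// addr_ge0.
move=> b i M mb M0; have bt := truncated_power_Cb k M0.
(* Euclidean division by [q] splits the time into full steps [mesh m], handled by [claim], and a
   remainder below 1, handled by [growth]. *)
pose q := (2 ^ (b - m))%N.
have q0 : (0 < q)%N by rewrite expn_gt0.
have qm : q%:R * mesh b = mesh m :> R.
  by have := @refine_time R m b 1 mb; rewrite /refine mul1n mul1r.
rewrite (divn_eq i q) addnC smk//.
have jm : ((i %/ q) * q)%:R * mesh b = (i %/ q)%:R * mesh m :> R by rewrite natrM -mulrA qm.
rewrite jm; have /andP[r0 r1] : (0 : R) <= (i %% q)%:R * mesh b <= (1 : R).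
  rewrite time_ge0 /=; apply: (@le_trans _ _ (q%:R * mesh b)).
    by rewrite ler_pM2r ?mesh_gt0// ler_nat ltnW// ltn_mod.
  by rewrite qm exprn_ile1// invf_le1// ler1n.
apply: (semi_le (h := fun y => L * (V y ^+ k.+1 + a))) => //.
- exact: sCb.
- move=> y; apply: le_trans (claim _ _ _ M0) _; rewrite ler_wpM2l//.
  have gj0 : 0 <= gam ^+ (i %/ q) by exact: exprn_ge0.
  have gj1 : gam ^+ (i %/ q) <= 1 by rewrite exprn_ile1// ltW.
  apply: lerD; first by rewrite ler_piMl// exprn_ge0// (le_trans _ (V1 y)).
  by rewrite ler_piMr// lerBlDr lerDl.
- apply: mean_le_scale => //; apply: mean_le_add; last exact: mean_le_cst.
  have -> : L = L * V 0 ^+ k.+1 by rewrite /V /dotv big1 ?addr0 ?expr1n ?mulr1// => j _; rewrite !mxE mul0r.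
  by apply: hL; rewrite r0.
Qed.

(** Samples at spacing [1 / 2 ^ N] up to time [2 ^ N]: the horizon grows while the grid refines, so
    each dyadic time is eventually a multiple of the step. *)
Let average f N : R := (4 ^ N)%:R^-1 * \sum_(j < 4 ^ N) S (j%:R * mesh N) f 0.

Let average_le f N c : (forall j : nat, S (j%:R * mesh N) f 0 <= c) -> average f N <= c.
Proof.
move=> h; rewrite /average ler_pdivrMl ?ltr0n ?expn_gt0//.
apply: (@le_trans _ _ (\sum_(j < 4 ^ N) c)); first by apply: ler_sum => j _; exact: h.
by rewrite sumr_const card_ord -[c *+ _]mulr_natl.
Qed.

Let average_bounded f : Cb f -> exists M, forall N, `|average f N| <= M.
Proof.
move=> [cf [M fM]]; exists M => N; rewrite /average normrM ger0_norm ?invr_ge0//.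
rewrite ler_pdivrMl ?ltr0n ?expn_gt0//; apply: le_trans (ler_norm_sum _ _ _) _.
apply: (@le_trans _ _ (\sum_(j < 4 ^ N) M)); first by apply: ler_sum => j _; exact: semi_bounded.
by rewrite sumr_const card_ord -[M *+ _]mulr_natl.
Qed.

Let shift_sum (u : nat -> R) M k i : (forall j, `|u j| <= M) ->
  `|\sum_(j < k) u (i + j)%N - \sum_(j < k) u j| <= i%:R * (2 * M).
Proof.
move=> uM; elim: i => [|i IH]; first by rewrite mul0r subrr normr0.
have -> : \sum_(j < k) u (i.+1 + j)%N = \sum_(j < k) u (i + j)%N + u (i + k)%N - u i.
  elim: k {IH} => [|k IH]; first by rewrite !big_ord0 addn0 add0r subrr.
  rewrite !big_ord_recr /= IH addnS addSn; ring.
have -> : \sum_(j < k) u (i + j)%N + u (i + k)%N - u i - \sum_(j < k) u j =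
   (\sum_(j < k) u (i + j)%N - \sum_(j < k) u j) + (u (i + k)%N - u i) by ring.
apply: le_trans (ler_normD _ _) _; rewrite -natr1 mulrDl mul1r; apply: lerD => //.
apply: le_trans (ler_normB _ _) _; rewrite mulr2n mulrDl !mul1r; exact: lerD.
Qed.

(** Evolving for a time [i / 2 ^ b] shifts the sum by [i * 2 ^ (N - b)] places out of [4 ^ N], and
    each place costs at most [2 M]. *)
Let average_invariant f b i : Cb f ->
  (fun N => average (S (i%:R * mesh b) f) N - average f N) @ \oo --> (0 : R).
Proof.
move=> bf; have [cf [M fM]] := bf.
have M0 : 0 <= M by apply: le_trans (fM 0).
have c2 : (fun N => i%:R * (2 * M) * mesh N : R) @ \oo --> (0 : R).
  rewrite -[X in _ --> X](mulr0 (i%:R * (2 * M))); apply: (@cvgM R _ _ _ (fun=> i%:R * (2 * M)) (fun N => mesh N)); first exact: cvg_cst.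
  by apply: cvg_expr; rewrite ger0_norm// invf_lt1// ltr1n.
apply/norm_cvg0P; apply: (squeeze_cvgr _ (cvg_cst 0) c2).
exists b => // N /= bN; rewrite normr_ge0 /=.
rewrite /average -mulrBr -(refine_time i bN).
have -> : \sum_(j < 4 ^ N) S (j%:R * mesh N) (S ((refine b N i)%:R * mesh N) f) 0 =
    \sum_(j < 4 ^ N) S ((refine b N i + j)%:R * mesh N) f 0.
  by apply: eq_bigr => j _; rewrite addnC smk.
rewrite normrM ger0_norm ?invr_ge0//.
have h := @shift_sum (fun j => S (j%:R * mesh N) f 0) M (4 ^ N) (refine b N i)
  (fun j => semi_bounded 0 (time_ge0 j N) cf fM).
rewrite ler_pdivrMl ?ltr0n ?expn_gt0//; apply: le_trans h _.
have h4 : (4 ^ N)%:R * mesh N = (2 ^ N)%:R :> R.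
  rewrite /mesh -[4%N]/(2 * 2)%N expnMn natrM -mulrA natrX -exprMn divff ?pnatr_eq0//.
  by rewrite expr1n mulr1.
have -> : (4 ^ N)%:R * (i%:R * (2 * M) * mesh N) = i%:R * (2 ^ N)%:R * (2 * M).
  by rewrite -h4; ring.
rewrite ler_wpM2r ?mulr_ge0// /refine natrM ler_wpM2l// ler_nat leq_exp2l// leq_subr//.
Qed.

Lemma stationary_functional : exists mu : probability (borelV R n) R,
  (forall f b i, Cb f -> \int[mu]_x S (i%:R * mesh b) f x = \int[mu]_x f x) /\
  (forall k, exists C, forall M, 0 <= M -> \int[mu]_x truncated_power k M x <= C).
Proof.
have [U [L [UP ooU aL]]] := ultralimit average_bounded.
have avg_le f c : Cb f -> (\forall N \near \oo, average f N <= c) -> L f <= c.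
  move=> bf h; apply: (@closed_cvg _ _ U _ (average f) [set y | y <= c]) (aL f bf).
    exact: closed_le.
  exact: ooU.
have limE f l : Cb f -> average f @ U --> l -> L f = l.
  by move=> bf h; exact: (@cvg_unique _ (@Rhausdorff R) _ _ _ _ (aL f bf) h).
have tp_bound k : exists C, forall M, 0 <= M -> L (truncated_power k M) <= C.
  have [m [C [C0 hC]]] := semi_truncated_le k; exists C => M M0.
  apply: avg_le; first exact: truncated_power_Cb.
  by exists m => // N /= mN; apply: average_le => j; exact: hC.
have L_add f g : Cb f -> Cb g -> L (fun x => f x + g x) = L f + L g.
  move=> bf bg; apply: limE; first exact: Cb_add.
  have -> : average (fun x => f x + g x) = fun N => average f N + average g N.
    apply/funext => N; rewrite /average -mulrDr -big_split /=; congr (_ * _).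
    apply: eq_bigr => j _; rewrite /S /semi RintegralD//; exact: semi_integrable.
  exact: (cvgD (aL f bf) (aL g bg)).
have L_scale a f : Cb f -> L (fun x => a * f x) = a * L f.
  move=> bf; apply: limE; first exact: Cb_scale.
  have -> : average (fun x => a * f x) = fun N => a * average f N.
    apply/funext => N; rewrite /average [RHS]mulrCA; congr (_ * _).
    rewrite mulr_sumr; apply: eq_bigr => j _; rewrite /S /semi RintegralZl//; exact: semi_integrable.
  exact: (cvgM (cvg_cst a) (aL f bf)).
have L_ge0 f : Cb f -> (forall x, 0 <= f x) -> 0 <= L f.
  move=> bf f0; have := @avg_le (fun x => (-1) * f x) 0 (Cb_scale _ bf).
  rewrite L_scale// mulN1r oppr_le0; apply; apply: nearW => N; apply: average_le => j.
  rewrite /S /semi RintegralZl//; last exact: semi_integrable.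
  by rewrite mulN1r oppr_le0; apply: Rintegral_ge0.
have L_mono f g : Cb f -> Cb g -> (forall x, f x <= g x) -> L f <= L g.
  move=> bf bg fg; have := @L_ge0 (fun x => g x + (-1) * f x).
  rewrite L_add ?L_scale//; last exact: Cb_scale.
  rewrite mulN1r subr_ge0; apply; first by apply: Cb_add => //; exact: Cb_scale.
  by move=> x; rewrite mulN1r subr_ge0.
have L_one : L (fun=> 1) = 1.
  apply: limE; first exact: Cb_cst.
  have -> : average (fun=> 1) = fun=> 1.
    apply/funext => N; rewrite /average.
    under eq_bigr do rewrite /S /semi Rintegral_cst// mul1r (congr1 fine (probability_setT P)).
    by rewrite sumr_const card_ord mulVf// pnatr_eq0 -lt0n expn_gt0.
  exact: cvg_cst.
have L_tight e : 0 < e -> exists r : R, forall f, Cb f ->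
    (forall x, 0 <= f x <= 1) -> (forall x, `|x| <= r -> f x = 0) -> L f <= e.
  move=> e0; have [C hC] := tp_bound 0%N.
  (* Chebyshev's argument: a function vanishing on the ball is at most [min (V, r) / r], since
     [V >= |x|^2 >= r] outside it; and [C <= r * e]. *)
  pose r := 1 + `|C| / e.
  have r1 : 1 <= r by rewrite lerDl divr_ge0// ltW.
  have r0 : 0 < r by exact: lt_le_trans r1.
  exists r => f bf f01 fr.
  have bt := truncated_power_Cb 0 (ltW r0).
  apply: (@le_trans _ _ (L (fun x => r^-1 * truncated_power 0 r x))).
    apply: L_mono => //; first exact: Cb_scale.
    move=> x; rewrite ler_pdivlMl//.
    have t0 : 0 <= truncated_power 0 r x by rewrite le_min exprn_ge0 ?(ltW r0)// (le_trans _ (V1 x)).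
    have [xr|xr] := lerP `|x| r; first by rewrite fr// mulr0.
    have -> : truncated_power 0 r x = r.
      rewrite /truncated_power min_r// expr1; apply: (@le_trans _ _ (`|x| ^+ 2)).
        by rewrite expr2 -[leLHS]mulr1 ler_pM// ?ltW// (le_lt_trans r1).
      by rewrite (le_trans (norm_sqr_le_dotv x))// /V lerDr.
    by have /andP[_ f1] := f01 x; rewrite ger_pMr.
  rewrite L_scale// ler_pdivrMl//; apply: le_trans (hC _ (ltW r0)) _.
  apply: le_trans (ler_norm C) _.
  by rewrite /r mulrDl mul1r divfK ?gt_eqF// lerDr ltW.
have [mu muE] := riesz_probability L_add L_scale L_mono L_one L_tight.
exists mu; split => [f b i bf|k].
  rewrite !muE//; last exact: sCb.
  apply: limE; first exact: sCb.
  have h : (fun N => average (S (i%:R * mesh b) f) N - average f N) @ U --> (0 : R).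
    move=> B nB; apply: ooU; exact: (average_invariant b i bf nB).
  have -> : average (S (i%:R * mesh b) f) =
      fun N => (average (S (i%:R * mesh b) f) N - average f N) + average f N.
    by apply/funext => N; rewrite subrK.
  by rewrite -[L f]add0r; exact: (cvgD h (aL f bf)).
have [C hC] := tp_bound k; exists C => M M0; rewrite muE; first exact: hC.
exact: truncated_power_Cb.
Qed.

Lemma dyadic_approx (t : R) : 0 <= t ->
  (fun k => (Num.truncn (t * 2 ^+ k))%:R * mesh k) @ \oo --> t.
Proof.
move=> t0; apply/cvgrPdist_le => e e0; have [m hm] := mesh_small e0.
exists m => // k /= mk.
have tk : 0 <= t * 2 ^+ k by rewrite mulr_ge0// exprn_ge0.
have := truncn_itv tk; set i := Num.truncn _ => /andP[i1 i2].
have me : mesh k <= e :> R.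
  apply: le_trans hm; rewrite /mesh -(subnK mk) exprD ger_pMl ?exprn_gt0//.
  by rewrite exprn_ile1// invf_le1// ler1n.
have tE : t = t * 2 ^+ k * mesh k by rewrite /mesh -mulrA -exprMn divff// expr1n mulr1.
have mk0 : (0 : R) < mesh k by exact: mesh_gt0.
rewrite {1}tE -mulrBl normrM (gtr0_norm mk0) ger0_norm ?subr_ge0//.
apply: le_trans me; rewrite ger_pMl//.
by move: i2; rewrite -natr1; lra.
Qed.

Let transition t (E : set (borelV R n)) (x : borelV R n) : \bar R := P [set w | E (X x t w)].

Let measurable_preim t E x : 0 <= t -> measurable E -> measurable [set w | E (X x t w)].
Proof. by move=> t0 mE; have := mX x t0 measurableT mE; rewrite setTI. Qed.

Lemma stationary_exists : exists mu : probability (borelV R n) R,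
  (forall t E, 0 <= t -> measurable E -> (\int[mu]_x P [set w | E (X x t w)] = mu E)%E) /\
  (forall k, mu.-integrable setT (fun x => (V x ^+ k.+1)%:E)).
Proof.
have [mu [inv mom]] := stationary_functional; exists mu.
have Cb_int f : Cb f -> mu.-integrable setT (EFin \o (f : borelV R n -> R)).
  move=> [cf [M fM]]; apply: (@bounded_integrable _ _ _ mu _ M) => //.
  exact: borel_measurable_continuous.
split; last first.
  move=> k; have [C hC] := mom k.
  have [] := @mean_le_fatou _ _ _ mu (fun j x => truncated_power k j%:R x) (fun x => V x ^+ k.+1) C.
  - by move=> j x; rewrite le_min ler0n andbT exprn_ge0// (le_trans _ (V1 x)).
  - by move=> j; split; [apply: Cb_int; exact: truncated_power_Cb|exact: hC].
  - move=> x; apply: cvg_near_cst; exists (Num.truncn (V x ^+ k.+1)).+1 => // j /= hj.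
    rewrite /truncated_power min_l//; apply: le_trans (ltW (truncnS_gt _)) _.
    by rewrite ler_nat.
  - by move=> _ [].
have invt t f : 0 <= t -> Cb f ->
    measurable_fun setT (S t f : borelV R n -> R) /\ \int[mu]_x S t f x = \int[mu]_x f x.
  move=> t0 bf; have [cf [M fM]] := bf.
  pose t_ k : R := (Num.truncn (t * 2 ^+ k))%:R * mesh k.
  have ct : t_ @ \oo --> t by exact: dyadic_approx.
  have cS x : S (t_ k) f x @[k --> \oo] --> S t f x by apply: stc => // k; exact: time_ge0.
  have mSk k : measurable_fun setT (S (t_ k) f : borelV R n -> R).
    by apply: borel_measurable_continuous; have [] := sCb k (Num.truncn (t * 2 ^+ k)) bf.
  have mS : measurable_fun setT (S t f : borelV R n -> R).
    by apply: (measurable_fun_cvg mSk) => x _; exact: cS.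
  split => //; have := @bounded_convergence _ _ _ mu (fun k => S (t_ k) f) (S t f) M mSk mS.
  have -> : (fun k => \int[mu]_x S (t_ k) f x) = fun=> \int[mu]_x f x.
    by apply/funext => k; exact: inv.
  have SM k x : `|S (t_ k) f x| <= M by apply: semi_bounded => //; exact: time_ge0.
  have aeS : {ae mu, forall x, S (t_ k) f x @[k --> \oo] --> S t f x}.
    by apply: aeW => x; exact: cS.
  move=> /(_ SM aeS) h.
  have c1 : (fun _ : nat => \int[mu]_x f x) @ \oo --> \int[mu]_x f x by exact: cvg_cst.
  exact: (@cvg_unique _ (@Rhausdorff R) _ _ _ _ h c1).
move=> t E t0; move: E.
(* Measurability of the transition kernel in the starting point is part of the induction, since it
   is not among the data. *)
suff main E : measurable E -> measurable_fun setT (transition t E) /\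
    (\int[mu]_x transition t E x = mu E)%E by move=> E mE; have [] := main E mE.
have trans_fin E' x : measurable E' -> transition t E' x \is a fin_num.
  by move=> mE; apply: fin_num_measure; exact: measurable_preim.
have trans_int E' : measurable E' -> measurable_fun setT (transition t E') ->
    mu.-integrable setT (transition t E').
  move=> mE mt; apply: (@le_integrable _ _ _ mu setT measurableT _ (fun=> 1%E)) => //.
    move=> x _; rewrite gee0_abs//= normr1; apply: probability_le1; exact: measurable_preim.
  by have := Cb_int _ (Cb_cst 1).
apply: (@dynkin_induction _ (borelV R n) open (fun E => measurable_fun setT (transition t E) /\
    (\int[mu]_x transition t E x = mu E)%E)) => //.
- by move=> A B; exact: openI.
- have -> : transition t setT = fun=> 1%E by apply/funext => x; exact: probability_setT.
  by split; [exact: measurable_cst|rewrite integral_cst// mul1e].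
- move=> U oU; have mU : measurable (U : set (borelV R n)) by exact: sub_sigma_algebra.
  have [phi [bphi phi01 _ phi0 phi1]] := open_indicator_approx oU.
  have phiU x : phi ^~ x @ \oo --> (\1_U x : R).
    apply: cvg_near_cst; rewrite indicE; have [Ux|Ux] := pselect (U x).
      by have [k0 hk] := phi1 x Ux; exists k0 => // k /= /hk ->; rewrite mem_set.
    by apply: nearW => k; rewrite phi0// memNset.
  have phi_le k x : `|phi k x| <= 1 by have /andP[h0 h1] := phi01 k x; rewrite ger0_norm.
  have mind : measurable_fun setT (\1_U : borelV R n -> R) by exact: measurable_indic.
  have indE x : \int[P]_w (\1_U (X x t w) : R) = fine (transition t U x).
    rewrite /Rintegral /transition -[X in P X]setIT -integral_indic//; first exact: measurable_preim.
  have cQ x : S t (phi k) x @[k --> \oo] --> fine (transition t U x).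
    rewrite -indE; apply: (@bounded_convergence _ _ _ _ _ _ 1) => //.
    - by move=> k; apply: mfX => //; have [] := bphi k.
    - exact: (measurableT_comp mind (mX x t0)).
    - by apply: aeW => w; exact: phiU.
  have mQ : measurable_fun setT (fun x : borelV R n => fine (transition t U x)).
    have mSk k : measurable_fun setT (S t (phi k) : borelV R n -> R).
      by have [] := invt t (phi k) t0 (bphi k).
    by apply: (measurable_fun_cvg mSk) => x _; exact: cQ.
  have tE : transition t U = EFin \o (fun x => fine (transition t U x)).
    by apply/funext => x /=; rewrite fineK// trans_fin.
  have mt : measurable_fun setT (transition t U) by rewrite tE; exact/measurable_EFinP.
  split => //.
  have h1 : \int[mu]_x S t (phi k) x @[k --> \oo] --> \int[mu]_x fine (transition t U x).
    apply: (@bounded_convergence _ _ _ _ _ _ 1) => //.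
    - by move=> k; have [] := invt t (phi k) t0 (bphi k).
    - by move=> k x; apply: semi_bounded => //; have [] := bphi k.
    - by apply: aeW => x; exact: cQ.
  have h2 : \int[mu]_x phi k x @[k --> \oo] --> \int[mu]_x (\1_U x : R).
    apply: (@bounded_convergence _ _ _ _ _ _ 1) => //.
    - by move=> k; apply: borel_measurable_continuous; have [] := bphi k.
    - by apply: aeW => x; exact: phiU.
  have h3 : \int[mu]_x fine (transition t U x) = \int[mu]_x (\1_U x : R).
    have e : (fun k => \int[mu]_x S t (phi k) x) = (fun k => \int[mu]_x phi k x).
      by apply/funext => k; have [_ ->] := invt t (phi k) t0 (bphi k).
    by rewrite -e in h2; exact: (@cvg_unique _ (@Rhausdorff R) _ _ _ _ h1 h2).
  have h4 : (\int[mu]_x transition t U x = (\int[mu]_x fine (transition t U x))%:E)%E.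
    have e : (\int[mu]_x (fine (transition t U x))%:E = \int[mu]_x transition t U x)%E.
      by apply: eq_integral => x _; rewrite fineK// trans_fin.
    by rewrite /Rintegral e fineK//; apply: integrable_fin_num => //; exact: trans_int.
  rewrite h4 h3 /Rintegral integral_indic// setIT fineK//; exact: fin_num_measure.
- move=> A mA [mt it].
  have tC : transition t (~` A) = (fun x => 1%E - transition t A x)%E.
    by apply/funext => x; rewrite /transition -probability_setC//; exact: measurable_preim.
  rewrite tC; split; first by apply: emeasurable_funB => //; exact: measurable_cst.
  rewrite integralB//; [|by have := Cb_int _ (Cb_cst 1)|exact: trans_int].
  rewrite [RHS]probability_setC// it; congr (_ - _)%E.
  by rewrite integral_cst// mul1e; exact: probability_setT.
- move=> A mA tA hA.
  have tU : transition t (\bigcup_k A k) = (fun x => \sum_(0 <= k <oo) transition t (A k) x)%E.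
    apply/funext => x; rewrite /transition.
    have -> : [set w | (\bigcup_k A k) (X x t w)] = \bigcup_k [set w | A k (X x t w)] by [].
    rewrite measure_bigcup//; [|by move=> k _; exact: measurable_preim|]; last first.
      by move=> i j _ _ [w [wi wj]]; apply: (tA i j) => //; exists (X x t w).
    by apply: eq_eseriesl => k; rewrite in_setT.
  have mU : measurable_fun setT (transition t (\bigcup_k A k)).
    rewrite tU; apply: ge0_emeasurable_sum => [k x _ _|k _]; first exact: measure_ge0.
    by have [] := hA k.
  split => //; rewrite tU integral_nneseries//; last by move=> k; have [] := hA k.
  under eq_eseriesr do rewrite (hA _).2.
  rewrite measure_bigcup//.
  by apply: eq_eseriesl => k; rewrite in_setT.
Qed.

End StationaryMeasure.

Lemma ae_witness d (T : measurableType d) (R : realType) (P : probability T R) (Q : T -> Prop) :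
  {ae P, forall w, Q w} -> exists w, Q w.
Proof.
move=> [N [mN PN0 hN]]; apply: contrapT => nQ.
have : P setT = 0%E.
  apply/eqP; rewrite -measure_le0 -PN0; apply: le_measure; rewrite ?inE//.
  by move=> w _; apply: hN => Qw; apply: nQ; exists w.
by move=> /eqP; rewrite probability_setT onee_eq0.
Qed.

Theorem theorem1p1 (R : realType) (n : nat)
    (B : {bilinear 'cV[R]_n -> 'cV[R]_n -> 'cV[R]_n})
    (B_conserves : forall x : 'cV[R]_n, dotv x (B x x) = 0)
    (A : 'M[R]_n) (A_psd : psdmx A)
    (A_ker : exists x : 'cV[R]_n, kerv A x /\ x <> 0)
    (sigma : 'M[R]_n)
    (d : measure_display) (Omega : measurableType d) (P : probability Omega R)
    (W : R -> Omega -> borelV R n) (W_brownian : standard_brownian_motion P W)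
    (X : 'cV[R]_n -> R -> Omega -> borelV R n)
    (X_sol : forall x : 'cV[R]_n, sde_solution P (drift B A) sigma W x (X x))
    (escape : exists J : nat, forall x : 'cV[R]_n,
        (kerv A `&` @usphere R n) x ->
        forall Y : R -> 'cV[R]_n, ode_solution (fun y => B y y) x Y ->
        exists j : nat, (j <= J)%N /\
          orthproj (orthc (kerv A)) (derive1n j Y 0) <> 0) :
  exists mu : probability (borelV R n) R,
    stationary_measure P X mu /\
    forall p : R, mu.-integrable setT (fun x => (bracket x `^ p)%:E).
Proof.
have [KB KB0 hB] := bilinear_bounded B.
have [KA KA0 hA] := mulmx_bounded A.
have [Ks Ks0 hs] := mulmx_bounded sigma.
pose K : R := 1 + KB + KA + Ks + n%:R.
have n0 : 0 <= n%:R :> R by [].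
have K1 : 1 <= K by rewrite /K; lra.
have mono (a b : R) : a <= K -> 0 <= b -> a * b <= K * b by move=> aK b0; exact: ler_wpM2r.
have BK x y : `|B x y| <= K * (`|x| * `|y|).
  by apply: le_trans (hB x y) (mono _ _ _ _); [rewrite /K; lra|rewrite mulr_ge0].
have AK (x : 'cV[R]_n) : `|A *m x| <= K * `|x|.
  by apply: le_trans (hA x) (mono _ _ _ _) => //; rewrite /K; lra.
have sK (x : 'cV[R]_n) : `|sigma *m x| <= K * `|x|.
  by apply: le_trans (hs x) (mono _ _ _ _) => //; rewrite /K; lra.
have dK (x y : 'cV[R]_n) : `|dotv x y| <= K * (`|x| * `|y|).
  by apply: le_trans (dotv_le_norm x y) (mono _ _ _ _); [rewrite /K; lra|rewrite mulr_ge0].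
have qK (x : 'cV[R]_n) : dotv x x <= K * `|x| ^+ 2.
  by rewrite expr2; apply: le_trans (ler_norm _) (dK _ _).
have Apos := A_psd.2.
have cF := drift_continuous K1 BK AK.
have locF m : exists2 L, 0 <= L & forall x y : 'cV[R]_n,
    `|x| <= m -> `|y| <= m -> `|drift B A x - drift B A y| <= L * `|x - y|.
  have [m0|m0] := lerP 0 m; last first.
    by exists 0 => // x y xm; have := le_lt_trans xm m0; rewrite ltNge normr_ge0.
  exists (2 * K * m + K); first by rewrite addr_ge0 ?mulr_ge0 ?(le_trans _ K1).
  by move=> x y; exact: drift_lipschitz.
have ode : forall x, exists Y, ode_solution (fun y => B y y) x Y.
  apply: (ode_exists B_conserves Apos K1 BK AK dK) => x.
  (* Countably many null sets are avoided at once, so a single noise path drives the solutions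
     started at all the multiples [k.+1%:R *: x]. *)
  have [w hw] : exists w, forall k : nat, exists v,
      [/\ driven (drift B A) (fun t => X (k.+1%:R *: x) (pos_time t) w)
        (fun t => sigma *m (W (pos_time t) w : 'cV[R]_n)) v,
      v 0 = k.+1%:R *: x, continuous (fun t => W (pos_time t) w : 'cV[R]_n) &
      X (k.+1%:R *: x) (pos_time 0) w = k.+1%:R *: x].
    apply: (@ae_witness _ _ _ P); apply/ae_foralln => k.
    exact: (solution_driven cF W_brownian X_sol (k.+1%:R *: x)).
  exists (fun t => sigma *m (W (pos_time t) w : 'cV[R]_n)) => k.
  by have [v [dv v0 _ _]] := hw k; exists (fun t => X (k.+1%:R *: x) (pos_time t) w), v.
have [c c0 contr] := driven_contraction B_conserves A_psd K1 BK AK dK escape ode.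
have crude := @driven_crude _ _ _ _ B_conserves Apos K K1 BK AK dK.
have C0 : 0 <= 16 * K ^+ 2 by rewrite mulr_ge0// sqr_ge0.
have [mu [stat mom]] := stationary_exists
  (fun x t t0 => (X_sol x).1 t t0) (@V_continuous R n)
  (semi_Cb cF locF W_brownian X_sol) (fun b i j f x bf => semi_markov cF locF W_brownian X_sol b i j x bf)
  (fun f x t t_ => @semi_time_cvg _ _ _ _ cF _ _ _ _ W_brownian _ X_sol f x t t_)
  (moment_growth cF W_brownian X_sol K1 sK qK C0 crude)
  (moment_drift cF W_brownian X_sol K1 sK qK C0 crude c0 contr).
exists mu; split.
  move=> t t0 E mE; rewrite -(stat t E t0 mE) /dual_semigroup.
  apply: eq_integral => x _; rewrite /markov_semigroup unlock.
  rewrite -[X in P X]setIT -integral_indic//; last first.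
    by have := (X_sol x).1 t t0 measurableT E mE; rewrite setTI.
move=> p.
have bE (x : 'cV[R]_n) : bracket x = Num.sqrt (1 + dotv x x).
  by rewrite /bracket /enorm sqr_sqrtr// dotv_ge0.
have b1 (x : 'cV[R]_n) : 1 <= bracket x.
  by rewrite bE -[leLHS]sqrtr1 ler_wsqrtr// lerDl dotv_ge0.
(* Since the bracket is at least 1 and [p <= |p| < k.+1], its power [p] is dominated by its power
   [2 * k.+1], that is, by [V ^+ k.+1]; negative [p] is covered. *)
pose k := Num.truncn `|p|.
have mb : measurable_fun setT (@bracket R n : borelV R n -> R).
  apply: borel_measurable_continuous => x.
  rewrite (_ : @bracket R n = fun x => Num.sqrt (1 + dotv x x)); last exact/funext.
  apply: (continuous_comp (f := fun x : 'cV[R]_n => 1 + dotv x x) (g := @Num.sqrt R)).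
    exact: V_continuous.
  exact: sqrt_continuous.
apply: le_integrable (mom k) => //.
  apply/measurable_EFinP; exact: (measurableT_comp (measurable_powR p) mb).
move=> x _ /=; rewrite lee_fin.
have V0 : 0 <= 1 + dotv x x by rewrite addr_ge0// dotv_ge0.
rewrite !ger0_norm ?powR_ge0 ?exprn_ge0//.
have -> : 1 + dotv x x = bracket x ^+ 2 by rewrite bE sqr_sqrtr.
rewrite -exprM -powR_mulrn ?(le_trans ler01)// ler_powR//.
apply: le_trans (ler_norm p) _; apply: le_trans (ltW (truncnS_gt _)) _.
by rewrite ler_nat mul2n -addnn leq_addr.
Qed.
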